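(* Let $G$ be a smooth groupoid. The following are equivalent: (i) $G$ is Morita equivalent to a smooth étale groupoid; (ii) the Lie algebroid $\mathfrak{g}$ of $G$ has an injective anchor map $\alpha:\mathfrak{g}\to TG_0$; (iii) all isotropy Lie groups $G_x^x$ ($x\in G_0$) of $G$ are discrete.
   Context: A groupoid $G$ is a small category in which every arrow is invertible; $G_0$ and $G_1$ denote its sets of objects and arrows, $s,t:G_1\to G_0$ the source and target maps, $u:G_0\to G_1$, $x\mapsto 1_x$, the unit map. $G$ is smooth if $G_0$ and $G_1$ are smooth manifolds ($G_1$ not necessarily Hausdorff), all structure maps (source, target, composition, unit, inverse) are smooth, and $s,t$ are submersions. A smooth groupoid is étale if $s:G_1\to G_0$ is a local diffeomorphism. For $x\in G_0$ put $G_x=s^{-1}(x)$, and $G_x^x=s^{-1}(x)\cap t^{-1}(x)$, a Lie group called the isotropy group of $G$ at $x$. Lie algebroid and anchor: $\mathfrak{g}$ is the vector bundle over $G_0$ with fibre $\mathfrak{g}_x=T_{1_x}(G_x)$, i.e. the restriction along $u$ of $\ker(ds:TG_1\to TG_0)$. The anchor map $\alpha:\mathfrak{g}\to TG_0$ is the vector bundle map induced by $dt$; it is called injective if it is injective on every fibre. Morita equivalence: a homomorphism $\varphi:K\to G$ of smooth groupoids is a smooth functor, given by smooth maps $\varphi_0:K_0\to G_0$ and $\varphi_1:K_1\to G_1$. It is an essential equivalence if the map $s\pi_2:K_0\times_{G_0}G_1\to G_0$, $(y,g)\mapsto s(g)$, defined on the space of pairs $(y,g)\in K_0\times G_1$ with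 $t(g)=\varphi_0(y)$, is a surjective submersion, and the square with horizontal maps $\varphi_1:K_1\to G_1$ and $\varphi_0\times\varphi_0:K_0\times K_0\to G_0\times G_0$ and vertical maps $(s,t):K_1\to K_0\times K_0$ and $(s,t):G_1\to G_0\times G_0$ is a pullback. Two smooth groupoids $G$ and $H$ are Morita equivalent if there exist a third smooth groupoid $K$ and essential equivalences $K\to G$ and $K\to H$. *)

(* Defs.v *)
From HB Require Import structures.
From mathcomp Require Import all_boot all_order all_algebra.
From mathcomp Require Import all_classical all_reals all_analysis.
Set Implicit Arguments.
Unset Strict Implicit.
Unset Printing Implicit Defensive.
Import Order.TTheory GRing.Theory Num.Theory.
Import numFieldNormedType.Exports.
Local Open Scope classical_set_scope.
Local Open Scope ring_scope.

(* In [Ck], [Cinfty] and [smooth_on], the set [U] is always an open set; only *)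
(* the values of the functions on [U] matter.                                 *)
Fixpoint Ck (R : realType) (n m : nat) (k : nat) (U : set 'rV[R]_n)
    (f : 'rV[R]_n -> 'rV[R]_m) : Prop :=
  match k with
  | 0%N => forall x, U x -> {for x, continuous f}
  | k'.+1 => (forall x, U x -> differentiable f x) /\
             (forall v, Ck k' U ('D_v f))
  end.

Definition Cinfty (R : realType) (n m : nat) (U : set 'rV[R]_n)
    (f : 'rV[R]_n -> 'rV[R]_m) : Prop :=
  forall k, Ck k U f.

Lemma near_eq_differentiable (R : realType) (V W : normedModType R)
    (f g : V -> W) (x : V) :
  (\near x, f x = g x) -> differentiable f x -> differentiable g x.
Proof.
move=> fg df.
have hx : forall h : V -> W, (\near x, h x = 0) -> differentiable h x.
  move=> h h0.
  have e : h \o shift x = cst (h x) + (\0 : {linear V -> W}) +o_ 0 id.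
    apply/eqaddoP => e e0; rewrite (nbhs_singleton h0).
    have := h0; rewrite (near_shift 0 x) => h0'.
    near=> y; rewrite -[leLHS]/((`|h (y + x) - (0 + 0)|)).
    have -> : h (y + x) = 0 by near: y; move: h0'; rewrite /= subr0.
    by rewrite addr0 subr0 normr0 mulr_ge0// ltW.
  apply/diff_locallyP; rewrite (diff_unique _ e) //; last exact: cst_continuous.
  by split => //; exact: cst_continuous.
have -> : g = f + (g - f) by rewrite addrC subrK.
apply: differentiableD => //; apply: hx.
by near=> y; rewrite -[LHS]/(g y - f y); apply/eqP; rewrite subr_eq0 eq_sym; apply/eqP; near: y.
Unshelve. all: by end_near. Qed.

Lemma Ck_eq (R : realType) n m k (U : set 'rV[R]_n) (f g : 'rV[R]_n -> 'rV[R]_m) :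
  open U -> (forall x, U x -> f x = g x) -> Ck k U f -> Ck k U g.
Proof.
move=> oU; elim: k f g => [|k IH] f g fg /=.
- move=> Cf x Ux; have fgx : \near x, f x = g x.
    by near=> y; apply: fg; near: y; exact: open_nbhs_nbhs.
  rewrite /prop_for /continuous_at -(fg x)//.
  exact: (cvg_trans (near_eq_cvg fgx) (Cf x Ux)).
- have fgx x : U x -> \near x, f x = g x.
    by move=> Ux; near=> y; apply: fg; near: y; exact: open_nbhs_nbhs.
  move=> [df Df]; split => [x Ux|v].
    exact: (near_eq_differentiable (fgx x Ux) (df x Ux)).
  by apply: IH (Df v) => x Ux; apply: near_eq_derive; exact: fgx.
Unshelve. all: by end_near. Qed.

Lemma row_mx_continuous (R : realType) (T : topologicalType) n m
    (f : T -> 'rV[R]_n) (g : T -> 'rV[R]_m) x :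
  {for x, continuous f} -> {for x, continuous g} ->
  {for x, continuous (fun y => row_mx (f y) (g y))}.
Proof.
move=> cf cg; apply/cvg_ballP => e e0.
have hf : \forall y \near x, ball (f x) e (f y) by exact: (cvg_ball cf e0).
have hg : \forall y \near x, ball (g x) e (g y) by exact: (cvg_ball cg e0).
near=> y.
have [_ hfy] : ball (f x) e (f y) by near: y.
have [_ hgy] : ball (g x) e (g y) by near: y.
by split => // i j; rewrite !mxE; case: splitP => k _; [exact: hfy|exact: hgy].
Unshelve. all: by end_near. Qed.

Lemma row_mx0E (R : realType) n m : exists A : {linear 'rV[R]_n -> 'rV[R]_(n+m)},
 exists B : {linear 'rV[R]_m -> 'rV[R]_(n+m)}, [/\ continuous A, continuous B &
  forall u v, row_mx u v = A u + B v].
Proof.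
exists (mulmxr (row_mx 1%:M 0)), (mulmxr (row_mx 0 1%:M)); split => /=.
- have -> : mulmxr (row_mx 1%:M 0) = (fun u : 'rV[R]_n => row_mx u (0 : 'rV_m)).
    by apply/funext => u /=; rewrite mul_mx_row mulmx1 mulmx0.
  by move=> u; apply: (@row_mx_continuous R _ n m id (fun=> 0)) => //; exact: cst_continuous.
- have -> : mulmxr (row_mx 0 1%:M) = (fun u : 'rV[R]_m => row_mx (0 : 'rV_n) u).
    by apply/funext => u /=; rewrite mul_mx_row mulmx1 mulmx0.
  by move=> u; apply: (@row_mx_continuous R _ n m (fun=> 0) id) => //; exact: cst_continuous.
- by move=> u v; rewrite !mul_mx_row !mulmx1 !mulmx0 add_row_mx addr0 add0r.
Qed.

Lemma is_diff_linear (R : realType) (V W : normedModType R)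
    (L : {linear V -> W}) x : continuous L -> is_diff x L L.
Proof.
by move=> cL; apply: DiffDef; [exact: linear_differentiable|exact: diff_lin].
Qed.

Lemma Ck_row_mx (R : realType) n m n' m' k (U : set 'rV[R]_n) (V : set 'rV[R]_m)
    (f : 'rV[R]_n -> 'rV[R]_n') (g : 'rV[R]_m -> 'rV[R]_m') :
  open U -> open V -> Ck k U f -> Ck k V g ->
  Ck k (lsubmx @^-1` U `&` rsubmx @^-1` V)
       (fun w => row_mx (f (lsubmx w)) (g (rsubmx w))).
Proof.
move=> oU oV; elim: k f g => [|k IH] f g /=.
  move=> Cf Cg w [/= Uw Vw]; apply: row_mx_continuous.
  - by apply: (continuous_comp (f := lsubmx)); [exact: continuous_lsubmx|exact: Cf].
  - by apply: (continuous_comp (f := rsubmx)); [exact: continuous_rsubmx|exact: Cg].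
move=> [df Df] [dg Dg].
have [A [B [cA cB AB]]] := row_mx0E R n' m'.
set F := fun w => _.
have F_diff w : U (lsubmx w) -> V (rsubmx w) -> is_diff w F (fun v =>
    row_mx ('d f (lsubmx w) (lsubmx v)) ('d g (rsubmx w) (rsubmx v))).
  move=> Uw Vw.
  have -> : F = (A \o (f \o lsubmx)) + (B \o (g \o rsubmx)).
    by apply/funext => v; rewrite /F AB.
  have hl : is_diff w (lsubmx : 'rV[R]_(n + m) -> 'rV[R]_n) lsubmx.
    exact/is_diff_linear/continuous_lsubmx.
  have hr : is_diff w (rsubmx : 'rV[R]_(n + m) -> 'rV[R]_m) rsubmx.
    exact/is_diff_linear/continuous_rsubmx.
  have hA x : is_diff x A A by exact: is_diff_linear.
  have hB x : is_diff x B B by exact: is_diff_linear.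
  have hf := differentiableP (df _ Uw); have hg := differentiableP (dg _ Vw).
  apply: is_diff_eq; apply/funext => v.
  by rewrite AB.
split=> [w [/= Uw Vw]|v]; first by have := F_diff w Uw Vw => -[].
apply: (@Ck_eq _ _ _ _ _ (fun w =>
    row_mx ('D_(lsubmx v) f (lsubmx w)) ('D_(rsubmx v) g (rsubmx w)))).
- by apply: openI; apply: open_comp => // w _;
    [exact: continuous_lsubmx|exact: continuous_rsubmx].
- move=> w [/= Uw Vw]; have [dF eF] := F_diff w Uw Vw.
  by rewrite !deriveE ?eF //; [exact: dg|exact: df].
- exact: (IH _ _ (Df (lsubmx v)) (Dg (rsubmx v))).
Qed.

(* The map [cmap] is a homeomorphism from the open set [dom] onto an open     *)
(* subset of R^n, with inverse [cinv]; both are junk outside these sets.      *)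
Record chart (R : realType) (T : topologicalType) (n : nat) := Chart {
  dom : set T;
  cmap : T -> 'rV[R]_n;
  cinv : 'rV[R]_n -> T;
  dom_open : open dom;
  img_open : open (cmap @` dom);
  cmapK : {in dom, cancel cmap cinv};
  cmap_continuous : {in dom, continuous cmap};
  cinv_continuous : {in cmap @` dom, continuous cinv}
}.

Arguments dom_open {R T n} c.
Arguments img_open {R T n} c.

(* Second countable, not necessarily Hausdorff, of constant dimension; the    *)
(* atlas is not required to be maximal.                                       *)
Record manifold (R : realType) := Manifold {
  carrier :> topologicalType;
  dim : nat;
  atlas : set (chart R carrier dim);
  atlas_cover : forall p : carrier, exists c, atlas c /\ dom c p;
  atlas_compat : forall c d, atlas c -> atlas d ->
    Cinfty (cmap c @` (dom c `&` dom d)) (cmap d \o cinv c);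
  manifold_second_countable : @second_countable carrier
}.

Section SmoothMaps.
Variable R : realType.
Implicit Types M N : manifold R.

Definition smooth_on M N (U : set M) (f : M -> N) : Prop :=
  (forall x, U x -> {for x, continuous f}) /\
  forall (c : chart R M (dim M)) (d : chart R N (dim N)),
    atlas c -> atlas d ->
    Cinfty (cmap c @` (U `&` dom c `&` f @^-1` dom d))
           (cmap d \o f \o cinv c).

Definition smooth M N (f : M -> N) : Prop := smooth_on setT f.

Definition local_diffeo M N (f : M -> N) : Prop :=
  forall p : M, exists (U : set M) (h : N -> M),
    [/\ open U /\ U p, open (f @` U), {in U, cancel f h},
        smooth_on U f & smooth_on (f @` U) h].

(* A tangent vector at [p] is given by its coordinates in all charts around   *)
(* [p], related by the derivatives of the changes of charts. As a function on *)
(* all charts it is 0 on the irrelevant ones, so that equality of functions   *)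
(* is equality of tangent vectors and [tangent_space p] is a linear subspace. *)
Definition tangent_family M : Type := chart R M (dim M) -> 'rV[R]_(dim M).

Definition tangent_space M (p : M) : set (tangent_family M) :=
  [set v | (forall c d, atlas c -> dom c p -> atlas d -> dom d p ->
              v d = 'D_(v c) (cmap d \o cinv c) (cmap c p)) /\
           (forall c, ~ (atlas c /\ dom c p) -> v c = 0)].

Definition chart_at M (p : M) : chart R M (dim M) :=
  sval (cid (atlas_cover p)).

(* The differential of [f] at [p], on [tangent_space p]; for a smooth map [f] *)
(* the value does not depend on the chart chosen at [p].                      *)
Definition differential M N (f : M -> N) (p : M) (v : tangent_family M) :
    tangent_family N :=
  fun d => if `[< atlas d /\ dom d (f p) >]
           then 'D_(v (chart_at p)) (cmap d \o f \o cinv (chart_at p))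
                  (cmap (chart_at p) p)
           else 0.

Definition submersion M N (f : M -> N) : Prop :=
  forall p : M,
    set_surj (tangent_space p) (tangent_space (f p)) (differential f p).

(* Fibre products are those of the category of (possibly non-Hausdorff)       *)
(* smooth manifolds.                                                          *)
Definition is_pullback (P A B Z : manifold R) (p : P -> A) (q : P -> B)
    (f : A -> Z) (g : B -> Z) : Prop :=
  [/\ smooth p, smooth q, f \o p = g \o q &
    forall (X : manifold R) (a : X -> A) (b : X -> B),
      smooth a -> smooth b -> f \o a = g \o b ->
      exists! h : X -> P, [/\ smooth h, p \o h = a & q \o h = b]].

End SmoothMaps.

Section Product.
Variable R : realType.

Section ProductChart.
Variables (S T : topologicalType) (n m : nat).
Variables (c : chart R S n) (d : chart R T m).

Let pdom : set (S * T) := dom c `*` dom d.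
Let pmap (x : S * T) : 'rV[R]_(n + m) := row_mx (cmap c x.1) (cmap d x.2).
Let pinv (w : 'rV[R]_(n + m)) : S * T := (cinv c (lsubmx w), cinv d (rsubmx w)).

Lemma prod_imgE (U : set S) (V : set T) : pmap @` (U `*` V) =
  lsubmx @^-1` (cmap c @` U) `&` rsubmx @^-1` (cmap d @` V).
Proof.
apply/seteqP; split => [_ [[x y] [/= xc yd] <-]|w [[x xc xw] [y yd yw]]] /=.
  by rewrite row_mxKl row_mxKr; split; [exists x|exists y].
by exists (x, y) => //; rewrite /pmap /= xw yw hsubmxK.
Qed.

Lemma open_lrsubmx (U : set 'rV[R]_n) (V : set 'rV[R]_m) : open U -> open V ->
  open ((lsubmx : 'rV[R]_(n + m) -> _) @^-1` U `&` rsubmx @^-1` V).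
Proof.
by move=> oU oV; apply: openI; apply: open_comp => // w _;
  [exact: continuous_lsubmx|exact: continuous_rsubmx].
Qed.

Lemma prod_dom_open : open pdom.
Proof.
rewrite openE => -[x y] [/= xc yd]; exists (dom c, dom d) => //=.
by split; [have := dom_open c|have := dom_open d]; rewrite openE; exact.
Qed.

Lemma prod_img_open : open (pmap @` pdom).
Proof. by rewrite prod_imgE; apply: open_lrsubmx; exact: img_open. Qed.

Lemma prod_cmapK : {in pdom, cancel pmap pinv}.
Proof.
move=> [x y]; rewrite inE => -[/= xc yd].
by rewrite /pinv /pmap row_mxKl row_mxKr !cmapK ?inE.
Qed.

Lemma prod_cmap_continuous : {in pdom, continuous pmap}.
Proof.
move=> [x y]; rewrite inE => -[/= xc yd].
apply: (@row_mx_continuous R _ n m (fun z : S * T => cmap c z.1) (cmap d \o snd)).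
- apply: (continuous_comp (f := fst)); first exact: cvg_fst.
  by apply: cmap_continuous; rewrite inE.
- apply: (continuous_comp (f := snd)); first exact: cvg_snd.
  by apply: cmap_continuous; rewrite inE.
Qed.

Lemma prod_cinv_continuous : {in pmap @` pdom, continuous pinv}.
Proof.
move=> w; rewrite inE prod_imgE => -[/= wc wd].
have c1 : {for w, continuous (cinv c \o lsubmx)}.
  apply: continuous_comp; first exact: continuous_lsubmx.
  by apply: cinv_continuous; rewrite inE.
have c2 : {for w, continuous (cinv d \o rsubmx)}.
  apply: continuous_comp; first exact: continuous_rsubmx.
  by apply: cinv_continuous; rewrite inE.
exact: (cvg_pair c1 c2).
Qed.

Definition prod_chart : chart R (S * T)%type (n + m) :=
  Chart prod_dom_open prod_img_open prod_cmapK prod_cmap_continuous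
        prod_cinv_continuous.

End ProductChart.

Variables M N : manifold R.

Definition prod_atlas : set (chart R (M * N)%type (dim M + dim N)) :=
  [set e | exists c d, [/\ atlas c, atlas d & e = prod_chart c d]].

Lemma prod_atlas_cover (p : M * N) : exists c, prod_atlas c /\ dom c p.
Proof.
have [c [ac pc]] := atlas_cover p.1; have [d [ad pd]] := atlas_cover p.2.
by exists (prod_chart c d); split => //; exists c, d.
Qed.

Lemma open_transition (T : topologicalType) n (c d : chart R T n) :
  open (cmap c @` (dom c `&` dom d)).
Proof.
have -> : cmap c @` (dom c `&` dom d) = cmap c @` dom c `&` cinv c @^-1` dom d.
  apply/seteqP; split => [_ [x [xc xd] <-]|_ [[x xc <-]] /=].
    by split; [exists x|rewrite /= cmapK// inE].
  by rewrite cmapK ?inE// => xd; exists x.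
rewrite openE => w [wc wd]; apply: filterI.
  by have := img_open c; rewrite openE; exact.
apply: (@cinv_continuous _ _ _ c); first by rewrite inE.
by have := dom_open d; rewrite openE; exact.
Qed.

Lemma prod_atlas_compat e e' : prod_atlas e -> prod_atlas e' ->
  Cinfty (cmap e @` (dom e `&` dom e')) (cmap e' \o cinv e).
Proof.
move=> [c [d [ac ad ->]]] [c' [d' [ac' ad' ->]]] k /=.
rewrite -setXI prod_imgE.
apply: (@Ck_row_mx R _ _ _ _ k _ _ (cmap c' \o cinv c) (cmap d' \o cinv d)).
- exact: open_transition.
- exact: open_transition.
- exact: atlas_compat.
- exact: atlas_compat.
Qed.

Lemma prod_second_countable : @second_countable (M * N)%type.
Proof.
have [B cB [oB bB]] := manifold_second_countable M.
have [C cC [oC bC]] := manifold_second_countable N.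
exists [set UV.1 `*` UV.2 | UV in B `*` C].
  exact: (sub_countable (card_image_le _ _) (countableX cB cC)).
split => [_ [[U V] [/= BU CV] <-]|[x y] A [[U V] [/= xU yV] UVA]].
  rewrite openE => -[x y] [/= Ux Vy]; exists (U, V) => //=.
  by split; [have := oB _ BU|have := oC _ CV]; rewrite openE; exact.
have [U' [BU' U'x] U'U] := bB x U xU; have [V' [CV' V'y] V'V] := bC y V yV.
exists (U' `*` V'); first by split => //; exists (U', V').
by move=> [a b] [/= /U'U Ua /V'V Vb]; exact: UVA.
Qed.

Definition prod_manifold : manifold R :=
  Manifold prod_atlas_cover prod_atlas_compat prod_second_countable.

End Product.

(* [comp g h] is "g after h"; it is junk unless [src g = tgt h]. The manifold *)
(* [arr] of arrows need not be Hausdorff.                                     *)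
Record smooth_groupoid (R : realType) := SmoothGroupoid {
  obj : manifold R;
  arr : manifold R;
  src : arr -> obj;
  tgt : arr -> obj;
  unit_arr : obj -> arr;
  inv_arr : arr -> arr;
  comp : arr -> arr -> arr;

  src_unit : forall x, src (unit_arr x) = x;
  tgt_unit : forall x, tgt (unit_arr x) = x;
  src_inv : forall g, src (inv_arr g) = tgt g;
  tgt_inv : forall g, tgt (inv_arr g) = src g;
  src_comp : forall g h, src g = tgt h -> src (comp g h) = src h;
  tgt_comp : forall g h, src g = tgt h -> tgt (comp g h) = tgt g;
  compA : forall g h k, src g = tgt h -> src h = tgt k ->
    comp g (comp h k) = comp (comp g h) k;
  comp_unitl : forall g, comp (unit_arr (tgt g)) g = g;
  comp_unitr : forall g, comp g (unit_arr (src g)) = g;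
  comp_invl : forall g, comp (inv_arr g) g = unit_arr (src g);
  comp_invr : forall g, comp g (inv_arr g) = unit_arr (tgt g);

  obj_hausdorff : hausdorff_space obj;
  src_smooth : smooth src;
  tgt_smooth : smooth tgt;
  unit_smooth : smooth unit_arr;
  inv_smooth : smooth inv_arr;
  src_submersion : submersion src;
  tgt_submersion : submersion tgt;
  (* [G2] is the manifold of composable pairs. *)
  comp_smooth : exists (G2 : manifold R) (p q : G2 -> arr),
    is_pullback p q src tgt /\ smooth (fun z => comp (p z) (q z))
}.

Section Groupoids.
Variable R : realType.
Implicit Types G H K : smooth_groupoid R.

Definition etale G : Prop := local_diffeo (@src R G).

Definition isotropy G (x : obj G) : set (arr G) :=
  [set g | src g = x /\ tgt g = x].

(* As a type, [isotropy x] carries the subspace topology from [arr G].        *)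
Definition discrete_isotropy G : Prop :=
  forall (x : obj G) (A : set (isotropy x)), open A.

(* The fibre at [x] of the restriction along the units of ker(ds).            *)
Definition lie_algebroid G (x : obj G) : set (tangent_family (arr G)) :=
  [set v | tangent_space (unit_arr x) v /\ differential (@src R G) (unit_arr x) v = 0].

Definition anchor G (x : obj G) :
    tangent_family (arr G) -> tangent_family (obj G) :=
  differential (@tgt R G) (unit_arr x).

Definition injective_anchor G : Prop :=
  forall x : obj G, set_inj (lie_algebroid x) (anchor x).

Record homomorphism K G := Homomorphism {
  hom0 : obj K -> obj G;
  hom1 : arr K -> arr G;
  hom0_smooth : smooth hom0;
  hom1_smooth : smooth hom1;
  hom_src : forall k, src (hom1 k) = hom0 (src k);
  hom_tgt : forall k, tgt (hom1 k) = hom0 (tgt k);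
  hom_unit : forall y, hom1 (unit_arr y) = unit_arr (hom0 y);
  hom_comp : forall k l, src k = tgt l ->
    hom1 (comp k l) = comp (hom1 k) (hom1 l)
}.

Definition src_tgt G (g : arr G) : prod_manifold (obj G) (obj G) :=
  (src g, tgt g).

Definition hom00 K G (phi : homomorphism K G)
    (y : prod_manifold (obj K) (obj K)) : prod_manifold (obj G) (obj G) :=
  (hom0 phi y.1, hom0 phi y.2).

Definition essential_equivalence K G (phi : homomorphism K G) : Prop :=
  (exists (P : manifold R) (p1 : P -> obj K) (p2 : P -> arr G),
     [/\ is_pullback p1 p2 (hom0 phi) (@tgt R G),
         set_surj setT setT (@src R G \o p2) & submersion (@src R G \o p2)]) /\
  is_pullback (hom1 phi) (@src_tgt K) (@src_tgt G) (hom00 phi).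

Definition morita_equivalent G H : Prop :=
  exists (K : smooth_groupoid R) (phi : homomorphism K G)
         (psi : homomorphism K H),
    essential_equivalence phi /\ essential_equivalence psi.

End Groupoids.

(* Main.v *)
(* Write kappa(g) for the dimension of ker(ds) /\ ker(dt) at an arrow g. Right *)
(* translation by g is a diffeomorphism between source fibres that commutes   *)
(* with t, so dt(ker ds) is the same subspace of the tangent space at t(g)    *)
(* whether it is computed at g or at the unit of t(g). With inversion this    *)
(* gives kappa(g) = kappa(1_(t g)) = kappa(1_(s g)), and the anchor is        *)
(* injective at x exactly when kappa(1_x) = 0.                                *)
(*   If kappa vanishes then (s, t) is an immersion, hence locally injective,  *)
(* and the isotropy groups are discrete. If kappa(1_x) > 0 then t has         *)
(* constant rank on the source fibre of x, so its fibre through 1_x contains  *)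
(* an injectively parametrized manifold of positive dimension. The isotropy   *)
(* group at x is then not discrete; moreover the universal property of an     *)
(* essential equivalence K -> G lifts this family to K, and its image in an   *)
(* etale groupoid H is locally constant, so G is not Morita equivalent to H.  *)
(*   If the anchor is injective, countably many discs transverse to the       *)
(* orbits meet all the orbits. Let T be their disjoint union. The map         *)
(* T x_G0 G1 -> G0 induced by s is a surjective local diffeomorphism, so the  *)
(* restriction of G to T is etale and its map to G is an essential            *)
(* equivalence.                                                               *)

(* The three conditions meet in the integer $\kappa$, which is [isotropy_rank]. At a unit it is the
   dimension of the kernel of the anchor, so (ii) says that it vanishes at units
   ([injective_anchorP]); [isotropy_rank_tgt] and [isotropy_rank_src] carry this to all arrows.

   The size of the isotropy enters through [isotropy_curve]: if $\kappa(1_x) > 0$, a ball of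
   positive dimension maps smoothly and injectively into the isotropy at $x$. It comes from
   [constant_rank_fibre] applied to [tgt] on the source fibre of $x$. Such a family contradicts
   (iii) at once ([discrete_injective_anchor]). It contradicts (i) because it can be conjugated into
   the image of an essential equivalence, lifted, and pushed to an étale groupoid, where arrows
   close to a given one are determined by their source ([etale_morita_injective_anchor]).
   Conversely, [injective_anchor_discrete] is the local injectivity of the immersion [(src, tgt)].

   For (ii) implies (i), the tangent space of $G_0$ along a transversal is the direct sum of the
   tangent spaces of the transversal and of the orbit. This makes [sat], which sends an arrow ending
   on the transversal to its source, a local diffeomorphism ([sat_free], [sat_full]); the source map
   of the restricted groupoid is a base change of [sat], hence étale. [local_transversal] finds the
   arrows from nearby points to a disc by the inverse function theorem, and second countability
   leaves countably many discs in [complete_transversal].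

   The analysis rests on [inverse_function]; through [manifold_inverse] and [submersion_chart] it
   yields [fibre_product], from which the source fibres and the restricted groupoid are built. *)
From HB Require Import structures.
From mathcomp Require Import all_boot all_order all_algebra.
From mathcomp Require Import all_classical all_reals all_analysis.
From mathcomp Require Import ring lra.
Require Import Defs.
Set Implicit Arguments.
Unset Strict Implicit.
Unset Printing Implicit Defensive.
Import Order.TTheory GRing.Theory Num.Theory.
Import numFieldNormedType.Exports.
Local Open Scope classical_set_scope.
Local Open Scope ring_scope.

(** * Differential calculus on row vectors *)

Section Euclid.
Variable R : realType.
Implicit Types (n m k : nat) (W : normedModType R).

(* [Ck] with an arbitrary normed codomain, so that real-valued functions are  *)
(* covered.                                                                   *)
Fixpoint smoothness (n : nat) (W : normedModType R) (k : nat) (U : set 'rV[R]_n)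
    (f : 'rV[R]_n -> W) : Prop :=
  match k with
  | 0%N => forall x, U x -> {for x, continuous f}
  | k'.+1 => (forall x, U x -> differentiable f x) /\
             (forall v, smoothness k' U ('D_v f))
  end.

Lemma CkE n m k (U : set 'rV[R]_n) (f : 'rV[R]_n -> 'rV[R]_m) :
  Ck k U f = smoothness k U f.
Proof.
elim: k f => [//|k IH] f /=.
by congr (_ /\ _); apply/eq_forall => v; rewrite IH.
Qed.

Lemma smoothness_sub n W k (U V : set 'rV[R]_n) (f : 'rV[R]_n -> W) :
  V `<=` U -> smoothness k U f -> smoothness k V f.
Proof.
move=> VU; elim: k f => [|k IH] f /=; first by move=> Cf x /VU; exact: Cf.
by move=> [df Df]; split => [x /VU|v]; [exact: df|exact: IH (Df v)].
Qed.

(** Each clause of [smoothness] is a condition at the points of the set on a function defined on the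
    whole space, so it passes to arbitrary unions. *)
Lemma smoothness_local n W k (U : set 'rV[R]_n) (f : 'rV[R]_n -> W) :
  (forall x, U x -> exists2 V, V x & smoothness k V f) -> smoothness k U f.
Proof.
elim: k f => [|k IH] f /= H.
  by move=> x /H[V Vx]; exact.
split => [x /H[V Vx [df _]]|v]; first exact: df.
by apply: IH => x /H[V Vx [_ Df]]; exists V.
Qed.

Lemma smoothnessS n W k (U : set 'rV[R]_n) (f : 'rV[R]_n -> W) :
  smoothness k.+1 U f -> smoothness k U f.
Proof.
elim: k f => [|k IH] f /= [df Df].
  by move=> x Ux; apply: differentiable_continuous; exact: df.
by split => // v; exact/IH/Df.
Qed.

Lemma near_open n (U : set 'rV[R]_n) x : open U -> U x -> \near x, U x.
Proof. by move=> oU Ux; apply: open_nbhs_nbhs. Qed.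

Lemma smoothness_eq n W k (U : set 'rV[R]_n) (f g : 'rV[R]_n -> W) :
  open U -> (forall x, U x -> f x = g x) -> smoothness k U f -> smoothness k U g.
Proof.
move=> oU; elim: k f g => [|k IH] f g fg /=.
- move=> Cf x Ux; have fgx : \near x, f x = g x.
    by near=> y; apply: fg; near: y; exact: near_open.
  rewrite /prop_for /continuous_at -(fg x)//.
  exact: (cvg_trans (near_eq_cvg fgx) (Cf x Ux)).
- have fgx x : U x -> \near x, f x = g x.
    by move=> Ux; near=> y; apply: fg; near: y; exact: near_open.
  move=> [df Df]; split => [x Ux|v].
    exact: (near_eq_differentiable (fgx x Ux) (df x Ux)).
  by apply: IH (Df v) => x Ux; apply: near_eq_derive; exact: fgx.
Unshelve. all: by end_near. Qed.

Lemma smoothness_cst n W k (U : set 'rV[R]_n) (w : W) :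
  open U -> smoothness k U (fun=> w).
Proof.
move=> oU; elim: k w => [|k IH] w /=; first by move=> x _; exact: cst_continuous.
split=> [x _|v]; first exact: differentiable_cst.
apply: (smoothness_eq oU _ (IH 0)) => x _.
by rewrite derive_cst.
Qed.

Lemma smoothness_lin n W W' (L : {linear W -> W'}) k (U : set 'rV[R]_n)
    (f : 'rV[R]_n -> W) : continuous L -> open U ->
  smoothness k U f -> smoothness k U (L \o f).
Proof.
move=> cL oU; elim: k f => [|k IH] f /= Cf.
  by move=> x Ux; apply: continuous_comp; [exact: Cf|exact: cL].
case: Cf => df Df; split=> [x Ux|v].
  by apply: differentiable_comp; [exact: df|exact: linear_differentiable].
apply: (smoothness_eq oU _ (IH _ (Df v))) => x Ux /=.
have dL y : differentiable L y by exact: linear_differentiable.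
rewrite [RHS]deriveE; last by apply: differentiable_comp => //; exact: df.
by rewrite diff_comp ?diff_lin ?deriveE //; exact: df.
Qed.

Lemma smoothness_add n W k (U : set 'rV[R]_n) (f g : 'rV[R]_n -> W) : open U ->
  smoothness k U f -> smoothness k U g -> smoothness k U (f \+ g).
Proof.
move=> oU; elim: k f g => [|k IH] f g /= Cf Cg.
  by move=> x Ux; apply: continuousD; [exact: Cf|exact: Cg].
case: Cf Cg => df Df [dg Dg]; split=> [x Ux|v].
  by apply: differentiableD; [exact: df|exact: dg].
apply: (smoothness_eq oU _ (IH _ _ (Df v) (Dg v))) => x Ux /=.
rewrite -[RHS]/('D_v (f + g) x) deriveD //; apply: diff_derivable.
  exact: df.
exact: dg.
Qed.

Lemma smoothness_sum n W k (U : set 'rV[R]_n) (I : finType)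
    (f : I -> 'rV[R]_n -> W) : open U ->
  (forall i, smoothness k U (f i)) -> smoothness k U (fun x => \sum_i f i x).
Proof.
move=> oU Cf.
have H (s : seq I) : smoothness k U (fun x => \sum_(i <- s) f i x).
  elim: s => [|i s IH].
    apply: (smoothness_eq oU _ (smoothness_cst k 0 oU)) => x _.
    by rewrite big_nil.
  apply: (smoothness_eq oU _ (smoothness_add oU (Cf i) IH)) => x _.
  by rewrite big_cons.
exact: H.
Qed.

Lemma smoothness_mul n k (U : set 'rV[R]_n) (f g : 'rV[R]_n -> R) : open U ->
  smoothness k U f -> smoothness k U g -> smoothness k U (f \* g).
Proof.
move=> oU; elim: k f g => [|k IH] f g Cf Cg.
  by move=> x Ux; apply: continuousM; [exact: Cf|exact: Cg].
have [Cf' Cg'] := (smoothnessS Cf, smoothnessS Cg).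
case: Cf Cg => df Df [dg Dg]; split=> [x Ux|v].
  by apply: differentiableM; [exact: df|exact: dg].
apply: (smoothness_eq oU _
  (smoothness_add oU (IH _ _ Cf' (Dg v)) (IH _ _ Cg' (Df v)))) => x Ux /=.
rewrite -[RHS]/('D_v (f * g) x) deriveM //; apply: diff_derivable.
  exact: df.
exact: dg.
Qed.

Lemma smoothness_prod n k (U : set 'rV[R]_n) (I : finType)
    (f : I -> 'rV[R]_n -> R) : open U ->
  (forall i, smoothness k U (f i)) -> smoothness k U (fun x => \prod_i f i x).
Proof.
move=> oU Cf.
have H (s : seq I) : smoothness k U (fun x => \prod_(i <- s) f i x).
  elim: s => [|i s IH].
    apply: (smoothness_eq oU _ (smoothness_cst k (1 : R) oU)) => x _.
    by rewrite big_nil.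
  apply: (smoothness_eq oU _ (smoothness_mul oU (Cf i) IH)) => x _.
  by rewrite big_cons.
exact: H.
Qed.

Lemma smoothness_inv n k (U : set 'rV[R]_n) (f : 'rV[R]_n -> R) : open U ->
  (forall x, U x -> f x != 0) ->
  smoothness k U f -> smoothness k U (fun x => (f x)^-1).
Proof.
move=> oU f0; elim: k => [|k IH] Cf.
  by move=> x Ux; apply: continuousV; [exact: f0|exact: Cf].
have Cf' := IH (smoothnessS Cf).
case: Cf => df Df; split=> [x Ux|v].
  by apply: differentiableV; [exact: df|exact: f0].
have Cm := smoothness_mul oU (smoothness_mul oU Cf' Cf') (Df v).
have := smoothness_mul oU (smoothness_cst k (-1 : R) oU) Cm.
apply: (smoothness_eq oU) => x Ux /=.
rewrite [RHS]deriveV; [|exact: f0|by apply: diff_derivable; exact: df].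
by rewrite /GRing.scale/= mulN1r mulNr expr2 invfM.
Qed.

Lemma rV_linear_continuous n W (L : {linear 'rV[R]_n -> W}) : continuous L.
Proof.
have -> : (L : _ -> _) = (fun x => \sum_i x 0 i *: L (delta_mx 0 i)).
  apply/funext => x; rewrite {1}(row_sum_delta x) linear_sum.
  by apply: eq_bigr => i _; rewrite linearZ.
apply: continuous_big => [|i _ x]; first exact: add_continuous.
apply: continuousZr_tmp.
by move: x; exact: coord_continuous.
Qed.


Lemma smoothness_coord n m k (U : set 'rV[R]_n) (f : 'rV[R]_n -> 'rV[R]_m) :
  open U ->
  smoothness k U f <-> forall j, smoothness k U (fun x => f x 0 j).
Proof.
move=> oU; split=> [Cf j|Cf].
  have @L : {linear 'rV[R]_m -> R}.
    by exists (fun N : 'rV[R]_m => N 0 j); do 2![eexists]; do ?[constructor];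
      rewrite ?mxE// => ? *; rewrite ?mxE//; move=> ?; rewrite !mxE.
  exact: (smoothness_lin (@rV_linear_continuous m R L) oU Cf).
have Llin j : linear ( *:%R^~ (delta_mx 0 j) : R -> 'rV[R]_m).
  by move=> a x y; rewrite scalerDl scalerA.
pose LM j := GRing.isLinear.Build _ _ _ _ _ (Llin j).
pose L j : {linear _ -> _} := HB.pack ( *:%R^~ (delta_mx 0 j)) (LM j).
have cL j : continuous (L j) by move=> r; exact: scalel_continuous.
have := smoothness_sum oU (fun j => smoothness_lin (cL j) oU (Cf j)).
apply: (smoothness_eq oU) => x _.
by rewrite [RHS]row_sum_delta.
Qed.


Lemma diff_coord (V : normedModType R) m (f : V -> 'rV[R]_m) x v j : differentiable f x ->
  'D_v (fun y => f y 0 j) x = ('D_v f x) 0 j.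
Proof.
by move=> df; rewrite derive_mx ?mxE //; exact: diff_derivable.
Qed.

Lemma differentiable_entry (V : normedModType R) m (f : V -> 'rV[R]_m) x j :
  differentiable f x -> differentiable (fun y => f y 0 j : R) x.
Proof.
move=> df; apply: (@differentiable_comp _ _ _ _ f (fun N => N 0 j)) => //.
exact: differentiable_coord.
Qed.

Lemma diff_delta n W (f : 'rV[R]_n -> W) x v : differentiable f x ->
  'D_v f x = \sum_i v 0 i *: 'D_(delta_mx 0 i) f x.
Proof.
move=> df; rewrite deriveE // {1}(row_sum_delta v) linear_sum.
by apply: eq_bigr => i _; rewrite linearZ /= deriveE.
Qed.

(** The chain rule in coordinates, $D_v(g\circ f)=\sum_j (D_v f)_j\,(\partial_j g\circ f)$,
    expresses the derivative by products of functions of class $C^k$; real values of [g] make these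
    products available. *)
Lemma smoothness_comp1 n m k (U : set 'rV[R]_n) (V : set 'rV[R]_m)
    (f : 'rV[R]_n -> 'rV[R]_m) (g : 'rV[R]_m -> R) :
  open U -> open V -> (forall x, U x -> V (f x)) ->
  smoothness k U f -> smoothness k V g -> smoothness k U (g \o f).
Proof.
move=> oU oV fUV; elim: k g => [|k IH] g Cf Cg.
  by move=> x Ux; apply: continuous_comp; [exact: Cf|apply: Cg; exact: fUV].
have Cf' := smoothnessS Cf; case: Cf Cg => df Df [dg Dg].
split=> [x Ux|v].
  by apply: differentiable_comp; [exact: df|apply: dg; exact: fUV].
have H j := smoothness_mul oU ((smoothness_coord _ _ oU).1 (Df v) j)
  (IH _ Cf' (Dg (delta_mx 0 j))).
apply: (smoothness_eq oU _ (smoothness_sum oU H)) => x Ux /=.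
have [dfx dgx] := (df _ Ux, dg _ (fUV _ Ux)).
rewrite [RHS]deriveE; last exact: differentiable_comp.
by rewrite diff_comp //= -!deriveE // [RHS]diff_delta.
Qed.

Lemma smoothness_comp n m p k (U : set 'rV[R]_n) (V : set 'rV[R]_m)
    (f : 'rV[R]_n -> 'rV[R]_m) (g : 'rV[R]_m -> 'rV[R]_p) :
  open U -> open V -> (forall x, U x -> V (f x)) ->
  smoothness k U f -> smoothness k V g -> smoothness k U (g \o f).
Proof.
move=> oU oV fUV Cf /(smoothness_coord _ _ oV) Cg.
by apply/smoothness_coord => // j; exact: (smoothness_comp1 oU oV fUV Cf (Cg j)).
Qed.

(** By Cramer's rule the entries of the inverse are cofactors divided by the determinant. *)
Lemma smoothness_invmx n p k (U : set 'rV[R]_n) (A : 'rV[R]_n -> 'M[R]_p) :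
  open U -> (forall x, U x -> A x \in unitmx) ->
  (forall i j, smoothness k U (fun x => A x i j)) ->
  forall i j, smoothness k U (fun x => invmx (A x) i j).
Proof.
move=> oU uA CA i j.
have Cdet q (B : 'rV[R]_n -> 'M[R]_q) :
    (forall i j, smoothness k U (fun x => B x i j)) ->
    smoothness k U (fun x => \det (B x)).
  move=> CB; apply: smoothness_sum => // s.
  exact: (smoothness_mul oU (smoothness_cst k ((-1) ^+ (perm.odd_perm s) : R) oU)
    (smoothness_prod oU (fun i => CB i (perm.fun_of_perm s i)))).
have Cc : smoothness k U (fun x =>
    (\det (A x))^-1 * ((-1) ^+ (j + i) * \det (row' j (col' i (A x))))).
  have d0 x : U x -> \det (A x) != 0 by move=> /uA; rewrite unitmxE unitfE.
  refine (smoothness_mul oU (smoothness_inv oU d0 (Cdet _ _ CA)) _).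
  refine (smoothness_mul oU (smoothness_cst k ((-1) ^+ (j + i) : R) oU) _).
  apply: Cdet => a b; have := CA (lift j a) (lift i b).
  by apply: smoothness_eq => // x _; rewrite !mxE.
apply: (smoothness_eq oU _ Cc) => x Ux.
by rewrite /invmx uA // !mxE.
Qed.

End Euclid.

(** * The inverse function theorem *)

HB.instance Definition _ (R : realType) m n := Complete.on 'M[R]_(m, n).

Section InverseFunction.
Variable R : realType.

Lemma rV_norm_coord n (v : 'rV[R]_n) i : `|v 0 i| <= `|v|.
Proof.
rewrite [leRHS]/Num.Def.normr/= mx_normrE.
exact: (le_bigmax _ (fun ij : 'I_1 * 'I_n => `|v ij.1 ij.2|) (0, i)).
Qed.

Lemma rV_norm_le n (v : 'rV[R]_n) e : 0 <= e ->
  (forall i, `|v 0 i| <= e) -> `|v| <= e.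
Proof.
move=> e0 ve; rewrite [leLHS]/Num.Def.normr/= mx_normrE.
by rewrite bigmax_le // => -[i j] _ /=; rewrite ord1; exact: ve.
Qed.

(** The norm is the maximum norm, so it suffices to bound one coordinate at a time, by the
    one-variable mean value theorem along the segment. *)
Lemma mean_value n m (g : 'rV[R]_n -> 'rV[R]_m) (a b : 'rV[R]_n) (c : R) :
  (forall t : R, 0 <= t <= 1 -> differentiable g (a + t *: (b - a))) ->
  (forall t : R, 0 <= t <= 1 -> `|'D_(b - a) g (a + t *: (b - a))| <= c) ->
  `|g b - g a| <= c.
Proof.
move=> dg Dg.
have c0 : 0 <= c.
  by apply: le_trans (Dg 0 _); rewrite ?lexx ?ler01.
apply: rV_norm_le => // j; rewrite !mxE.
pose p (t : R) : 'rV[R]_n := a + t *: (b - a).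
pose phi (t : R) : R := (g (p t)) 0 j.
have dgp (t : R) : 0 <= t <= 1 -> differentiable (g \o p) t /\
    'D_1 (g \o p) t = 'D_(b - a) g (p t).
  move=> t01.
  have hp : is_diff t p ( *:%R^~ (b - a)).
    have H := @is_diffD R R _ (cst a) ( *:%R^~ (b - a)) 0 ( *:%R^~ (b - a)) t
      (is_diff_cst _ _) (is_diff_scalel _ _).
    rewrite add0r in H.
    have pE : p = cst a + *:%R^~ (b - a) by apply/funext.
    by rewrite pE.
  have hg := dg _ t01; case: (hp) => dp dpE.
  have hgp : differentiable (g \o p) t by exact: differentiable_comp.
  by split => //; rewrite !deriveE // diff_comp //= dpE scale1r.
have dphi (t : R) : 0 <= t <= 1 -> is_derive t 1 phi (('D_(b - a) g (p t)) 0 j).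
  move=> /dgp [d1 <-]; apply: DeriveDef; last exact: diff_coord.
  apply: diff_derivable; exact: differentiable_entry.
have [||t t01] := @MVT_segment R phi (fun t => ('D_(b - a) g (p t)) 0 j) 0 1 ler01.
- by move=> t; rewrite in_itv /= => /andP[t0 t1]; apply: dphi; rewrite !ltW.
- apply: continuous_in_subspaceT => t; rewrite inE /= in_itv /= => t01.
  apply: differentiable_continuous; apply: (@differentiable_entry R _ m (g \o p)).
  by have [] := dgp t t01.
rewrite /phi /p scale1r scale0r addr0 (addrC a) subrK subr0 mulr1 => ->.
by apply: le_trans (rV_norm_coord _ _) (Dg t _); move: t01; rewrite in_itv.
Qed.

(** The derivative at [x0] is normalized to the identity, so [g = id - f] is a contraction near
    [x0], and the solutions of [f x = y] are the fixed points of [x |-> y + g x]. The inverse is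
    Lipschitz, then differentiable, then smooth by the formula for its derivative. *)
Lemma inverse_function n (f : 'rV[R]_n -> 'rV[R]_n) (U : set 'rV[R]_n) x0 :
  open U -> U x0 -> (forall k, smoothness k U f) -> (forall v, 'd f x0 v = v) ->
  exists V (h : 'rV[R]_n -> 'rV[R]_n),
    [/\ open V, V x0, V `<=` U & open (f @` V)] /\
    ((forall x, V x -> h (f x) = x) /\ (forall k, smoothness k (f @` V) h)).
Proof.
move=> oU Ux0 Cf df0.
have df x : U x -> differentiable f x by case: (Cf 1%N) => + _; exact.
pose g x : 'rV[R]_n := x - f x.
have dg x : U x -> differentiable g x.
  move=> Ux; have -> : g = id - f by [].
  by apply: differentiableB => //; exact: df.
have Dg x v : U x -> 'D_v g x = v - 'D_v f x.
  move=> Ux; have -> : g = id - f by [].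
  by rewrite deriveB ?derive_id //; apply: diff_derivable; exact: df.
(* With [n] partial derivatives of norm at most [e], the derivative of [g] has norm at most 1/2;
   [n.+1] keeps [e] meaningful for [n = 0]. *)
pose e : R := 2^-1 / n.+1%:R.
have e0 : 0 < e by rewrite divr_gt0 ?invr_gt0.
have nearDg : \forall x \near x0, U x /\ forall i, `|'D_(delta_mx 0 i) g x| <= e.
  have nU := near_open oU Ux0.
  have nD : \forall x \near x0, forall i, `|delta_mx 0 i - 'D_(delta_mx 0 i) f x| <= e.
    apply: (@filter_forall _ _
      (fun i x => `|delta_mx 0 i - 'D_(delta_mx 0 i) f x| <= e) (nbhs x0)) => i.
    have [_ /(_ (delta_mx 0 i) x0 Ux0) cD] := Cf 1%N.
    have := (cvgrPdist_le _ _ ).1 cD e e0; rewrite deriveE; last exact: df.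
    by rewrite df0; apply.
  near=> x; have Ux : U x by near: x.
  have Dx : forall i, `|delta_mx 0 i - 'D_(delta_mx 0 i) f x| <= e.
    by near: x; exact: nD.
  by split => // i; rewrite Dg.
move/nbhs_ballP: nearDg => [r0 /= r00 Hr].
pose r := r0 / 2; have r_gt0 : 0 < r by rewrite divr_gt0.
have Hr' x : `|x - x0| <= r -> U x /\ forall i, `|'D_(delta_mx 0 i) g x| <= e.
  move=> xr; apply: Hr; rewrite -ball_normE /= distrC (le_lt_trans xr) //.
  by rewrite /r ltr_pdivrMr // ltr_pMr // ltr1n.
have Dgle x v : `|x - x0| <= r -> `|'D_v g x| <= 2^-1 * `|v|.
  move=> /Hr'[Ux Dx]; rewrite diff_delta; last exact: dg.
  apply: le_trans (ler_norm_sum _ _ _) _.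
  apply: (@le_trans _ _ (\sum_(i < n) (`|v| * e))).
    apply: ler_sum => i _; rewrite normrZ ler_pM //; exact: rV_norm_coord.
  rewrite sumr_const card_ord -(mulr_natr (`|v| * e)) -mulrA mulrC ler_wpM2r //.
  by rewrite /e mulrAC ler_pdivrMr // ler_wpM2l // ler_nat.
have glip a b : `|a - x0| <= r -> `|b - x0| <= r -> `|g b - g a| <= 2^-1 * `|b - a|.
  move=> ar br.
  have cvx (t : R) : 0 <= t <= 1 -> `|a + t *: (b - a) - x0| <= r.
    move=> /andP[t0 t1].
    have -> : a + t *: (b - a) - x0 = (1 - t) *: (a - x0) + t *: (b - x0).
      by apply/rowP => i; rewrite !mxE; ring.
    apply: le_trans (ler_normD _ _) _; rewrite !normrZ !ger0_norm ?subr_ge0 //.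
    have -> : r = (1 - t) * r + t * r by ring.
    by rewrite lerD // ler_wpM2l // subr_ge0.
  apply: mean_value => t t01; last by apply: Dgle; exact: cvx.
  by apply: dg; have [] := Hr' _ (cvx t t01).
(* Since [g] is 1/2-Lipschitz, [f = id - g] shrinks distances by a factor of at most 2. This gives
   injectivity and the Lipschitz bound on the inverse. *)
have flip a b : `|a - x0| <= r -> `|b - x0| <= r -> `|b - a| <= 2 * `|f b - f a|.
  move=> ar br; have := glip _ _ ar br.
  have -> : g b - g a = (b - a) - (f b - f a).
    by apply/rowP => i; rewrite !mxE; ring.
  move=> H; have := lerB_dist (b - a) (f b - f a); lra.
have fx0 x : `|x - x0| <= r -> f x = x - g x by move=> _; rewrite /g opprB addrC subrK.
(* The contraction preserves the closed ball because [r / 2] from [y] and [r / 2] from [g] add up to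
   [r]; [flip] then gives the strict inequality for the fixed point. *)
have fixpt y : `|y - f x0| < r / 2 -> exists2 x, `|x - x0| < r & f x = y.
  move=> yr; pose C := [set x : 'rV[R]_n | `|x - x0| <= r].
  have CC : set_fun C C (fun x => y + g x).
    move=> x; rewrite /C /= => xr.
    have -> : y + g x - x0 = (y - f x0) + (g x - g x0).
      by apply/rowP => i; rewrite !mxE; ring.
    have x0r : `|x0 - x0| <= r by rewrite subrr normr0 ltW.
    have := glip _ _ x0r xr; have := ler_normD (y - f x0) (g x - g x0).
    by move: yr xr; clear; lra.
  pose FM := isFun.Build _ _ C C (fun x => y + g x) CC.
  pose F : {fun C >-> C} := HB.pack (fun x => y + g x) FM.
  have ctr : is_contraction F.
    exists (2^-1)%:nng; split; first by rewrite /=; lra.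
    move=> [a b] [/= aC bC].
    have -> : y + g a - (y + g b) = g a - g b by rewrite opprD addrACA subrr add0r.
    exact: glip.
  have clC : closed C.
    rewrite (_ : C = closed_ball_ (fun v => `|v|) x0 r); first exact: closed_closed_ball_.
    by apply/seteqP; split=> x; rewrite /C /closed_ball_ /= distrC.
  have [|x Cx xE] := banach_fixed_point ctr clC.
    by exists x0; rewrite /C /= subrr normr0 ltW.
  have fxy : f x = y by move: xE => /= xE; rewrite (fx0 x Cx) {1}xE addrK.
  exists x => //.
  have x0r : `|x0 - x0| <= r by rewrite subrr normr0 ltW.
  by have := flip _ _ x0r Cx; rewrite fxy; move: yr; clear; lra.
pose B := [set y : 'rV[R]_n | `|y - f x0| < r / 2].
pose V := [set x : 'rV[R]_n | `|x - x0| < r /\ B (f x)].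
have oball m (c : 'rV[R]_m) s : open [set y : 'rV[R]_m | `|y - c| < s].
  rewrite (_ : [set y | _] = ball c s); first exact: ball_open.
  by rewrite -ball_normE; apply/seteqP; split=> x; rewrite /= distrC.
have oV : open V.
  rewrite openE => x [/= xr Bfx].
  have : {for x, continuous f}.
    by apply: differentiable_continuous; apply: df; have [] := Hr' x (ltW xr).
  move=> cf; apply: filterI.
    by apply: open_nbhs_nbhs; split => //; exact: oball.
  by apply: cf; apply: open_nbhs_nbhs; split => //; exact: oball.
have fV : f @` V = B.
  apply/seteqP; split => [_ [x [_ Bx] <-] //|y By].
  by have [x xr fxy] := fixpt y By; exists x => //; split => //; rewrite fxy.
pose h y := xget x0 [set x : 'rV[R]_n | `|x - x0| < r /\ f x = y].
have hP y : B y -> `|h y - x0| < r /\ f (h y) = y.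
  move=> By; rewrite /h; case: xgetP => [//|H].
  by have [x xr fxy] := fixpt y By; have := H x; case.
have hf x : V x -> h (f x) = x.
  move=> [xr Bx]; have [hr hE] := hP _ Bx.
  apply/eqP; rewrite -subr_eq0 -normr_le0.
  by have := flip _ _ (ltW xr) (ltW hr); rewrite hE subrr normr0 mulr0.
have hlip y y' : B y -> B y' -> `|h y' - h y| <= 2 * `|y' - y|.
  move=> /hP[yr yE] /hP[yr' yE'].
  by have := flip _ _ (ltW yr) (ltW yr'); rewrite yE yE'.
exists V, h; split; first split => //.
- by rewrite /V /B /= !subrr !normr0; split => //; rewrite divr_gt0.
- by move=> x [/= /ltW /Hr'[]].
- by rewrite fV; exact: oball.
split => //; rewrite fV.
have oB : open B by exact: oball.
pose J x := \matrix_(i < n, j < n) ('D_(delta_mx 0 i) f x) 0 j.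
have JE x v : U x -> 'd f x v = v *m J x.
  move=> Ux; rewrite -deriveE; last exact: df.
  rewrite diff_delta; last exact: df.
  apply/rowP => j; rewrite !mxE summxE.
  by apply: eq_bigr => i _; rewrite !mxE.
(* The derivative differs from the identity by an operator of norm at most 1/2, so it is invertible
   with inverse of norm at most 2. *)
have Jle x (v : 'rV[R]_n) : `|x - x0| < r -> `|v| <= 2 * `|v *m J x|.
  move=> xr; have [Ux _] := Hr' x (ltW xr).
  have := Dgle x v (ltW xr); rewrite Dg // deriveE; last exact: df.
  by rewrite JE //; have := lerB_dist v (v *m J x); lra.
have uJ x : `|x - x0| < r -> J x \in unitmx.
  move=> xr; rewrite -row_free_unit -kermx_eq0; apply/rowV0P => v /sub_kermxP vJ.
  by apply/eqP; rewrite -normr_le0 (le_trans (Jle x v xr)) // vJ normr0 mulr0.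
have dh y : B y -> differentiable h y /\ forall v, 'd h y v = v *m invmx (J (h y)).
  move=> By; have [hr hE] := hP _ By; have uJh := uJ _ hr.
  have [Uh _] := Hr' _ (ltW hr).
  have @L : {linear 'rV[R]_n -> 'rV[R]_n} := mulmxr (invmx (J (h y))).
  have H : h \o shift y = cst (h y) + L +o_ 0 id.
    apply/eqaddoP => e' e'0.
    (* The factor 4 absorbs two losses of 2: the norm of the inverse Jacobian ([Jle]) and the
       Lipschitz constant of [h] ([hlip]). *)
    have /diff_locallyP[_ /eqaddoP/(_ (e' / 4))] := df _ Uh.
    rewrite divr_gt0 // => /(_ isT) /nbhs_ballP[d /= d0 Hd].
    suff : \forall k \near (0 : 'rV[R]_n),
      `|h (k + y) - (h y + k *m invmx (J (h y)))| <= e' * `|k| by [].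
    near=> k.
    have kd : `|k| < d / 2.
      near: k; apply/nbhs_ballP; exists (d / 2); first by rewrite /= divr_gt0.
      by move=> k; rewrite -ball_normE /= sub0r normrN.
    have Bk : B (k + y).
      near: k; apply/nbhs_ballP; exists (r / 2 - `|y - f x0|); first by rewrite /= subr_gt0.
      move=> k; rewrite -ball_normE /= sub0r normrN => kr.
      by rewrite /B /= -addrA (le_lt_trans (ler_normD _ _)) // -ltrBrDr.
    have Hlip := hlip _ _ By Bk; rewrite addrK in Hlip.
    have [_ hkE] := hP _ Bk.
    set w := h (k + y) - h y in Hlip *.
    have bw : ball 0 d w.
      by rewrite -ball_normE /= sub0r normrN; move: Hlip kd; clear; lra.
    have {Hd} := Hd w bw.
    rewrite -[X in X -> _]/(is_true
      (`|f (w + h y) - (f (h y) + 'd f (h y) w)| <= e' / 4 * `|w|)).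
    rewrite JE // subrK hkE hE => Hw.
    have -> : h (k + y) - (h y + k *m invmx (J (h y))) =
        (w *m J (h y) - k) *m invmx (J (h y)).
      by rewrite mulmxBl mulmxK // /w opprD addrA.
    apply: le_trans (Jle _ _ hr) _; rewrite mulmxKV //.
    have -> : w *m J (h y) - k = - (k + y - (y + w *m J (h y))).
      by rewrite opprB (addrC k) opprD addrA (addrC y) addrK.
    rewrite normrN; apply: (@le_trans _ _ (2 * (e' / 4 * (2 * `|k|)))).
      by rewrite ler_wpM2l // (le_trans Hw) // ler_wpM2l // divr_ge0 // ltW.
    by have -> : 2 * (e' / 4 * (2 * `|k|)) = e' * `|k| by field.
  have dL : 'd h y = L :> (_ -> _) by apply: (diff_unique _ H); exact: rV_linear_continuous.
  split => [|v]; last by rewrite dL.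
  by apply/diff_locallyP; rewrite dL; split => //; exact: rV_linear_continuous.
(* Bootstrap: the derivative of [h] is the inverse of [J] taken at [h y], which is of class $C^k$ as
   soon as [h] is. *)
elim=> [|k IH].
  by move=> y By; apply: differentiable_continuous; case: (dh y By).
split=> [y By|v]; first by case: (dh y By).
have CJ i j : smoothness k U (fun x => J x i j).
  case: (Cf k.+1) => _ Df; have := (smoothness_coord _ _ oU).1 (Df (delta_mx 0 i)) j.
  by apply: smoothness_eq => // x _; rewrite mxE.
have CJh i j : smoothness k B (fun y => J (h y) i j).
  apply: (smoothness_comp1 oB oU _ IH (CJ i j)) => y /hP[yr _].
  by case: (Hr' _ (ltW yr)).
have uJh y : B y -> J (h y) \in unitmx by move=> /hP[yr _]; exact: uJ.
have Cinv := smoothness_invmx oB uJh CJh.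
apply/smoothness_coord => // j.
have Cs i := smoothness_mul oB (smoothness_cst k (v 0 i) oB) (Cinv i j).
apply: (smoothness_eq oB _ (smoothness_sum oB Cs)) => y By /=.
have [dhy dhE] := dh y By.
by rewrite deriveE // dhE mxE.
Unshelve. all: by end_near. Qed.
End InverseFunction.

(** * Smooth maps and their differentials *)

(* Locked because unification of two Jacobians otherwise unfolds ['d].        *)
HB.lock Definition jac (R : realType) n m (f : 'rV[R]_n -> 'rV[R]_m)
  (x : 'rV[R]_n) : 'M[R]_(n, m) := lin1_mx ('d f x).

Section Germs.
Variable R : realType.
Implicit Types n m : nat.

(** One neighbourhood serves all orders. Germs replace the bookkeeping of domains when chart
    representatives, junk far from the point, are composed. *)
Definition germ_smooth n m (f : 'rV[R]_n -> 'rV[R]_m) (x : 'rV[R]_n) : Prop :=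
  exists U, [/\ open U, U x & forall k, smoothness k U f].

Lemma Cinfty_germ n m (U : set 'rV[R]_n) (f : 'rV[R]_n -> 'rV[R]_m) :
  open U -> Cinfty U f <-> forall x, U x -> germ_smooth f x.
Proof.
move=> oU; split=> [Cf x Ux|H k].
  by exists U; split => // k; rewrite -CkE.
by rewrite CkE; apply: smoothness_local => x /H[V [_ Vx CV]]; exists V.
Qed.

Lemma germ_near n m (f : 'rV[R]_n -> 'rV[R]_m) x :
  germ_smooth f x -> \forall y \near x, germ_smooth f y.
Proof.
move=> [U [oU Ux Cf]]; near=> y; exists U; split=> //; near: y; exact: near_open.
Unshelve. all: by end_near. Qed.

Lemma germ_continuous n m (f : 'rV[R]_n -> 'rV[R]_m) x :
  germ_smooth f x -> {for x, continuous f}.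
Proof. by move=> [U [oU Ux /(_ 0%N)]]; exact. Qed.

Lemma germ_differentiable n m (f : 'rV[R]_n -> 'rV[R]_m) x :
  germ_smooth f x -> differentiable f x.
Proof. by move=> [U [oU Ux /(_ 1%N)[+ _]]]; exact. Qed.

Lemma near_openP (T : topologicalType) (x : T) (P : T -> Prop) :
  (\forall y \near x, P y) <-> exists U, [/\ open U, U x & U `<=` P].
Proof.
split; first by rewrite -nbhs_nearE nbhsE => -[U [oU Ux] UP]; exists U.
by move=> [U [oU Ux UP]]; rewrite -nbhs_nearE nbhsE; exists U.
Qed.

Lemma germ_eq n m (f g : 'rV[R]_n -> 'rV[R]_m) x :
  (\forall y \near x, f y = g y) -> germ_smooth f x -> germ_smooth g x.
Proof.
move=> /near_openP[V [oV Vx fg]] [U [oU Ux Cf]].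
exists (U `&` V); split=> //; first exact: openI.
move=> k; apply: (@smoothness_eq _ _ _ _ _ f); first exact: openI.
  by move=> y [_ /fg].
by apply: smoothness_sub (Cf k) => y [].
Qed.

Lemma germ_comp n m p (f : 'rV[R]_n -> 'rV[R]_m) (g : 'rV[R]_m -> 'rV[R]_p) x :
  germ_smooth f x -> germ_smooth g (f x) -> germ_smooth (g \o f) x.
Proof.
move=> [U [oU Ux Cf]] [V [oV Vx Cg]].
have oW : open (U `&` f @^-1` V).
  rewrite openE => y [Uy Vy]; apply: filterI; first exact: near_open.
  by apply: (Cf 0%N y Uy); exact: near_open.
exists (U `&` f @^-1` V); split => // k.
apply: (smoothness_comp oW oV _ _ (Cg k)) => [y []|] //.
by apply: smoothness_sub (Cf k) => y [].
Qed.

Lemma germ_cst n m (c : 'rV[R]_m) (x : 'rV[R]_n) : germ_smooth (fun=> c) x.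
Proof.
by exists setT; split => // [|k]; [exact: openT|apply: smoothness_cst; exact: openT].
Qed.

Lemma smoothness_id n k : smoothness k setT (id : 'rV[R]_n -> 'rV[R]_n).
Proof.
case: k => [|k]; first by move=> x _; exact: cvg_id.
split=> [x _|v]; first exact: ex_diff.
apply: (@smoothness_eq _ _ _ _ _ (fun=> v)); first exact: openT.
  by move=> x _; rewrite derive_id.
by apply: smoothness_cst; exact: openT.
Qed.

Lemma germ_id n (x : 'rV[R]_n) : germ_smooth id x.
Proof.
by exists setT; split => // [|k]; [exact: openT|exact: smoothness_id].
Qed.

Lemma germ_lin n m p (L : {linear 'rV[R]_m -> 'rV[R]_p})
    (f : 'rV[R]_n -> 'rV[R]_m) x : germ_smooth f x -> germ_smooth (L \o f) x.
Proof.
move=> [U [oU Ux Cf]]; exists U; split => // k.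
by apply: smoothness_lin => //; exact: rV_linear_continuous.
Qed.

Lemma germ_add n m (f g : 'rV[R]_n -> 'rV[R]_m) x :
  germ_smooth f x -> germ_smooth g x -> germ_smooth (f \+ g) x.
Proof.
move=> [U [oU Ux Cf]] [V [oV Vx Cg]].
have oW : open (U `&` V) by exact: openI.
exists (U `&` V); split => // k; apply: smoothness_add => //.
  by apply: smoothness_sub (Cf k) => y [].
by apply: smoothness_sub (Cg k) => y [].
Qed.

Lemma germ_row_mx n m p (f : 'rV[R]_n -> 'rV[R]_m) (g : 'rV[R]_n -> 'rV[R]_p) x :
  germ_smooth f x -> germ_smooth g x ->
  germ_smooth (fun y => row_mx (f y) (g y)) x.
Proof.
have [A [B [_ _ AB]]] := row_mx0E R m p.
move=> Cf Cg; have -> : (fun y => row_mx (f y) (g y)) = (A \o f) \+ (B \o g).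
  by apply/funext => y; rewrite AB.
by apply: germ_add; exact: germ_lin.
Qed.

Lemma germ_mulmx n m (A : 'M[R]_(n, m)) x :
  germ_smooth (fun y : 'rV[R]_n => y *m A) x.
Proof. exact: (germ_lin (mulmxr A) (germ_id x)). Qed.

Lemma germ_lsubmx n m (x : 'rV[R]_(n + m)) : germ_smooth (@lsubmx R 1 n m) x.
Proof. exact: (germ_lin lsubmx (germ_id x)). Qed.

Lemma germ_rsubmx n m (x : 'rV[R]_(n + m)) : germ_smooth (@rsubmx R 1 n m) x.
Proof. exact: (germ_lin rsubmx (germ_id x)). Qed.

Lemma mulmx_ext n m (A B : 'M[R]_(n, m)) :
  (forall v : 'rV[R]_n, v *m A = v *m B) -> A = B.
Proof. by move=> AB; apply/row_matrixP => i; rewrite rowE AB -rowE. Qed.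

Lemma jacE n m (f : 'rV[R]_n -> 'rV[R]_m) (x v : 'rV[R]_n) :
  germ_smooth f x -> v *m jac f x = 'D_v f x.
Proof. by move=> /germ_differentiable df; rewrite deriveE // jac.unlock mul_rV_lin1. Qed.

Lemma jac_eq n m (f g : 'rV[R]_n -> 'rV[R]_m) x :
  (\forall y \near x, f y = g y) -> germ_smooth f x -> jac f x = jac g x.
Proof.
move=> fg Cf; apply: mulmx_ext => v.
by rewrite (jacE v Cf) (jacE v (germ_eq fg Cf)); exact: near_eq_derive.
Qed.

Lemma jac_comp n m p (f : 'rV[R]_n -> 'rV[R]_m) (g : 'rV[R]_m -> 'rV[R]_p) x :
  germ_smooth f x -> germ_smooth g (f x) ->
  jac (g \o f) x = jac f x *m jac g (f x).
Proof.
move=> Cf Cg; apply: mulmx_ext => v; rewrite mulmxA.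
have [df dg] := (germ_differentiable Cf, germ_differentiable Cg).
by rewrite jac.unlock !mul_rV_lin1 /= diff_comp.
Qed.

Lemma jac_id n (x : 'rV[R]_n) : jac id x = 1%:M.
Proof.
apply: mulmx_ext => v.
by rewrite (jacE _ (germ_id x)) derive_id mulmx1.
Qed.

Lemma jac_cst n m (c : 'rV[R]_m) (x : 'rV[R]_n) : jac (fun=> c) x = 0.
Proof.
apply: mulmx_ext => v.
by rewrite (jacE _ (germ_cst c x)) derive_cst mulmx0.
Qed.

Lemma jac_lin n m (L : {linear 'rV[R]_n -> 'rV[R]_m}) x : jac L x = lin1_mx L.
Proof.
by rewrite jac.unlock; congr lin1_mx; rewrite diff_lin //; exact: rV_linear_continuous.
Qed.

Lemma jac_mulmx n m (A : 'M[R]_(n, m)) x : jac (fun y : 'rV[R]_n => y *m A) x = A.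
Proof.
apply: mulmx_ext => v.
by rewrite -[X in jac X]/(mulmxr A : _ -> _) (jac_lin (mulmxr A)) mul_rV_lin1.
Qed.

End Germs.

(** * Charts as local homeomorphisms *)

Section ChartTopology.
Variables (R : realType) (T : topologicalType) (n : nat).
Implicit Types (c : chart R T n).

Lemma chart_cmapK c p : dom c p -> cinv c (cmap c p) = p.
Proof. by move=> cp; rewrite cmapK // inE. Qed.

Lemma chart_cmap_continuous c p : dom c p -> {for p, continuous (cmap c)}.
Proof. by move=> cp; apply: cmap_continuous; rewrite inE. Qed.

Lemma chart_cinv_continuous c p : dom c p ->
  {for cmap c p, continuous (cinv c)}.
Proof. by move=> cp; apply: cinv_continuous; rewrite inE; exists p. Qed.

Lemma chart_near_dom c p : dom c p -> \forall q \near p, dom c q.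
Proof. by move=> cp; apply: open_nbhs_nbhs; split => //; exact: dom_open. Qed.

Lemma chart_near_img c p : dom c p ->
  \forall w \near cmap c p, (cmap c @` dom c) w.
Proof.
by move=> cp; apply: open_nbhs_nbhs; split; [exact: img_open|exists p].
Qed.

Lemma chart_cinvK c w : (cmap c @` dom c) w ->
  dom c (cinv c w) /\ cmap c (cinv c w) = w.
Proof. by move=> [p cp <-]; rewrite chart_cmapK. Qed.

Lemma chart_near_cinv c p (P : T -> Prop) : dom c p ->
  (\forall q \near p, P q) -> \forall w \near cmap c p, P (cinv c w).
Proof.
move=> cp Pp; have := chart_cinv_continuous cp.
by apply; rewrite chart_cmapK.
Qed.

Lemma open_cmap_img c (O : set T) : open O -> O `<=` dom c -> open (cmap c @` O).
Proof.
move=> oO Oc; rewrite openE => _ [p Op <-].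
have cp := Oc _ Op.
have h1 := chart_near_img cp.
have h2 : \forall w \near cmap c p, O (cinv c w).
  by apply: chart_near_cinv => //; apply: open_nbhs_nbhs.
suff : \forall w \near cmap c p, (cmap c @` O) w by [].
near=> w; exists (cinv c w); first by near: w.
have /chart_cinvK[] // : (cmap c @` dom c) w by near: w.
Unshelve. all: by end_near. Qed.

End ChartTopology.

(** * Smoothness at a point, independently of charts *)

Section SmoothGerms.
Variable R : realType.
Implicit Types M N P : manifold R.

Lemma chart_at_atlas M (p : M) : atlas (chart_at p).
Proof. by rewrite /chart_at; case: cid => c []. Qed.

Lemma chart_at_dom M (p : M) : dom (chart_at p) p.
Proof. by rewrite /chart_at; case: cid => c []. Qed.

Local Hint Resolve chart_at_atlas chart_at_dom : core.

Lemma open_domI (T : topologicalType) n (c d : chart R T n) :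
  open (dom c `&` dom d).
Proof. by apply: openI; exact: dom_open. Qed.

Lemma transition_germ M (c d : chart R M (dim M)) p : atlas c -> atlas d ->
  dom c p -> dom d p -> germ_smooth (cmap d \o cinv c) (cmap c p).
Proof.
move=> ac ad cp dp; have := atlas_compat ac ad.
have oI : open (cmap c @` (dom c `&` dom d)).
  by apply: open_cmap_img; [exact: open_domI|exact: subIsetl].
by move/(Cinfty_germ _ oI); apply; exists p.
Qed.

Definition chart_rep M N (c : chart R M (dim M)) (d : chart R N (dim N)) (f : M -> N) :=
  cmap d \o f \o cinv c.

(** The two representatives differ by transition maps only near the point, where continuity of [f]
    keeps its values in the domain of [d]. *)
Lemma chart_rep_change M N (f : M -> N) (p : M) (c c' : chart R M (dim M))
    (d d' : chart R N (dim N)) :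
  atlas c -> atlas c' -> atlas d -> atlas d' -> dom c p -> dom c' p ->
  dom d (f p) -> dom d' (f p) -> {for p, continuous f} ->
  germ_smooth (chart_rep c d f) (cmap c p) -> germ_smooth (chart_rep c' d' f) (cmap c' p).
Proof.
move=> ac ac' ad ad' cp cp' dp dp' cf Cf.
have C1 := transition_germ ac' ac cp' cp; have C2 := transition_germ ad ad' dp dp'.
have E1 : (cmap c \o cinv c') (cmap c' p) = cmap c p by rewrite /= chart_cmapK.
have E2 : chart_rep c d f (cmap c p) = cmap d (f p) by rewrite /chart_rep /= chart_cmapK.
have C3 : germ_smooth (chart_rep c d f \o (cmap c \o cinv c')) (cmap c' p).
  by apply: germ_comp => //; rewrite E1.
have C4 : germ_smooth ((cmap d' \o cinv d) \o (chart_rep c d f \o (cmap c \o cinv c')))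
    (cmap c' p).
  by apply: germ_comp => //=; rewrite (chart_cmapK cp') E2.
apply: germ_eq C4; apply: (chart_near_cinv cp'
  (P := fun q => (cmap d' \o cinv d) (chart_rep c d f (cmap c q)) = cmap d' (f q))).
have h1 := chart_near_dom cp.
have h2 : \forall q \near p, dom d (f q) by apply: cf; exact: chart_near_dom.
near=> q.
have cq : dom c q by near: q.
have dq : dom d (f q) by near: q.
by rewrite /chart_rep /= !chart_cmapK.
Unshelve. all: by end_near. Qed.

(** Continuity is a separate clause: [cmap] is junk off its domain, so a smooth representative does
    not control where [f] goes. *)
Definition smooth_at M N (f : M -> N) (p : M) : Prop :=
  {for p, continuous f} /\
  germ_smooth (chart_rep (chart_at p) (chart_at (f p)) f) (cmap (chart_at p) p).

Lemma smooth_at_chart M N (f : M -> N) (p : M) (c : chart R M (dim M))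
    (d : chart R N (dim N)) : atlas c -> atlas d -> dom c p -> dom d (f p) ->
  smooth_at f p <->
  {for p, continuous f} /\ germ_smooth (chart_rep c d f) (cmap c p).
Proof.
move=> ac ad cp dp; split=> -[cf Cf]; split=> //; move: Cf; exact: chart_rep_change.
Qed.

(** Continuity is given at [p] only. At nearby points it is recovered by writing [f] as its smooth
    representative between two charts. *)
Lemma smooth_at_near M N (f : M -> N) p :
  smooth_at f p -> \forall q \near p, smooth_at f q.
Proof.
move=> [cf Cf].
have hd : \forall q \near p, dom (chart_at (f p)) (f q).
  by apply: cf; exact: chart_near_dom.
have hc := chart_near_dom (chart_at_dom p).
have hg : \forall q \near p,
    germ_smooth (chart_rep (chart_at p) (chart_at (f p)) f) (cmap (chart_at p) q).
  by have := chart_cmap_continuous (chart_at_dom p); apply; exact: germ_near.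
have hd' : \forall q \near p, \forall q' \near q, dom (chart_at (f p)) (f q').
  by apply: near_join.
near=> q.
have cq : dom (chart_at p) q by near: q.
have dq : dom (chart_at (f p)) (f q) by near: q.
have gq : germ_smooth (chart_rep (chart_at p) (chart_at (f p)) f) (cmap (chart_at p) q).
  by near: q.
have dq' : \forall q' \near q, dom (chart_at (f p)) (f q') by near: q.
apply/(smooth_at_chart _ _ cq dq) => //; split => //.
have cr : {for q, continuous (cinv (chart_at (f p)) \o
    (chart_rep (chart_at p) (chart_at (f p)) f \o cmap (chart_at p)))}.
  apply: continuous_comp.
    apply: continuous_comp; first exact: chart_cmap_continuous.
    exact: germ_continuous.
  by rewrite /chart_rep /= chart_cmapK //; exact: chart_cinv_continuous.
have e : \forall q' \near q, (cinv (chart_at (f p)) \o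
    (chart_rep (chart_at p) (chart_at (f p)) f \o cmap (chart_at p))) q' = f q'.
  have hcq := chart_near_dom cq.
  near=> q'.
  have cq' : dom (chart_at p) q' by near: q'.
  have dq'' : dom (chart_at (f p)) (f q') by near: q'.
  by rewrite /chart_rep /= !chart_cmapK.
rewrite /prop_for /continuous_at -(nbhs_singleton e).
exact: (cvg_trans (near_eq_cvg e) cr).
Unshelve. all: by end_near. Qed.

Lemma smooth_onP M N (U : set M) (f : M -> N) : open U ->
  smooth_on U f <-> forall p, U p -> smooth_at f p.
Proof.
move=> oU; split=> [[cf Cf] p Up|H].
  split; first exact: cf.
  have Cf' := Cf (chart_at p) (chart_at (f p)) (chart_at_atlas p) (chart_at_atlas (f p)).
  set O := U `&` _ `&` _ in Cf'.
  have oO : open O.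
    rewrite openE => q [[Uq cq] dq]; apply: filterI; first apply: filterI.
    - exact: open_nbhs_nbhs.
    - exact: chart_near_dom.
    - by apply: (cf q Uq); exact: chart_near_dom.
  have oI : open (cmap (chart_at p) @` O).
    by apply: open_cmap_img => // q [[]].
  by move/(Cinfty_germ _ oI): Cf'; apply; exists p => //; split => //=; exact: chart_at_dom.
split=> [p Up|c d ac ad]; first by case: (H p Up).
set O := U `&` _ `&` _.
have oO : open O.
  rewrite openE => q [[Uq cq] dq]; apply: filterI; first apply: filterI.
  - exact: open_nbhs_nbhs.
  - exact: chart_near_dom.
  - by case: (H q Uq) => cf _; apply: cf; exact: chart_near_dom.
have oI : open (cmap c @` O) by apply: open_cmap_img => // q [[]].
apply/(Cinfty_germ _ oI) => _ [q [[Uq cq] dq] <-].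
by case: ((smooth_at_chart ac ad cq dq).1 (H q Uq)).
Qed.

Lemma smoothP M N (f : M -> N) : smooth f <-> forall p, smooth_at f p.
Proof.
rewrite /smooth smooth_onP; last exact: openT.
by split=> H p; [apply: H|].
Qed.

Lemma smooth_at_eq M N (f g : M -> N) p : (\forall q \near p, f q = g q) ->
  smooth_at f p -> smooth_at g p.
Proof.
move=> fg [cf Cf]; have fgp := nbhs_singleton fg; split.
  rewrite /prop_for /continuous_at -fgp.
  exact: (cvg_trans (near_eq_cvg fg) cf).
rewrite -fgp; apply: germ_eq Cf.
apply: (chart_near_cinv (chart_at_dom p)
  (P := fun q => cmap (chart_at (f p)) (f q) = cmap (chart_at (f p)) (g q))).
near=> q; have fgq : f q = g q by near: q.
by rewrite fgq.
Unshelve. all: by end_near. Qed.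

Lemma chart_rep_comp_near M N P (f : M -> N) (g : N -> P) p
    (c : chart R M (dim M)) (d : chart R N (dim N)) (e : chart R P (dim P)) :
  dom c p -> dom d (f p) -> {for p, continuous f} ->
  \forall w \near cmap c p, (chart_rep d e g \o chart_rep c d f) w = chart_rep c e (g \o f) w.
Proof.
move=> cp dp cf; apply: (chart_near_cinv cp
  (P := fun q => cmap e (g (cinv d (cmap d (f q)))) = cmap e (g (f q)))).
have h : \forall q \near p, dom d (f q) by apply: cf; exact: chart_near_dom.
near=> q; have dq : dom d (f q) by near: q.
by rewrite chart_cmapK.
Unshelve. all: by end_near. Qed.

Lemma smooth_at_comp M N P (f : M -> N) (g : N -> P) p :
  smooth_at f p -> smooth_at g (f p) -> smooth_at (g \o f) p.
Proof.
move=> [cf Cf] [cg Cg]; split; first exact: continuous_comp.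
apply: (germ_eq (chart_rep_comp_near _ _ (chart_at_dom p) (chart_at_dom (f p)) cf)).
by apply: germ_comp => //; rewrite {2}/chart_rep /= chart_cmapK.
Qed.

Lemma smooth_at_id M (p : M) : smooth_at id p.
Proof. by split; [exact: cvg_id|exact: transition_germ]. Qed.

Lemma smooth_at_cst M N (q : N) (p : M) : smooth_at (fun=> q) p.
Proof. by split; [exact: cst_continuous|exact: germ_cst]. Qed.

End SmoothGerms.

(* The matrix of the differential in the preferred charts, acting on row      *)
(* vectors from the right: [dM (g \o f)] is [dM f *m dM g].                   *)
HB.lock Definition dM (R : realType) (M N : manifold R) (f : M -> N) (p : M) :
  'M[R]_(dim M, dim N) :=
  jac (chart_rep (chart_at p) (chart_at (f p)) f) (cmap (chart_at p) p).

(** * Differentials as matrices, and their relation to tangent vectors *)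

Section Differential.
Variable R : realType.
Implicit Types M N P : manifold R.
Local Hint Resolve chart_at_atlas chart_at_dom : core.

Lemma dM_comp M N P (f : M -> N) (g : N -> P) p :
  smooth_at f p -> smooth_at g (f p) -> dM (g \o f) p = dM f p *m dM g (f p).
Proof.
move=> [cf Cf] [cg Cg]; rewrite dM.unlock.
have E : chart_rep (chart_at p) (chart_at (f p)) f (cmap (chart_at p) p) =
    cmap (chart_at (f p)) (f p) by rewrite /chart_rep /= chart_cmapK.
have C : germ_smooth (chart_rep (chart_at (f p)) (chart_at (g (f p))) g)
    (chart_rep (chart_at p) (chart_at (f p)) f (cmap (chart_at p) p)) by rewrite E.
rewrite -E -jac_comp //; symmetry; apply: jac_eq; last exact: germ_comp.
exact: chart_rep_comp_near.
Qed.

Lemma dM_eq M N (f g : M -> N) p : (\forall q \near p, f q = g q) ->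
  smooth_at f p -> dM f p = dM g p.
Proof.
move=> fg [cf Cf]; have fgp := nbhs_singleton fg.
rewrite dM.unlock -fgp; apply: jac_eq => //.
apply: (chart_near_cinv (chart_at_dom p)
  (P := fun q => cmap (chart_at (f p)) (f q) = cmap (chart_at (f p)) (g q))).
near=> q; have fgq : f q = g q by near: q.
by rewrite fgq.
Unshelve. all: by end_near. Qed.

Lemma chart_cinvK_near (T : topologicalType) n (c : chart R T n) p : dom c p ->
  \forall w \near cmap c p, cmap c (cinv c w) = w.
Proof.
move=> cp; have h := chart_near_img cp.
near=> w; have hw : (cmap c @` dom c) w by near: w.
by case: (chart_cinvK hw).
Unshelve. all: by end_near. Qed.

Lemma dM_id M (p : M) : dM id p = 1%:M.
Proof.
rewrite dM.unlock -(jac_id (cmap (chart_at p) p)); symmetry; apply: jac_eq.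
  have := chart_cinvK_near (chart_at_dom p); apply: filterS => w /= e.
  by rewrite /chart_rep /= e.
exact: germ_id.
Qed.

Lemma dM_cst M N (q : N) (p : M) : dM (fun=> q) p = 0.
Proof. by rewrite dM.unlock; exact: jac_cst. Qed.

(* Tangent vectors in the sense of [tangent_space] are determined by their    *)
(* coordinates in the preferred chart, which turns [differential] into [dM].  *)
Lemma tangent_inj M (p : M) v v' : tangent_space p v -> tangent_space p v' ->
  v (chart_at p) = v' (chart_at p) -> v = v'.
Proof.
move=> [tv zv] [tv' zv'] e; apply/funext => c.
have [[ac cp]|nc] := pselect (atlas c /\ dom c p); last by rewrite zv ?zv'.
have [a0 d0] := (chart_at_atlas p, chart_at_dom p).
by rewrite (tv _ _ a0 d0 ac cp) (tv' _ _ a0 d0 ac cp) e.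
Qed.

(** The other coordinates are obtained from [w] by the Jacobians of the transition maps; their
    compatibility is the chain rule. *)
Lemma tangent_ex M (p : M) (w : 'rV[R]_(dim M)) :
  exists2 v, tangent_space p v & v (chart_at p) = w.
Proof.
pose v : tangent_family M := fun c => if `[< atlas c /\ dom c p >]
  then 'D_w (cmap c \o cinv (chart_at p)) (cmap (chart_at p) p) else 0.
have vE c : atlas c -> dom c p ->
    v c = w *m jac (cmap c \o cinv (chart_at p)) (cmap (chart_at p) p).
  move=> ac cp; rewrite /v; case: asboolP => [_|[]//].
  by rewrite jacE //; exact: transition_germ.
exists v; last first.
  rewrite vE // -[RHS]mulmx1 -(jac_id (cmap (chart_at p) p)); congr (_ *m _).
  apply: jac_eq; last exact: transition_germ.
  exact: (chart_cinvK_near (chart_at_dom p)).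
split=> [c d ac cp ad dp|c nc]; last by rewrite /v; case: asboolP.
rewrite !vE // -jacE; last exact: transition_germ.
have E : (cmap c \o cinv (chart_at p)) (cmap (chart_at p) p) = cmap c p.
  by rewrite /= chart_cmapK.
have C : germ_smooth (cmap d \o cinv c)
    ((cmap c \o cinv (chart_at p)) (cmap (chart_at p) p)).
  by rewrite E; exact: transition_germ.
rewrite -mulmxA -E -jac_comp //; last exact: transition_germ.
congr (_ *m _); symmetry; apply: jac_eq; last first.
  by apply: germ_comp => //; exact: transition_germ.
apply: (chart_near_cinv (chart_at_dom p)
  (P := fun q => cmap d (cinv c (cmap c q)) = cmap d q)).
have := chart_near_dom cp; apply: filterS => q cq.
by rewrite chart_cmapK.
Qed.

Lemma differential_coord M N (f : M -> N) p v : smooth_at f p ->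
  differential f p v (chart_at (f p)) = v (chart_at p) *m dM f p.
Proof.
move=> [cf Cf]; rewrite /differential; case: asboolP => [_|[]//].
by rewrite dM.unlock jacE.
Qed.

Lemma differential_tangent M N (f : M -> N) p v : smooth_at f p ->
  tangent_space (f p) (differential f p v).
Proof.
move=> sf; case: (sf) => cf Cf.
have dE d : atlas d -> dom d (f p) ->
    differential f p v d =
    v (chart_at p) *m jac (chart_rep (chart_at p) d f) (cmap (chart_at p) p).
  move=> ad dp; rewrite /differential; case: asboolP => [_|[]//].
  have [_ C] := (smooth_at_chart (chart_at_atlas p) ad (chart_at_dom p) dp).1 sf.
  by rewrite jacE.
split=> [c d ac cp ad dp|c nc]; last by rewrite /differential; case: asboolP.
have [_ C] := (smooth_at_chart (chart_at_atlas p) ac (chart_at_dom p) cp).1 sf.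
have C2 := transition_germ ac ad cp dp.
rewrite !dE // -(jacE _ C2) -mulmxA; congr (_ *m _).
have E : chart_rep (chart_at p) c f (cmap (chart_at p) p) = cmap c (f p).
  by rewrite /chart_rep /= chart_cmapK.
rewrite -E -jac_comp //; last by rewrite E.
symmetry; apply: jac_eq; last by apply: germ_comp => //; rewrite E.
apply: (chart_near_cinv (chart_at_dom p)
  (P := fun q => cmap d (cinv c (cmap c (f q))) = cmap d (f q))).
have : \forall q \near p, dom c (f q) by apply: cf; exact: chart_near_dom.
by apply: filterS => q cq; rewrite chart_cmapK.
Qed.

Lemma row_full_surj m n (A : 'M[R]_(m, n)) :
  row_full A <-> forall w : 'rV[R]_n, exists v, v *m A = w.
Proof.
split=> [fA w|H].
  by have /submxP[v ->] := submx_full w fA; exists v.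
rewrite -sub1mx; apply/row_subP => i.
by have [v <-] := H (row i 1%:M); exact: submxMl.
Qed.

Lemma submersionP M N (f : M -> N) : smooth f ->
  submersion f <-> forall p, row_full (dM f p).
Proof.
move=> /smoothP sf; split=> [sub p|H p w tw].
  apply/row_full_surj => w; have [w' tw' <-] := tangent_ex (f p) w.
  have [v tv <-] := sub p w' tw'.
  by exists (v (chart_at p)); rewrite differential_coord.
have [u uE] := (row_full_surj _).1 (H p) (w (chart_at (f p))).
have [v tv vE] := tangent_ex p u.
exists v => //; apply: tangent_inj tw _; first exact: differential_tangent.
by rewrite differential_coord // vE.
Qed.

End Differential.

(** * Euclidean spaces as manifolds *)

Section Euclidean.
Variable R : realType.
Local Hint Resolve chart_at_atlas chart_at_dom : core.

Lemma rV_second_countable n : @second_countable 'rV[R]_n.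
Proof.
pose f (qk : 'rV[rat]_n * nat) : set 'rV[R]_n :=
  ball (map_mx ratr qk.1 : 'rV[R]_n) (qk.2.+1%:R^-1).
exists (range f); first exact: (sub_countable (card_image_le _ _) (countableP _)).
split=> [_ [qk _ <-]|x A /nbhs_ballP[e /= e0 eA]]; first exact: ball_open.
have [k ke] : exists k, k.+1%:R^-1 < e / 2.
  have e2 : 0 < e / 2 by rewrite divr_gt0.
  have [k _ /(_ k)/= Hk] := near_infty_natSinv_lt (PosNum e2).
  by exists k; apply: Hk; exact: leqnn.
have k0 : 0 < k.+1%:R^-1 :> R by rewrite invr_gt0.
have H i : exists q : rat, `|x 0 i - ratr q| < k.+1%:R^-1 / 2.
  have : x 0 i - k.+1%:R^-1 / 2 < x 0 i + k.+1%:R^-1 / 2.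
    by rewrite ltrD2l gtrN // divr_gt0.
  move=> /rat_in_itvoo[q]; rewrite in_itv /= => /andP[q1 q2]; exists q.
  by rewrite distrC ltr_distl q1 q2.
have [q qP] := choice H.
have qx : `|map_mx ratr (\row_i q i) - x| < k.+1%:R^-1.
  apply: (@le_lt_trans _ _ (k.+1%:R^-1 / 2)); last by rewrite gtr_pMr // invf_lt1 // ltr1n.
  apply: rV_norm_le => [|i]; first by rewrite divr_ge0 // ltW.
  by rewrite !mxE distrC ltW.
exists (f (\row_i q i, k)).
  by split; [exists (\row_i q i, k)|rewrite /f /= -ball_normE].
move=> y; rewrite /f /= -ball_normE /= => qy; apply: eA; rewrite -ball_normE /=.
have -> : x - y = (x - map_mx ratr (\row_i q i)) + (map_mx ratr (\row_i q i) - y).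
  by rewrite addrA subrK.
apply: le_lt_trans (ler_normD _ _) _; rewrite distrC.
by rewrite [ltRHS]splitr ltrD // (lt_trans _ ke).
Qed.

Section IdChart.
Variable n : nat.
Let D : set 'rV[R]_n := setT.

Lemma id_chart_img : open (@id 'rV[R]_n @` D).
Proof. by rewrite image_id; exact: openT. Qed.

Lemma id_chartK : {in D, cancel (@id 'rV[R]_n) id}. Proof. by []. Qed.

Lemma id_chart_continuous (A : set 'rV[R]_n) : {in A, continuous (@id 'rV[R]_n)}.
Proof. by move=> x _; exact: cvg_id. Qed.

Definition id_chart : chart R 'rV[R]_n n :=
  Chart openT id_chart_img id_chartK (@id_chart_continuous D)
    (@id_chart_continuous (id @` D)).

Lemma euclid_cover (p : 'rV[R]_n) : exists c, [set id_chart] c /\ dom c p.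
Proof. by exists id_chart. Qed.

Lemma euclid_compat c d : [set id_chart] c -> [set id_chart] d ->
  Cinfty (cmap c @` (dom c `&` dom d)) (cmap d \o cinv c).
Proof.
move=> -> -> k; rewrite CkE; apply: smoothness_sub (@smoothness_id R n k).
by [].
Qed.

Definition euclid : manifold R :=
  Manifold euclid_cover euclid_compat (@rV_second_countable n).

Lemma chart_at_euclid (p : euclid) : chart_at p = id_chart.
Proof. exact: (chart_at_atlas p). Qed.

End IdChart.

Implicit Types M N : manifold R.

Lemma smooth_at_euclid n m (f : 'rV[R]_n -> 'rV[R]_m) x :
  @smooth_at R (euclid n) (euclid m) f x <-> germ_smooth f x.
Proof.
rewrite /smooth_at !chart_at_euclid; split=> [[_]//|Cf].
by split => //; exact: germ_continuous.
Qed.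

Lemma dM_euclid n m (f : 'rV[R]_n -> 'rV[R]_m) x :
  @dM R (euclid n) (euclid m) f x = jac f x.
Proof. by rewrite dM.unlock !chart_at_euclid. Qed.

Lemma smooth_at_cmap M (c : chart R M (dim M)) p : atlas c -> dom c p ->
  @smooth_at R M (euclid (dim M)) (cmap c) p.
Proof.
move=> ac cp; split; first exact: chart_cmap_continuous.
by rewrite chart_at_euclid; exact: transition_germ.
Qed.

Lemma smooth_at_cinv M (c : chart R M (dim M)) p : atlas c -> dom c p ->
  @smooth_at R (euclid (dim M)) M (cinv c) (cmap c p).
Proof.
move=> ac cp; split; first exact: chart_cinv_continuous.
rewrite chart_at_euclid (chart_cmapK cp).
exact: (transition_germ ac (chart_at_atlas p) cp (chart_at_dom p)).
Qed.

Lemma dM_cmap M (p : M) : @dM R M (euclid (dim M)) (cmap (chart_at p)) p = 1%:M.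
Proof.
rewrite dM.unlock chart_at_euclid -(jac_id (cmap (chart_at p) p)).
symmetry; apply: jac_eq; last exact: germ_id.
have := chart_cinvK_near (chart_at_dom p); apply: filterS => w e.
by rewrite /chart_rep /= e.
Qed.

End Euclidean.

(** * Smooth maps and tangent vectors of products *)

Section Products.
Variable R : realType.
Implicit Types M N X : manifold R.
Local Hint Resolve chart_at_atlas chart_at_dom : core.

Lemma smooth_at_pair X M N (f : X -> M) (g : X -> N) x :
  smooth_at f x -> smooth_at g x ->
  @smooth_at R X (prod_manifold M N) (fun y => (f y, g y)) x.
Proof.
move=> [cf Cf] [cg Cg].
pose e := prod_chart (chart_at (f x)) (chart_at (g x)).
have ae : @atlas R (prod_manifold M N) e.
  by exists (chart_at (f x)), (chart_at (g x)).
have de : dom e (f x, g x) by split => /=.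
apply/(smooth_at_chart (chart_at_atlas x) ae (chart_at_dom x) de).
split; first exact: cvg_pair.
exact: germ_row_mx.
Qed.

Lemma prod_near_chart M N (z : prod_manifold M N) (c : chart R M (dim M))
    (d : chart R N (dim N)) : dom c z.1 -> dom d z.2 ->
  \forall w \near cmap (prod_chart c d) z,
    cmap c (cinv c (lsubmx w)) = lsubmx w /\ cmap d (cinv d (rsubmx w)) = rsubmx w.
Proof.
move=> cz dz; have h : dom (prod_chart c d) z by split.
have := chart_near_img h; apply: filterS => _ [[a b] [/= ca db] <-].
by rewrite row_mxKl row_mxKr !chart_cmapK.
Qed.

Lemma smooth_at_fst M N (z : prod_manifold M N) :
  @smooth_at R (prod_manifold M N) M fst z.
Proof.
pose e := prod_chart (chart_at z.1) (chart_at z.2).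
have ae : @atlas R (prod_manifold M N) e.
  by exists (chart_at z.1), (chart_at z.2).
have de : dom e z by split => /=.
apply/(smooth_at_chart ae (chart_at_atlas z.1) de (chart_at_dom z.1)).
split; first by case: z {ae de e} => a b; exact: cvg_fst.
apply: germ_eq (germ_lsubmx _).
have := @prod_near_chart M N z _ _ (chart_at_dom z.1) (chart_at_dom z.2).
by apply: filterS => w [].
Qed.

Lemma smooth_at_snd M N (z : prod_manifold M N) :
  @smooth_at R (prod_manifold M N) N snd z.
Proof.
pose e := prod_chart (chart_at z.1) (chart_at z.2).
have ae : @atlas R (prod_manifold M N) e.
  by exists (chart_at z.1), (chart_at z.2).
have de : dom e z by split => /=.
apply/(smooth_at_chart ae (chart_at_atlas z.2) de (chart_at_dom z.2)).
split; first by case: z {ae de e} => a b; exact: cvg_snd.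
apply: germ_eq (germ_rsubmx _).
have := @prod_near_chart M N z _ _ (chart_at_dom z.1) (chart_at_dom z.2).
by apply: filterS => w [].
Qed.

(** The preferred chart at [z] is a product of charts [c] and [d] that may differ from the preferred
    charts of the factors. The two halves of [v] are its images under the differentials of
    [cmap c \o fst] and [cmap d \o snd], which factor through the projections. *)
Lemma prod_dM_inj M N (z : prod_manifold M N) (v : 'rV[R]_(dim M + dim N)) :
  v *m @dM R (prod_manifold M N) M fst z = 0 ->
  v *m @dM R (prod_manifold M N) N snd z = 0 -> v = 0.
Proof.
move=> v1 v2.
have [c [d [ac ad ce]]] := chart_at_atlas z.
have [cz dz] : dom c z.1 /\ dom d z.2 by have := chart_at_dom z; rewrite ce => -[].
have s0 := smooth_at_cmap (chart_at_atlas z) (chart_at_dom z).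
have E1 : v *m @dM R (prod_manifold M N) (euclid R (dim M)) (cmap c \o fst) z = lsubmx v.
  rewrite (_ : cmap c \o fst = lsubmx \o cmap (chart_at z)).
    rewrite (dM_comp (N := euclid R (dim M + dim N)) (P := euclid R (dim M)) s0).
      rewrite dM_cmap mul1mx dM_euclid jac_lin.
      by rewrite mul_rV_lin1.
    by apply/smooth_at_euclid; exact: germ_lsubmx.
  by rewrite ce; apply/funext => y /=; rewrite row_mxKl.
have E2 : v *m @dM R (prod_manifold M N) (euclid R (dim N)) (cmap d \o snd) z = rsubmx v.
  rewrite (_ : cmap d \o snd = rsubmx \o cmap (chart_at z)).
    rewrite (dM_comp (N := euclid R (dim M + dim N)) (P := euclid R (dim N)) s0).
      rewrite dM_cmap mul1mx dM_euclid jac_lin.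
      by rewrite mul_rV_lin1.
    by apply/smooth_at_euclid; exact: germ_rsubmx.
  by rewrite ce; apply/funext => y /=; rewrite row_mxKr.
rewrite -[v]hsubmxK -E1 -E2.
rewrite (dM_comp (smooth_at_fst z) (smooth_at_cmap ac cz)).
rewrite (dM_comp (smooth_at_snd z) (smooth_at_cmap ad dz)).
by rewrite !mulmxA v1 v2 !mul0mx row_mx0.
Qed.

End Products.

(** * The inverse function theorem on manifolds *)

Section ManifoldInverse.
Variable R : realType.
Implicit Types M N X : manifold R.
Local Hint Resolve chart_at_atlas chart_at_dom : core.

Lemma row_free_inv m n (A : 'M[R]_(m, n)) : row_free A -> m = n ->
  exists B, A *m B = 1%:M /\ B *m A = 1%:M.
Proof.
move=> fA mn; case: n / mn A fA => A; rewrite row_free_unit => uA.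
by exists (invmx A); rewrite mulmxV // mulVmx.
Qed.

Lemma row_free_ker0 m n (A : 'M[R]_(m, n)) :
  row_free A <-> forall v : 'rV[R]_m, v *m A = 0 -> v = 0.
Proof.
split=> [fA v vA|H]; first by apply: (row_free_inj fA); rewrite vA mul0mx.
rewrite -kermx_eq0; apply/rowV0P => v /sub_kermxP; exact: H.
Qed.

Lemma open_preimage_dom (S T : topologicalType) (D : set S) (f : S -> T) (O : set T) :
  open D -> (forall x, D x -> {for x, continuous f}) -> open O ->
  open (D `&` f @^-1` O).
Proof.
move=> oD cf oO; rewrite openE => x [Dx Ox]; apply: filterI.
  exact: open_nbhs_nbhs.
by apply: (cf x Dx); apply: open_nbhs_nbhs.
Qed.

(** Multiplying the chart representative by the inverse [B] of its Jacobian normalizes the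
    derivative at the point, so that [inverse_function] applies. *)
Lemma manifold_inverse M N (f : M -> N) (p : M) : dim M = dim N ->
  smooth_at f p -> row_free (dM f p) ->
  exists (U : set M) (h : N -> M), [/\ open U, U p & open (f @` U)] /\
    (forall q, U q -> h (f q) = q /\ smooth_at f q) /\
    (forall y, (f @` U) y -> smooth_at h y).
Proof.
move=> dMN sf fA; case: (sf) => cf Cf.
pose c := chart_at p; pose d := chart_at (f p).
pose x0 := cmap c p.
have [B [AB BA]] := row_free_inv fA dMN.
rewrite dM.unlock -/c -/d -/x0 in fA AB BA.
set A := jac _ _ in fA AB BA.
change (germ_smooth (chart_rep c d f) x0) in Cf.
pose F' := (fun y : 'rV[R]_(dim N) => y *m B) \o chart_rep c d f.
have CF' : germ_smooth F' x0 by apply: germ_comp => //; exact: germ_mulmx.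
have dF' v : 'd F' x0 v = v.
  have dF := germ_differentiable CF'.
  rewrite -deriveE // -jacE // jac_comp //; last exact: germ_mulmx.
  by rewrite jac_mulmx AB mulmx1.
have [U0 [oU0 U0x0 CU0]] := CF'.
have : \forall w \near x0, [/\ U0 w, (cmap c @` dom c) w, dom d (f (cinv c w))
    & smooth_at f (cinv c w)].
  have h1 : \forall w \near x0, U0 w by exact: near_open.
  have h2 := chart_near_img (chart_at_dom p).
  have h3 : \forall w \near x0, dom d (f (cinv c w)).
    apply: (chart_near_cinv (chart_at_dom p) (P := fun q => dom d (f q))).
    by apply: cf; exact: (chart_near_dom (chart_at_dom (f p))).
  have h4 : \forall w \near x0, smooth_at f (cinv c w).
    by apply: (chart_near_cinv (chart_at_dom p)); exact: smooth_at_near.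
  by near=> w; split; near: w.
move=> /near_openP[W [oW Wx0 WP]].
have CW k : smoothness k W F' by apply: smoothness_sub (CU0 k) => w /WP[].
have [V [h0 [[oV Vx0 VW oFV] [h0F Ch0]]]] := inverse_function oW Wx0 CW dF'.
pose U := dom c `&` cmap c @^-1` V.
have ac : atlas c by exact: chart_at_atlas.
have ad : atlas d by exact: chart_at_atlas.
have dp : dom d (f p) by exact: chart_at_dom.
have oU : open U.
  by apply: open_preimage_dom => //; [exact: dom_open|move=> q; exact: chart_cmap_continuous].
have UP q : U q -> dom d (f q) /\ smooth_at f q.
  by move=> [cq /VW/WP[_ _ + +]]; rewrite chart_cmapK.
pose h (y : N) : M := cinv c (h0 (cmap d y *m B)).
have F'E q : U q -> F' (cmap c q) = cmap d (f q) *m B.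
  by move=> [cq _]; rewrite /F' /chart_rep /= chart_cmapK.
have hf q : U q -> h (f q) = q.
  by move=> Uq; rewrite /h -F'E // h0F ?chart_cmapK //; case: Uq.
have fUE : f @` U = dom d `&` (fun y => cmap d y *m B) @^-1` (F' @` V).
  apply/seteqP; split => [_ [q Uq <-]|y [dy [w Vw wE]]].
    split; first by case: (UP q Uq).
    by exists (cmap c q); [case: Uq|rewrite F'E].
  have [_ cw dw _] := WP _ (VW _ Vw).
  have [cw' cwE] := chart_cinvK cw.
  exists (cinv c w); first by split => //=; rewrite cwE.
  rewrite -[RHS](chart_cmapK dy) -[LHS](chart_cmapK dw); congr (cinv d _).
  have := congr1 (mulmx^~ A) wE.
  by rewrite /F' /= -!mulmxA BA !mulmx1.
exists U, h; split; first split => //.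
- by split => //; exact: chart_at_dom.
- rewrite fUE.
  apply: (open_preimage_dom (f := fun y => cmap d y *m B) (dom_open d) _ oFV).
  move=> y dy; apply: (@continuous_comp _ _ _ (cmap d) (fun w => w *m B)).
    exact: chart_cmap_continuous.
  exact: (germ_continuous (germ_mulmx B _)).
split=> [q Uq|y].
  by split; [exact: hf|case: (UP q Uq)].
move=> fUy; have : (f @` U) y by [].
rewrite {1}fUE => -[dy [w Vw wE]].
have s1 := smooth_at_cmap ad dy.
have s2 : @smooth_at R (euclid R (dim N)) (euclid R (dim M)) (mulmx^~ B) (cmap d y).
  by apply/smooth_at_euclid; exact: germ_mulmx.
have s3 : @smooth_at R (euclid R (dim M)) (euclid R (dim M)) h0 (cmap d y *m B).
  apply/smooth_at_euclid; exists (F' @` V); split => //.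
  by exists w.
have hE : h0 (cmap d y *m B) = w by rewrite -wE h0F.
have [_ cw _ _] := WP _ (VW _ Vw).
have s4 : @smooth_at R (euclid R (dim M)) M (cinv c) (h0 (cmap d y *m B)).
  have [cw' cwE] := chart_cinvK cw.
  by rewrite hE -cwE; exact: smooth_at_cinv.
have s12 := smooth_at_comp s1 s2.
have s123 := smooth_at_comp s12 s3.
exact: (smooth_at_comp s123 s4).
Unshelve. all: by end_near. Qed.

Lemma local_inverse_free M N (f : M -> N) (h : N -> M) (U : set M) q : open U ->
  U q -> (forall q, U q -> h (f q) = q) -> smooth_at f q -> smooth_at h (f q) ->
  row_free (dM f q).
Proof.
move=> oU Uq hf sf sh; apply/row_freeP; exists (dM h (f q)).
rewrite -dM_comp // -(dM_id q); apply: dM_eq; last exact: smooth_at_comp.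
by apply/near_openP; exists U.
Qed.

End ManifoldInverse.

(** * Submanifolds and fibre products *)

Section SubtypeTopology.
Variables (T : topologicalType) (S : set T).

Lemma subtype_openP (O : set (set_type S)) :
  open O <-> exists A, open A /\ O = set_val @^-1` A.
Proof. by split=> [[A oA <-]|[A [oA ->]]]; exists A. Qed.

Lemma subtype_val_continuous : continuous (@set_val T S : set_type S -> T).
Proof. exact: initial_continuous. Qed.

Lemma subtype_continuous (X : topologicalType) (f : X -> set_type S) x :
  {for x, continuous (set_val \o f)} -> {for x, continuous f}.
Proof.
move=> cf A /=; rewrite nbhsE => - [Q [] /subtype_openP [B [oB ->]] /= Bfx QA].
have : \forall y \near x, B (set_val (f y)) by apply: cf; exact: open_nbhs_nbhs.
by apply: filterS => y By; exact: QA.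
Qed.

Lemma subtype_second_countable : @second_countable T ->
  @second_countable (set_type S).
Proof.
move=> [B cB [oB bB]].
exists [set set_val @^-1` U | U in B].
  exact: (sub_countable (card_image_le _ _) cB).
split=> [_ [U BU <-]|x A].
  by apply/subtype_openP; exists U; split => //; exact: oB.
rewrite nbhsE => - [Q [] /subtype_openP [U [oU ->]] /= Ux QA].
have [V [BV Vx] VU] := bB (set_val x) U (open_nbhs_nbhs (conj oU Ux)).
exists (set_val @^-1` V); first by split => //; exists V.
by move=> y Vy; apply: QA; exact: VU.
Qed.

End SubtypeTopology.

Lemma injective_hausdorff (X Y : topologicalType) (f : X -> Y) :
  injective f -> continuous f -> hausdorff_space Y -> hausdorff_space X.
Proof.
move=> injf cf; rewrite !open_hausdorff => H x y xy.
have [|[A B] /= [xA yB] [oA oB /eqP AB]] := H (f x) (f y).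
  by apply: contra xy => /eqP /injf ->.
exists (f @^-1` A, f @^-1` B) => /=; first by move: xA yB; rewrite !inE.
split; [exact: open_comp|exact: open_comp|].
by rewrite -preimage_setI AB preimage_set0.
Qed.

Lemma prod_hausdorff (X Y : topologicalType) :
  hausdorff_space X -> hausdorff_space Y -> hausdorff_space (X * Y)%type.
Proof.
rewrite !open_hausdorff => HX HY [x y] [x' y'] ne.
have [xx'|xx'] := eqVneq x x'.
  have yy' : y != y' by apply: contra ne => /eqP ->; rewrite xx'.
  have [[A B] /= [] ] := HY _ _ yy'; rewrite !inE => Ay By [oA oB AB].
  exists (snd @^-1` A, snd @^-1` B) => /=; first by rewrite !inE.
  split; try by apply: open_comp => // z _; exact: cvg_snd.
  by rewrite -preimage_setI AB preimage_set0.
have [[A B] /= [] ] := HX _ _ xx'; rewrite !inE => Ay By [oA oB AB].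
exists (fst @^-1` A, fst @^-1` B) => /=; first by rewrite !inE.
split; try by apply: open_comp => // z _; exact: cvg_fst.
by rewrite -preimage_setI AB preimage_set0.
Qed.

Section SmoothCriteria.
Variable R : realType.
Implicit Types M N X : manifold R.
Local Hint Resolve chart_at_atlas chart_at_dom : core.

Lemma smooth_at_target M N (f : M -> N) p (d : chart R N (dim N)) :
  {for p, continuous f} -> atlas d -> dom d (f p) ->
  @smooth_at R M (euclid R (dim N)) (cmap d \o f) p -> smooth_at f p.
Proof.
move=> cf ad dp [_]; rewrite chart_at_euclid => C.
by apply/(smooth_at_chart (chart_at_atlas p) ad (chart_at_dom p) dp).
Qed.

Lemma smooth_at_source M N (f : M -> N) p (c : chart R M (dim M)) :
  atlas c -> dom c p ->
  @smooth_at R (euclid R (dim M)) N (f \o cinv c) (cmap c p) -> smooth_at f p.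
Proof.
move=> ac cp C; have C' := smooth_at_comp (smooth_at_cmap ac cp) C.
apply: smooth_at_eq C'; have := chart_near_dom cp; apply: filterS => q cq /=.
by rewrite chart_cmapK.
Qed.

End SmoothCriteria.

(* A slice near [p] consists of a coordinate map [phi] of the ambient         *)
(* manifold on [V] and a local parametrization [psi] of [S] on [W], inverse   *)
(* to each other between [S `&` V] and [W].                                   *)
Section Slices.
Variables (R : realType) (M : manifold R) (S : set M) (n : nat).

Definition slice (V : set M) (phi : M -> 'rV[R]_n) (W : set 'rV[R]_n)
    (psi : 'rV[R]_n -> M) : Prop :=
  [/\ open V, open W, forall q, V q -> @smooth_at R M (euclid R n) phi q,
      forall w, W w -> [/\ @smooth_at R (euclid R n) M psi w, S (psi w),
        V (psi w) & phi (psi w) = w] &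
      forall q, S q -> V q -> W (phi q) /\ psi (phi q) = q].

Definition sliced : Prop := forall p, S p ->
  exists V phi W psi, slice V phi W psi /\ V p.

Hypothesis HS : sliced.

Definition sub_atlas : set (chart R (set_type S) n) :=
  [set c | (exists phi : M -> euclid R n,
      forall x, dom c x -> smooth_at phi (set_val x) /\ cmap c x = phi (set_val x)) /\
    forall w, (cmap c @` dom c) w ->
      @smooth_at R (euclid R n) M (set_val \o cinv c) w].

Lemma sub_atlas_cover (p : set_type S) : exists c, sub_atlas c /\ dom c p.
Proof.
have [V [phi [W [psi [[oV oW sphi sW SV] Vp]]]]] := HS (set_valP p).
pose D : set (set_type S) := set_val @^-1` V.
pose cm (x : set_type S) := phi (set_val x).
pose ci (w : 'rV[R]_n) : set_type S :=
  match pselect (S (psi w)) with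
  | left H => exist _ (psi w) (mem_set H) | right _ => p end.
have ciE w : W w -> set_val (ci w) = psi w.
  by move=> /sW[_ Sw _ _]; rewrite /ci; case: pselect.
have oD : open D by apply/subtype_openP; exists V.
have imgE : cm @` D = W.
  apply/seteqP; split=> [_ [x Vx <-]|w Ww].
    by have [] := SV _ (set_valP x) Vx.
  have [_ Sw Vw phiw] := sW _ Ww.
  by exists (ci w); rewrite /D /cm /= ciE.
have oI : open (cm @` D) by rewrite imgE.
have cK : {in D, cancel cm ci}.
  move=> x; rewrite inE => Vx; apply: val_inj.
  have [Wx xE] := SV _ (set_valP x) Vx.
  by rewrite -[LHS]/(set_val (ci (cm x))) ciE.
have ccm : {in D, continuous cm}.
  move=> x; rewrite inE => Vx.
  apply: (@continuous_comp _ _ _ set_val phi); first exact: subtype_val_continuous.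
  by case: (sphi _ Vx).
have near_ci w : W w -> \forall w' \near w, psi w' = (set_val \o ci) w'.
  move=> Ww; have : \forall w' \near w, W w' by exact: near_open.
  by apply: filterS => w' Ww' /=; rewrite ciE.
have sci w : W w -> @smooth_at R (euclid R n) M (set_val \o ci) w.
  move=> Ww; case: (sW _ Ww) => sp _ _ _.
  exact: (@smooth_at_eq R (euclid R n) M psi _ w (near_ci w Ww) sp).
have cci : {in cm @` D, continuous ci}.
  move=> w; rewrite inE imgE => Ww; apply: subtype_continuous.
  by case: (sci _ Ww).
exists (Chart oD oI cK ccm cci); split=> //; split => /= [|w].
  by exists phi => x Vx; split => //; exact: sphi.
move=> H; apply: sci; rewrite -imgE; exact: H.
Qed.

Lemma sub_atlas_compat c d : sub_atlas c -> sub_atlas d ->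
  Cinfty (cmap c @` (dom c `&` dom d)) (cmap d \o cinv c).
Proof.
move=> [_ sc] [[phi sphi] _].
have oI : open (cmap c @` (dom c `&` dom d)).
  by apply: open_cmap_img; [exact: open_domI|exact: subIsetl].
apply/(Cinfty_germ _ oI) => _ [x [cx dx] <-].
have cE : (set_val \o cinv c) (cmap c x) = set_val x by rewrite /= chart_cmapK.
have : smooth_at phi ((set_val \o cinv c) (cmap c x)).
  by rewrite cE; case: (sphi _ dx).
have ix : (cmap c @` dom c) (cmap c x) by exists x.
move=> /(smooth_at_comp (sc _ ix)) /smooth_at_euclid; apply: germ_eq.
have := chart_near_cinv cx (chart_near_dom dx).
by apply: filterS => w /sphi[_ e]; symmetry; exact: e.
Qed.

Definition submanifold : manifold R := Manifold sub_atlas_cover sub_atlas_compat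
  (subtype_second_countable S (manifold_second_countable M)).

Definition incl (x : submanifold) : M := set_val x.

Lemma inclP (x : submanifold) : S (incl x).
Proof. exact: set_valP. Qed.

Lemma incl_inj : injective incl.
Proof. by move=> x y; exact: val_inj. Qed.

Lemma incl_smooth (x : submanifold) : smooth_at incl x.
Proof.
have [_ sc] := chart_at_atlas x.
apply: (smooth_at_source (chart_at_atlas x) (chart_at_dom x)).
by apply: sc; exists x => //; exact: chart_at_dom.
Qed.

(** A chart of the submanifold is the restriction of an ambient smooth map [phi], so in coordinates
    [f] is [phi] after [incl \o f]. *)
Lemma smooth_at_sub (X : manifold R) (f : X -> submanifold) x :
  smooth_at (incl \o f) x -> smooth_at f x.
Proof.
move=> sf; have [[phi sphi] _] := chart_at_atlas (f x).
have df := chart_at_dom (f x).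
have cf : {for x, continuous f} by apply: subtype_continuous; case: sf.
apply: (smooth_at_target cf (chart_at_atlas (f x)) df).
have [sp _] := sphi _ df.
apply: smooth_at_eq (smooth_at_comp sf sp).
have : \forall y \near x, dom (chart_at (f x)) (f y).
  exact: (cf _ (chart_near_dom df)).
by apply: filterS => y /sphi[_ e]; symmetry; exact: e.
Qed.

Lemma incl_free (x : submanifold) : row_free (dM incl x).
Proof.
have [[phi sphi] _] := chart_at_atlas x; have dx := chart_at_dom x.
have [sp _] := sphi _ dx.
apply/row_freeP; exists (@dM R M (euclid R n) phi (incl x)).
rewrite -(dM_comp (incl_smooth x) sp) -[RHS](dM_cmap x).
apply: (@dM_eq R submanifold (euclid R n) (phi \o incl) (cmap (chart_at x)) x);
  last exact: (smooth_at_comp (incl_smooth x) sp).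
have := chart_near_dom dx; apply: filterS => y /sphi[_ e]; symmetry; exact: e.
Qed.

Definition to_sub (q : M) (Sq : S q) : submanifold := exist _ q (mem_set Sq).

End Slices.

(** * The local normal form of a submersion *)

Section SubmersionCharts.
Variable R : realType.
Implicit Types M N X : manifold R.
Local Hint Resolve chart_at_atlas chart_at_dom : core.

Lemma smooth_at_row_mx X n m (f : X -> 'rV[R]_n) (g : X -> 'rV[R]_m) x :
  @smooth_at R X (euclid R n) f x -> @smooth_at R X (euclid R m) g x ->
  @smooth_at R X (euclid R (n + m)) (fun y => row_mx (f y) (g y)) x.
Proof.
rewrite /smooth_at !chart_at_euclid => -[cf Cf] [cg Cg].
by split; [exact: row_mx_continuous|exact: germ_row_mx].
Qed.

Lemma fst_full M N (z : prod_manifold M N) :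
  row_full (@dM R (prod_manifold M N) M fst z).
Proof.
have s : @smooth_at R M (prod_manifold M N) (fun x => (x, z.2)) z.1.
  by apply: smooth_at_pair; [exact: smooth_at_id|exact: smooth_at_cst].
have sz := smooth_at_fst z; rewrite {1}[z]surjective_pairing in sz.
have := dM_comp s sz; rewrite -[X in dM X _]/(@id M) dM_id -surjective_pairing => e.
by apply/row_fullP; eexists; symmetry; exact: e.
Qed.

(** [B] reads off the coordinates of a kernel vector in a basis of the kernel. *)
Lemma kernel_complement m n (A : 'M[R]_(m, n)) k : row_full A -> m = (n + k)%N ->
  exists B : 'M[R]_(m, k), forall v : 'rV[R]_m, v *m A = 0 -> v *m B = 0 -> v = 0.
Proof.
move=> fA mE; have kE : \rank (kermx A) = k.
  by rewrite mxrank_ker (eqP fA) mE addKn.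
exists (pinvmx (row_base (kermx A)) *m castmx (erefl _, kE) 1%:M).
move=> v /sub_kermxP; rewrite -(eq_row_base (kermx A)) => /submxP[u ->].
rewrite mulmxA mulmxKp ?row_base_free //.
case: k / kE {mE} => /=; rewrite castmx_id mulmx1 => ->.
by rewrite mul0mx.
Qed.

(** Completing [f] by [k] coordinates along the kernel of its differential gives a local
    diffeomorphism [(f, pi)]. Its differential stays invertible on all of [U], so [f] stays
    submersive there. *)
Lemma submersion_chart M N (f : M -> N) p k : dim M = (dim N + k)%N ->
  smooth_at f p -> row_full (dM f p) ->
  exists (pi : M -> 'rV[R]_k) (U : set M) (h : N * 'rV[R]_k -> M),
    [/\ open U, U p,
      @open (prod_manifold N (euclid R k)) ((fun q => (f q, pi q)) @` U),
      forall q, U q -> [/\ h (f q, pi q) = q, smooth_at f q, row_full (dM f q) &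
        @smooth_at R M (euclid R k) pi q] &
      forall y, ((fun q => (f q, pi q)) @` U) y ->
        @smooth_at R (prod_manifold N (euclid R k)) M h y].
Proof.
move=> dE sf ff; have [B BP] := kernel_complement ff dE.
pose pi (q : M) : 'rV[R]_k := cmap (chart_at p) q *m B.
pose E : manifold R := prod_manifold N (euclid R k).
pose e (q : M) : E := (f q, pi q).
have sc := smooth_at_cmap (chart_at_atlas p) (chart_at_dom p).
have smul x : @smooth_at R (euclid R (dim M)) (euclid R k) (mulmx^~ B) x.
  by apply/smooth_at_euclid; exact: germ_mulmx.
have spi : @smooth_at R M (euclid R k) pi p by exact: (smooth_at_comp sc (smul _)).
have dpi : @dM R M (euclid R k) pi p = B.
  rewrite (dM_comp (N := euclid R (dim M)) (P := euclid R k) sc (smul _)).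
  by rewrite dM_cmap mul1mx dM_euclid jac_mulmx.
have se : @smooth_at R M E e p by exact: smooth_at_pair.
have efst q : @smooth_at R M E e q -> smooth_at f q /\ @smooth_at R M (euclid R k) pi q.
  move=> sq; split.
    exact: (smooth_at_comp (P := N) sq (smooth_at_fst (e q))).
  exact: (smooth_at_comp (P := euclid R k) sq (smooth_at_snd (e q))).
have fe : row_free (dM e p).
  apply/row_free_ker0 => v ve; apply: BP.
    have := dM_comp (P := N) se (smooth_at_fst (e p)).
    by rewrite -[X in dM X p = _]/f => ->; rewrite mulmxA ve mul0mx.
  have := dM_comp (P := euclid R k) se (smooth_at_snd (e p)).
  by rewrite -[X in dM X p = _]/pi dpi => ->; rewrite mulmxA ve mul0mx.
have [U [h [[oU Up oeU] [hU hV]]]] := manifold_inverse (N := E) dE se fe.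
exists pi, U, h; split; [exact: oU|exact: Up|exact: oeU| |exact: hV].
move=> q Uq; have [hq sq] := hU _ Uq; have [sfq spq] := efst q sq.
split=> //; have shq : smooth_at h (e q) by apply: hV; exists q.
have feq := local_inverse_free oU Uq (fun q Uq => (hU q Uq).1) sq shq.
have [B' [_ BA]] := row_free_inv feq dE.
have -> : dM f q = dM e q *m dM (M := E) (N := N) fst (e q).
  by rewrite -(dM_comp (P := N) sq (smooth_at_fst (e q))).
have /row_fullP[C CA] := fst_full (e q).
by apply/row_fullP; exists (C *m B'); rewrite mulmxA -(mulmxA C) BA mulmx1.
Qed.

End SubmersionCharts.

Section OpenSubmanifolds.
Variables (R : realType) (M : manifold R) (S : set M).
Hypothesis oS : open S.

Lemma open_sliced : sliced S (dim M).
Proof.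
move=> p Sp; have [ac dc] := (chart_at_atlas p, chart_at_dom p).
set c := chart_at p in ac dc.
have oV : open (S `&` dom c) by apply: openI => //; exact: dom_open.
have sV : S `&` dom c `<=` dom c by exact: subIsetr.
exists (S `&` dom c), (cmap c), (cmap c @` (S `&` dom c)), (cinv c); split=> //.
split=> [||q [_ cq]|_ [q [Sq cq] <-]|q Sq [_ cq]] //; first exact: open_cmap_img.
- exact: smooth_at_cmap.
- by split; [exact: smooth_at_cinv|rewrite chart_cmapK..].
- by split; [exists q|rewrite chart_cmapK].
Qed.

Definition open_submanifold : manifold R := submanifold open_sliced.

End OpenSubmanifolds.

(** * Fibre products along a submersion *)

Section FibreProduct.
Variables (R : realType) (A B Z : manifold R) (f : A -> Z) (g : B -> Z).
Hypothesis sf : forall a, smooth_at f a.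
Hypothesis sg : forall b, smooth_at g b.
Hypothesis gfull : forall b, row_full (dM g b).

Let AB : manifold R := prod_manifold A B.
Let S : set AB := [set ab | f ab.1 = g ab.2].
Let k := (dim B - dim Z)%N.

(** A point of [B] makes the truncated subtraction in [k] exact. *)
Lemma dim_full (b : B) : dim B = (dim Z + k)%N.
Proof.
rewrite /k subnKC //; have := gfull b; rewrite /row_full => /eqP <-.
exact: rank_leq_row.
Qed.

(** Near [b0] the submersion [g] looks like the projection of $Z\times\mathbb{R}^k$ to $Z$. The
    equation then fixes the $Z$-component of [b], leaving [a] and the $\mathbb{R}^k$-component as
    free coordinates. *)
Lemma fibre_sliced : sliced S (dim A + k).
Proof.
move=> [a0 b0] e0.
have [pi [U [h [oU Ub0 oE eU hU]]]] := submersion_chart (dim_full b0) (sg b0) (gfull b0).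
set E := (_ @` U) in oE hU.
have [ac dc] := (chart_at_atlas a0, chart_at_dom a0); set c := chart_at a0 in ac dc.
pose V : set AB := dom c `*` U.
pose phi (ab : AB) : 'rV[R]_(dim A + k) := row_mx (cmap c ab.1) (pi ab.2).
pose fw (w : 'rV[R]_(dim A + k)) : prod_manifold Z (euclid R k) :=
  (f (cinv c (lsubmx w)), rsubmx w).
pose D : set 'rV[R]_(dim A + k) := lsubmx @^-1` (cmap c @` dom c).
pose W := D `&` fw @^-1` E.
pose psi (w : 'rV[R]_(dim A + k)) : AB := (cinv c (lsubmx w), h (fw w)).
have sl w : @smooth_at R (euclid R (dim A + k)) (euclid R (dim A)) lsubmx w.
  by apply/smooth_at_euclid; exact: germ_lsubmx.
have sr w : @smooth_at R (euclid R (dim A + k)) (euclid R k) rsubmx w.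
  by apply/smooth_at_euclid; exact: germ_rsubmx.
have sc w : D w -> @smooth_at R (euclid R (dim A + k)) A (cinv c \o lsubmx) w.
  move=> Dw; have [q cq qw] := Dw; apply: (smooth_at_comp (N := euclid R (dim A))).
    exact: sl.
  by rewrite -qw; exact: smooth_at_cinv.
have sfw w : D w -> @smooth_at R (euclid R (dim A + k)) (prod_manifold Z (euclid R k)) fw w.
  move=> Dw; apply: smooth_at_pair; last exact: sr.
  exact: (smooth_at_comp (sc w Dw) (sf _)).
have oD : open D.
  by apply: open_comp; [move=> w _; exact: continuous_lsubmx|exact: img_open].
have oW : open W.
  apply: (open_preimage_dom (f := fw) oD _ oE) => w Dw.
  by case: (sfw w Dw).
exists V, phi, W, psi; split; last by split.
split=> //.
- rewrite openE => -[a b] [/= ca Ub]; exists (dom c, U) => //=.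
  by split; [exact: chart_near_dom|exact: open_nbhs_nbhs].
- move=> [a b] [/= ca Ub]; apply: smooth_at_row_mx.
    exact: (smooth_at_comp (@smooth_at_fst R A B (a, b)) (smooth_at_cmap ac ca)).
  have [_ _ _ spi] := eU _ Ub.
  exact: (smooth_at_comp (@smooth_at_snd R A B (a, b)) spi).
- move=> w [Dw [b Ub bE]].
  have [hb sgb _ spi] := eU _ Ub.
  have shw : @smooth_at R (prod_manifold Z (euclid R k)) B h (fw w).
    by apply: hU; exists b.
  have hE : h (fw w) = b by rewrite -bE.
  have [cw cwE] := chart_cinvK Dw.
  split.
  + apply: smooth_at_pair; first exact: sc.
    exact: (smooth_at_comp (sfw w Dw) shw).
  + by rewrite /S /= hE; case: bE => -> _.
  + by split => //=; rewrite hE.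
  + by rewrite /phi /= cwE hE; case: bE => _ ->; rewrite hsubmxK.
- move=> [a b] /= abE [/= ca Ub].
  have [hb _ _ _] := eU _ Ub.
  rewrite /S /= in abE.
  have fwE : fw (phi (a, b)) = (g b, pi b).
    by rewrite /fw /phi row_mxKl row_mxKr chart_cmapK //= abE.
  split; last by rewrite /psi fwE hb /phi row_mxKl chart_cmapK.
  by split; [rewrite /D /phi /= row_mxKl; exists a|rewrite /= fwE; exists b].
Qed.

Definition fibre_product : manifold R := submanifold fibre_sliced.

Definition fp1 (x : fibre_product) : A := (incl x).1.
Definition fp2 (x : fibre_product) : B := (incl x).2.

Lemma fp_eq (x : fibre_product) : f (fp1 x) = g (fp2 x).
Proof. exact: (inclP x). Qed.

Definition fp_mk a b (e : f a = g b) : fibre_product := to_sub fibre_sliced (q := (a, b)) e.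

Lemma fp_ext (x y : fibre_product) : fp1 x = fp1 y -> fp2 x = fp2 y -> x = y.
Proof.
rewrite /fp1 /fp2 => e1 e2; apply: (@incl_inj R AB S _ fibre_sliced).
by rewrite [LHS]surjective_pairing [RHS]surjective_pairing e1 e2.
Qed.

Lemma fp1_smooth x : smooth_at fp1 x.
Proof. exact: (smooth_at_comp (incl_smooth x) (smooth_at_fst _)). Qed.

Lemma fp2_smooth x : smooth_at fp2 x.
Proof. exact: (smooth_at_comp (incl_smooth x) (smooth_at_snd _)). Qed.

Lemma smooth_at_fp (X : manifold R) (h : X -> fibre_product) x :
  smooth_at (fp1 \o h) x -> smooth_at (fp2 \o h) x -> smooth_at h x.
Proof.
move=> s1 s2; apply: smooth_at_sub; have := smooth_at_pair s1 s2.
apply: smooth_at_eq; apply: nearW => y.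
by rewrite /fp1 /fp2 /= -surjective_pairing.
Qed.

Lemma fp_tangent (x : fibre_product) (v : 'rV[R]_(dim A + k)) :
  v *m dM fp1 x = 0 -> v *m dM fp2 x = 0 -> v = 0.
Proof.
rewrite (dM_comp (incl_smooth x) (smooth_at_fst _)).
rewrite (dM_comp (incl_smooth x) (smooth_at_snd _)) !mulmxA => v1 v2.
have := (row_free_ker0 _).1 (incl_free x) v; apply.
exact: prod_dM_inj v1 v2.
Qed.

Lemma fp_pullback : is_pullback fp1 fp2 f g.
Proof.
split; [apply/smoothP; exact: fp1_smooth|apply/smoothP; exact: fp2_smooth| |].
  by apply/funext => x; exact: fp_eq.
move=> X a b /smoothP sa /smoothP sb ab.
have e x : f (a x) = g (b x) by have := congr1 (@^~ x) ab.
exists (fun x => fp_mk (e x)); split.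
  by split=> //; apply/smoothP => x; exact: smooth_at_fp.
move=> h [_ h1 h2]; apply/funext => x; apply: fp_ext.
  by have := congr1 (@^~ x) h1 => /= ->.
by have := congr1 (@^~ x) h2 => /= ->.
Qed.

End FibreProduct.

(** * Isotropy and orbits *)

Section GroupoidBasics.
Variables (R : realType) (G : smooth_groupoid R).
Implicit Types (g h : arr G) (x : obj G).
Local Notation src := (@src R G).
Local Notation tgt := (@tgt R G).

Lemma src_smooth_at g : smooth_at src g.
Proof. by move/smoothP: (@src_smooth R G); exact. Qed.

Lemma tgt_smooth_at g : smooth_at tgt g.
Proof. by move/smoothP: (@tgt_smooth R G); exact. Qed.

Lemma unit_smooth_at x : smooth_at (@unit_arr R G) x.
Proof. by move/smoothP: (@unit_smooth R G); exact. Qed.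

Lemma inv_smooth_at g : smooth_at (@inv_arr R G) g.
Proof. by move/smoothP: (@inv_smooth R G); exact. Qed.

Lemma src_full g : row_full (dM src g).
Proof. exact: ((submersionP (@src_smooth R G)).1 (@src_submersion R G)). Qed.

Lemma tgt_full g : row_full (dM tgt g).
Proof. exact: ((submersionP (@tgt_smooth R G)).1 (@tgt_submersion R G)). Qed.

Lemma comp_smooth_at (X : manifold R) (a b : X -> arr G) :
  (forall y, smooth_at a y) -> (forall y, smooth_at b y) ->
  (forall y, src (a y) = tgt (b y)) ->
  forall y, smooth_at (fun y => comp (a y) (b y)) y.
Proof.
move=> sa sb ab; have [G2 [p [q [[_ _ _ univ] /smoothP sc]]]] := @comp_smooth R G.
have [||| h [[/smoothP sh ph qh] _] y] := univ X a b.
- exact/smoothP.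
- exact/smoothP.
- by apply/funext.
have := smooth_at_comp (sh y) (sc (h y)).
by rewrite -ph -qh.
Qed.

Lemma inv_arrK g : inv_arr (inv_arr g) = g.
Proof.
rewrite -[LHS](comp_unitr (inv_arr (inv_arr g))) src_inv tgt_inv -(comp_invl g).
rewrite compA ?src_inv ?tgt_inv // comp_invl src_inv.
by rewrite comp_unitl.
Qed.

Lemma comp_cancelr g h : src g = tgt h -> comp (comp g h) (inv_arr h) = g.
Proof.
by move=> e; rewrite -compA ?tgt_inv // comp_invr -e comp_unitr.
Qed.

Lemma comp_cancell g h : src g = tgt h -> comp (inv_arr g) (comp g h) = h.
Proof.
by move=> e; rewrite compA ?src_inv // comp_invl e comp_unitl.
Qed.

Section SourceFibre.
Variable x : obj G.
Let pt (_ : euclid R 0) : obj G := x.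

Lemma pt_smooth a : smooth_at pt a.
Proof. exact: smooth_at_cst. Qed.

(** The fibre product with a one-point manifold, so that the results on fibre products apply. *)
Definition src_fibre : manifold R := fibre_product pt_smooth src_smooth_at src_full.

Definition fibre_arr : src_fibre -> arr G :=
  @fp2 _ _ _ _ _ _ pt_smooth src_smooth_at src_full.

Lemma src_fibre_arr y : src (fibre_arr y) = x.
Proof. by rewrite -(fp_eq y). Qed.

Definition to_fibre g (e : src g = x) : src_fibre :=
  fp_mk pt_smooth src_smooth_at src_full (a := 0) (esym e).

Lemma to_fibreK g (e : src g = x) : fibre_arr (to_fibre e) = g.
Proof. by []. Qed.

Lemma fibre_arr_inj : injective fibre_arr.
Proof.
move=> y z e; apply: fp_ext => //.
by apply/rowP => -[].
Qed.

Lemma fibre_arr_smooth y : smooth_at fibre_arr y.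
Proof. exact: fp2_smooth. Qed.

Lemma smooth_at_fibre (X : manifold R) (h : X -> src_fibre) z :
  smooth_at (fibre_arr \o h) z -> smooth_at h z.
Proof.
move=> s; apply: smooth_at_fp; last exact: s.
apply: smooth_at_eq (smooth_at_cst (0 : euclid R 0) z).
by apply: nearW => w; apply/rowP => -[].
Qed.

Lemma dim_src_fibre : dim src_fibre = (dim (arr G) - dim (obj G))%N.
Proof. by []. Qed.

Lemma fibre_arr_free y : row_free (dM fibre_arr y).
Proof.
apply/row_free_ker0 => v v0; apply: (fp_tangent _ v0).
exact: thinmx0.
Qed.

(** [src] is constant on the fibre, which gives one inclusion; equality follows by counting
    dimensions. *)
Lemma fibre_arr_ker y : (dM fibre_arr y :=: kermx (dM src (fibre_arr y)))%MS.
Proof.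
have sub : (dM fibre_arr y <= kermx (dM src (fibre_arr y)))%MS.
  apply/sub_kermxP; rewrite -dM_comp; [|exact: fibre_arr_smooth|exact: src_smooth_at].
  rewrite (_ : src \o fibre_arr = fun=> x); first exact: dM_cst.
  by apply/funext => z; exact: src_fibre_arr.
apply/eqmxP; rewrite -(geq_leqif (mxrank_leqif_eq sub)).
rewrite mxrank_ker (eqP (fibre_arr_free y)) (eqP (src_full _)).
by rewrite dim_src_fibre.
Qed.

End SourceFibre.

(* The row space is the tangent space of the orbit at [tgt g].                *)
Definition orbit_tangent g : 'M[R]_(dim (arr G), dim (obj G)) :=
  kermx (dM src g) *m dM tgt g.

Lemma orbit_tangent_fibre x (y : src_fibre x) :
  (dM (tgt \o @fibre_arr x) y :=: orbit_tangent (fibre_arr y))%MS.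
Proof.
rewrite dM_comp; [|exact: fibre_arr_smooth|exact: tgt_smooth_at].
exact: eqmxMr (fibre_arr_ker y).
Qed.

(** Right translation [r] by [h] between source fibres preserves targets, so the differential of
    [tgt] at [g] factors through that at [comp g h]. *)
Lemma orbit_tangent_comp_sub g h : src g = tgt h ->
  (orbit_tangent g <= orbit_tangent (comp g h))%MS.
Proof.
move=> e.
pose y : src_fibre (tgt h) := to_fibre e.
have e' (z : src_fibre (tgt h)) : src (comp (fibre_arr z) h) = src h.
  by rewrite src_comp // src_fibre_arr.
pose r (z : src_fibre (tgt h)) : src_fibre (src h) := to_fibre (e' z).
have sr z : smooth_at r z.
  apply: smooth_at_fibre; apply: comp_smooth_at => {}z.
  - exact: fibre_arr_smooth.
  - exact: smooth_at_cst.
  - exact: src_fibre_arr.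
have st x (z : src_fibre x) : smooth_at (tgt \o @fibre_arr x) z.
  exact: (smooth_at_comp (fibre_arr_smooth z) (tgt_smooth_at _)).
rewrite -(orbit_tangent_fibre y) -[comp g h]/(fibre_arr (r y)) -(orbit_tangent_fibre (r y)).
rewrite (_ : dM (tgt \o _) y = dM r y *m dM (tgt \o @fibre_arr _) (r y)).
  exact: submxMl.
rewrite -dM_comp //; congr (dM _ y); apply/funext => z /=.
by rewrite to_fibreK tgt_comp // src_fibre_arr.
Qed.

(** The two inclusions come from translating [g] by its inverse and the unit at [tgt g] by [g]. *)
Lemma orbit_tangent_unit g : (orbit_tangent g :=: orbit_tangent (unit_arr (tgt g)))%MS.
Proof.
apply/eqmxP/andP; split.
  by have := @orbit_tangent_comp_sub g (inv_arr g); rewrite tgt_inv comp_invr; exact.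
have := @orbit_tangent_comp_sub (unit_arr (tgt g)) g.
by rewrite src_unit comp_unitl; exact.
Qed.

Definition isotropy_rank g : nat :=
  \rank (kermx (dM src g) :&: kermx (dM tgt g))%MS.

Lemma rank_orbit_tangent g :
  (\rank (orbit_tangent g) + isotropy_rank g = dim (arr G) - dim (obj G))%N.
Proof. by rewrite mxrank_mul_ker mxrank_ker (eqP (src_full g)). Qed.

Lemma isotropy_rank_tgt g : isotropy_rank g = isotropy_rank (unit_arr (tgt g)).
Proof.
have := rank_orbit_tangent g.
rewrite -(rank_orbit_tangent (unit_arr (tgt g))) (orbit_tangent_unit g).
exact: addnI.
Qed.

(** Inversion is a diffeomorphism exchanging [src] and [tgt], so it carries one intersection of
    kernels into the other. *)
Lemma isotropy_rank_inv_le g : (isotropy_rank g <= isotropy_rank (inv_arr g))%N.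
Proof.
set K := (kermx (dM src g) :&: kermx (dM tgt g))%MS.
have si := inv_smooth_at g.
have e1 : dM (@inv_arr R G) g *m dM src (inv_arr g) = dM tgt g.
  rewrite -(dM_comp si (src_smooth_at _)); congr (dM _ g).
  by apply/funext => h; exact: src_inv.
have e2 : dM (@inv_arr R G) g *m dM tgt (inv_arr g) = dM src g.
  rewrite -(dM_comp si (tgt_smooth_at _)); congr (dM _ g).
  by apply/funext => h; exact: tgt_inv.
have fi : row_free (dM (@inv_arr R G) g).
  apply/row_freeP; exists (dM (@inv_arr R G) (inv_arr g)).
  rewrite -(dM_comp si (inv_smooth_at _)) -(dM_id g); congr (dM _ g).
  by apply/funext => h; exact: inv_arrK.
rewrite /isotropy_rank -/K -(mxrankMfree K fi); apply: mxrankS.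
rewrite sub_capmx; apply/andP; split; apply/sub_kermxP.
  by rewrite -mulmxA e1; apply/sub_kermxP; exact: capmxSr.
by rewrite -mulmxA e2; apply/sub_kermxP; exact: capmxSl.
Qed.

Lemma isotropy_rank_src g : isotropy_rank g = isotropy_rank (unit_arr (src g)).
Proof.
rewrite -tgt_inv -isotropy_rank_tgt; apply/eqP; rewrite eqn_leq.
rewrite isotropy_rank_inv_le; have := isotropy_rank_inv_le (inv_arr g).
by rewrite inv_arrK.
Qed.

Lemma isotropy_rank_eq0 g : isotropy_rank g = 0%N <-> forall v : 'rV[R]_(dim (arr G)),
  v *m dM src g = 0 -> v *m dM tgt g = 0 -> v = 0.
Proof.
split=> [/eqP|H].
  rewrite mxrank_eq0 => /eqP K0 v v1 v2; apply/eqP; rewrite -submx0 -K0.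
  by rewrite sub_capmx; apply/andP; split; apply/sub_kermxP.
apply/eqP; rewrite mxrank_eq0; apply/rowV0P => v.
by rewrite sub_capmx => /andP[/sub_kermxP v1 /sub_kermxP v2]; exact: H.
Qed.

Lemma injective_anchorP :
  injective_anchor G <-> forall x, isotropy_rank (unit_arr x) = 0%N.
Proof.
split=> H x.
  apply/isotropy_rank_eq0 => v v1 v2.
  have t0 p : tangent_space p (0 : tangent_family (arr G)).
    split=> [c d ac cp ad dp|c _] //.
    rewrite -jacE ?mul0mx //; exact: transition_germ.
  have t0' p : tangent_space p (0 : tangent_family (obj G)).
    split=> [c d ac cp ad dp|c _] //.
    rewrite -jacE ?mul0mx //; exact: transition_germ.
  have [w tw wE] := tangent_ex (unit_arr x) v.
  have dw (f : arr G -> obj G) : smooth_at f (unit_arr x) ->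
      v *m dM f (unit_arr x) = 0 -> differential f (unit_arr x) w = 0.
    move=> sf vf; apply: (tangent_inj _ (t0' (f (unit_arr x)))).
      exact: differential_tangent.
    by rewrite differential_coord // wE vf.
  have d0 (f : arr G -> obj G) : smooth_at f (unit_arr x) ->
      differential f (unit_arr x) 0 = 0.
    move=> sf; apply: (tangent_inj _ (t0' (f (unit_arr x)))).
      exact: differential_tangent.
    by rewrite differential_coord // mul0mx.
  have w0 : w = 0.
    apply: (H x); rewrite ?inE.
    - by split=> //; apply: dw => //; exact: src_smooth_at.
    - by split=> //; apply: d0; exact: src_smooth_at.
    - by rewrite /anchor dw ?d0 //; exact: tgt_smooth_at.
  by rewrite -wE w0.
move=> u v; rewrite !inE => -[tu su] [tv sv] e.
apply: tangent_inj tu tv _; apply/eqP; rewrite -subr_eq0; apply/eqP.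
have := (isotropy_rank_eq0 _).1 (H x); apply; rewrite mulmxBl.
  rewrite -!differential_coord; [|exact: src_smooth_at..].
  by rewrite su sv subrr.
rewrite -!differential_coord; [|exact: tgt_smooth_at..].
by rewrite -[differential _ _ u]/(anchor x u) e subrr.
Qed.

End GroupoidBasics.

(** * Immersions and maps of constant rank *)

Section ConstantRank.
Variable R : realType.
Implicit Types M N X : manifold R.
Local Hint Resolve chart_at_atlas chart_at_dom : core.

(** Followed by a right inverse [B] of its Jacobian matrix, [f] becomes a map between equal
    dimensions with invertible differential. *)
Lemma local_injective M N (f : M -> N) p : smooth_at f p -> row_free (dM f p) ->
  exists U, [/\ open U, U p & forall q q', U q -> U q' -> f q = f q' -> q = q'].
Proof.
move=> sf /row_freeP[B AB]; pose d := chart_at (f p).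
have sd := smooth_at_cmap (chart_at_atlas (f p)) (chart_at_dom (f p)).
have sB y : @smooth_at R (euclid R (dim N)) (euclid R (dim M)) (mulmx^~ B) y.
  by apply/smooth_at_euclid; exact: germ_mulmx.
have s2 := smooth_at_comp sf sd.
have sg := smooth_at_comp s2 (sB _).
have fg : row_free (@dM R M (euclid R (dim M)) ((mulmx^~ B) \o (cmap d \o f)) p).
  rewrite (dM_comp s2 (sB _)) (dM_comp sf sd) dM_cmap mulmx1 dM_euclid jac_mulmx AB.
  by rewrite row_free_unit unitmx1.
have [U [h [[oU Up _] [hU _]]]] :=
  manifold_inverse (erefl : dim M = dim (euclid R (dim M))) sg fg.
exists U; split=> // q q' Uq Uq' e.
by have [<- _] := hU _ Uq; have [<- _] := hU _ Uq'; rewrite /= e.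
Qed.

Lemma ball_not_open k (U : set 'rV[R]_k.+1) w : open U -> U w ->
  exists2 w', U w' & w' != w.
Proof.
move=> oU Uw; have : \forall y \near w, U y by exact: near_open.
move=> /nbhs_ballP[e /= e0 eU].
exists (w + const_mx (e / 2)).
  apply: eU; rewrite -ball_normE /= opprD addNKr normrN.
  apply: (@le_lt_trans _ _ (e / 2)); last by rewrite ltr_pdivrMr // ltr_pMr // ltr1n.
  apply: rV_norm_le => [|i]; first by rewrite divr_ge0 // ltW.
  by rewrite mxE ger0_norm // divr_ge0 // ltW.
rewrite -subr_eq0 addrC addKr; apply/eqP => /rowP/(_ 0); rewrite !mxE => /eqP.
by rewrite mulf_eq0 invr_eq0 pnatr_eq0 orbF gt_eqF.
Qed.

Lemma jac0_constant n m (g : 'rV[R]_n -> 'rV[R]_m) (w0 : 'rV[R]_n) (e : R) :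
  (forall w, ball w0 e w -> germ_smooth g w /\ jac g w = 0) ->
  forall w, ball w0 e w -> g w = g w0.
Proof.
move=> H w bw; apply/eqP; rewrite -subr_eq0 -normr_le0.
have b t : 0 <= t <= 1 -> ball w0 e (w0 + t *: (w - w0)).
  move: bw; rewrite -ball_normE /= => bw /andP[t0 t1].
  rewrite opprD addNKr normrN normrZ ger0_norm // distrC.
  by apply: le_lt_trans bw; rewrite ler_piMl.
apply: mean_value => t t01; have [gs g0] := H _ (b t t01).
  exact: germ_differentiable.
by rewrite -jacE // g0 mulmx0 normr0.
Qed.

(* Let [Psi] be [f] followed by a projection onto R^r that is submersive at   *)
(* [p]. Near [p] the kernels of the differentials of [f] and [Psi] have the   *)
(* same dimension, hence coincide, so [f] is constant on the level sets of    *)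
(* [Psi].                                                                     *)
Lemma constant_rank_fibre M N (f : M -> N) r k p : dim M = (r + k.+1)%N ->
  (forall q, smooth_at f q) -> (forall q, \rank (dM f q) = r) ->
  exists (X : manifold R) (gam : X -> M) (x0 : X), [/\ forall x, smooth_at gam x,
    injective gam, gam x0 = p, forall x, f (gam x) = f p & ~ open [set x0]].
Proof.
move=> dE sf rf; pose d := chart_at (f p).
have ad : atlas d by exact: chart_at_atlas.
have dp : dom d (f p) by exact: chart_at_dom.
(* [A] is the product of its column base and its row base; a right inverse of the row base leaves
   the column base, which has full column rank. *)
have [C AC] : exists C : 'M[R]_(dim N, r), row_full (dM f p *m C).
  have := rf p; set A := dM f p; move=> rA; case: r / rA {dE rf}.
  exists (pinvmx (row_base A)).
  have := congr1 (mulmx^~ (pinvmx (row_base A))) (mulmx_base A).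
  by rewrite -mulmxA mulmxVp ?row_base_free // mulmx1 => <-; exact: col_base_full.
pose Psi (q : M) : 'rV[R]_r := cmap d (f q) *m C.
have sC y : @smooth_at R (euclid R (dim N)) (euclid R r) (mulmx^~ C) y.
  by apply/smooth_at_euclid; exact: germ_mulmx.
have sPsi q : dom d (f q) -> @smooth_at R M (euclid R r) Psi q /\
    @dM R M (euclid R r) Psi q =
    dM f q *m (@dM R N (euclid R (dim N)) (cmap d) (f q) *m C).
  move=> dq; have sd := smooth_at_cmap ad dq.
  have s2 := smooth_at_comp (sf q) sd.
  split; first exact: (smooth_at_comp s2 (sC _)).
  rewrite [LHS](dM_comp s2 (sC _)) (dM_comp (sf q) sd) dM_euclid jac_mulmx.
  by rewrite mulmxA.
have [sPp dPp] := sPsi p dp.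
have fPp : row_full (@dM R M (euclid R r) Psi p).
  by rewrite dPp dM_cmap mul1mx.
have [pi [U [h [oU Up oE eU hU]]]] := 
  @submersion_chart R M (euclid R r) Psi p k.+1 dE sPp fPp.
set E := (_ @` U) in oE hU.
pose rho (w : 'rV[R]_k.+1) : M := h (Psi p, w).
pose j (w : 'rV[R]_k.+1) : prod_manifold (euclid R r) (euclid R k.+1) := (Psi p, w).
have sj w : @smooth_at R (euclid R k.+1) (prod_manifold (euclid R r) (euclid R k.+1)) j w.
  by apply: smooth_at_pair; [exact: smooth_at_cst|exact: smooth_at_id].
have Ep : E (j (pi p)) by exists p.
have hp : h (j (pi p)) = p by have [hp _ _ _] := eU p Up.
have : \forall w \near pi p, E (j w) /\ dom d (f (rho w)).
  have h1 : \forall w \near pi p, E (j w).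
    by case: (sj (pi p)) => cj _; apply: cj; exact: open_nbhs_nbhs.
  have h2 : \forall w \near pi p, dom d (f (rho w)).
    have := smooth_at_comp (smooth_at_comp (sj (pi p)) (hU _ Ep)) (sf _).
    case=> cf _; apply: cf; rewrite /= hp; exact: chart_near_dom.
  by near=> w; split; near: w.
move=> /nbhs_ballP[e /= e0 eP].
have rhoP w : ball (pi p) e w -> [/\ U (rho w), Psi (rho w) = Psi p, pi (rho w) = w &
    @smooth_at R (euclid R k.+1) M rho w].
  move=> /eP[[q Uq [qE1 qE2]] _]; have [hq _ _ _] := eU q Uq.
  have rq : rho w = q by rewrite /rho -qE1 -qE2.
  rewrite rq; split=> //.
  by apply: (smooth_at_comp (sj w)); apply: hU; exists q => //; rewrite /j -qE1 -qE2.
have bp : ball (pi p) e (pi p) by exact: ballxx.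
have drho w : ball (pi p) e w ->
    @dM R (euclid R k.+1) M rho w *m dM f (rho w) = 0.
  move=> bw; have [Uq Pq piq srho] := rhoP w bw.
  have [_ dq] := eP _ bw; have [sPq dPq] := sPsi _ dq.
  have [_ _ fPq _] := eU _ Uq.
  set q := rho w in Uq Pq piq dq sPq dPq fPq *.
  have z : @dM R (euclid R k.+1) M rho w *m @dM R M (euclid R r) Psi q = 0.
    rewrite -(dM_comp srho sPq) -(@dM_cst R (euclid R k.+1) (euclid R r) (Psi p) w).
    symmetry; apply: dM_eq; last exact: smooth_at_cst.
    have : \forall w' \near w, ball (pi p) e w'.
      by apply: open_nbhs_nbhs; split => //; exact: ball_open.
    by apply: filterS => w' /rhoP[].
  apply/sub_kermxP.
  have sub : (kermx (dM f q) <= kermx (@dM R M (euclid R r) Psi q))%MS.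
    by apply/sub_kermxP; rewrite dPq (mulmxA (kermx _)) mulmx_ker mul0mx.
  have /eqmxP/eqmx_sym kE : (kermx (dM f q) == kermx (@dM R M (euclid R r) Psi q))%MS.
    rewrite -(geq_leqif (mxrank_leqif_eq sub)) !mxrank_ker rf.
    by rewrite (eqP fPq).
  by rewrite -kE; apply/sub_kermxP.
have frho w : ball (pi p) e w -> f (rho w) = f p.
  move=> bw.
  have H w' : ball (pi p) e w' -> germ_smooth (cmap d \o (f \o rho)) w' /\
      jac (cmap d \o (f \o rho)) w' = 0.
    move=> bw'; have [Uq Pq piq srho] := rhoP w' bw'.
    have [_ dq] := eP _ bw'.
    have s1 := smooth_at_comp srho (sf _); have sd := smooth_at_cmap ad dq.
    have s2 := smooth_at_comp s1 sd.
    split; first exact/smooth_at_euclid.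
    by rewrite -dM_euclid (dM_comp s1 sd) (dM_comp srho (sf _)) drho // mul0mx.
  have /= e1 := jac0_constant H bw.
  have [_ dw] := eP _ bw.
  have rp : rho (pi p) = p by [].
  by rewrite -(chart_cmapK dw) e1 rp chart_cmapK.
have oB : open (ball (pi p) e) by exact: ball_open.
pose X := open_submanifold (M := euclid R k.+1) oB.
pose x0 : X := to_sub (open_sliced (M := euclid R k.+1) oB) bp.
exists X, (fun x : X => rho (incl x)), x0; split.
- move=> x; have [_ _ _ srho] := rhoP _ (inclP x).
  exact: (smooth_at_comp (incl_smooth x) srho).
- move=> x y exy.
  apply: (@incl_inj R (euclid R k.+1) _ _ (open_sliced (M := euclid R k.+1) oB)).
  have [_ _ <- _] := rhoP _ (inclP x); have [_ _ <- _] := rhoP _ (inclP y).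
  by congr (pi _).
- by [].
- by move=> x; apply: frho; exact: (inclP x).
move=> /subtype_openP[A [oA AE]].
have Ap : A (pi p) by have : [set x0] x0 by []; rewrite AE.
have [||w [bw Aw] ne] := @ball_not_open k (ball (pi p) e `&` A) (pi p).
- exact: openI.
- by split.
pose x : X := to_sub (open_sliced (M := euclid R k.+1) oB) bw.
have : (set_val @^-1` A) x by [].
rewrite -AE => xx0; move/eqP: ne; apply.
by have := congr1 (fun x : X => incl x) xx0.
Unshelve. all: by end_near. Qed.

End ConstantRank.

(** * Positive-dimensional isotropy and its consequences *)

Section Isotropy.
Variables (R : realType).
Implicit Types (G H K : smooth_groupoid R).

(** On the source fibre of [x] the rank of [tgt] is constant, because $\kappa$ is $\kappa(1_x)$ at
    each of its arrows. The fibre of [tgt] through the unit thus has dimension $\kappa(1_x) > 0$. *)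
Lemma isotropy_curve G (x : obj G) : isotropy_rank (unit_arr x) <> 0%N ->
  exists (X : manifold R) (gam : X -> arr G) (x0 : X),
    [/\ forall y, smooth_at gam y, injective gam, forall y, src (gam y) = x,
        forall y, tgt (gam y) = x & ~ open [set x0]].
Proof.
move=> k0; pose f := @tgt R G \o @fibre_arr R G x.
have sf y : smooth_at f y.
  exact: (smooth_at_comp (fibre_arr_smooth y) (tgt_smooth_at _)).
have rf y : \rank (dM f y) = \rank (orbit_tangent (unit_arr x)).
  rewrite (orbit_tangent_fibre y); have := rank_orbit_tangent (fibre_arr y).
  rewrite isotropy_rank_src src_fibre_arr -(rank_orbit_tangent (unit_arr x)).
  exact: addIn.
have dE : dim (src_fibre x) =
    (\rank (orbit_tangent (unit_arr x)) + (isotropy_rank (unit_arr x)).-1.+1)%N.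
  by rewrite prednK ?rank_orbit_tangent // lt0n; apply/eqP.
pose p : src_fibre x := to_fibre (src_unit x).
have [X [gam [x0 [sg ig gp fg nx0]]]] := constant_rank_fibre p dE sf rf.
exists X, (@fibre_arr R G x \o gam), x0; split=> //.
- by move=> y; exact: (smooth_at_comp (sg y) (fibre_arr_smooth _)).
- by move=> y z /fibre_arr_inj /ig.
- by move=> y; exact: src_fibre_arr.
- by move=> y; rewrite [LHS](fg y) /f /= to_fibreK tgt_unit.
Qed.

(** If [gam x0] were isolated in the isotropy, its preimage under the continuous injection [gam]
    would make [x0] isolated in [X]. *)
Lemma discrete_injective_anchor G : discrete_isotropy G -> injective_anchor G.
Proof.
move=> dG; apply/injective_anchorP => x; apply: contrapT.
move=> /isotropy_curve[X [gam [x0 [sg ig sx tx]]]]; apply.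
have ix0 : isotropy x (gam x0) by split.
pose z : isotropy x := exist _ (gam x0) (mem_set ix0).
have /subtype_openP[A [oA AE]] := dG x [set z].
have -> : [set x0] = gam @^-1` A.
  apply/seteqP; split=> [_ ->|y Ay].
    by have : [set z] z by []; rewrite AE.
  have iy : isotropy x (gam y) by split.
  pose zy : isotropy x := exist _ (gam y) (mem_set iy).
  have : (set_val @^-1` A) zy by [].
  rewrite -AE => yz; apply: ig.
  by have := congr1 set_val yz.
by apply: open_comp => // y _; case: (sg y).
Qed.

Lemma injective_anchor_discrete G : injective_anchor G -> discrete_isotropy G.
Proof.
move=> /injective_anchorP aG x A; rewrite openE => z Az.
pose st (g : arr G) : prod_manifold (obj G) (obj G) := (src g, tgt g).
have sst g : smooth_at st g.
  by apply: smooth_at_pair; [exact: src_smooth_at|exact: tgt_smooth_at].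
set g : arr G := set_val z.
have k0 : isotropy_rank g = 0%N by rewrite isotropy_rank_src.
have fst_ : row_free (dM st g).
  apply/row_free_ker0 => v v0; apply: ((isotropy_rank_eq0 g).1 k0).
    have := dM_comp (sst g) (smooth_at_fst (st g)).
    by rewrite -[X in dM X g = _]/(@src R G) => ->; rewrite mulmxA v0 mul0mx.
  have := dM_comp (sst g) (smooth_at_snd (st g)).
  by rewrite -[X in dM X g = _]/(@tgt R G) => ->; rewrite mulmxA v0 mul0mx.
have [U [oU Ug Uinj]] := local_injective (sst g) fst_.
suff : nbhs z [set z] by apply: filterS => _ ->.
rewrite nbhsE; exists (set_val @^-1` U).
  by split=> //; apply/subtype_openP; exists U.
move=> y Uy; apply: val_inj; apply: (Uinj (set_val y) (set_val z)) => //.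
have [sy ty] : isotropy x (set_val y) by exact: set_valP.
have [sz tz] : isotropy x (set_val z) by exact: set_valP.
by rewrite /st sy ty sz tz.
Qed.

(** The uniqueness clause of the pullback, tested on the one-point manifold. *)
Lemma pullback_inj (P A B Z : manifold R) (p : P -> A) (q : P -> B)
    (f : A -> Z) (g : B -> Z) : is_pullback p q f g ->
  forall y z, p y = p z -> q y = q z -> y = z.
Proof.
move=> [_ _ pq univ] y z pyz qyz.
have sc (N : manifold R) (c : N) : @smooth R (euclid R 0) N (fun=> c).
  by apply/smoothP => w; exact: smooth_at_cst.
have [|h [_ hu]] := univ (euclid R 0) _ _ (sc _ (p y)) (sc _ (q y)).
  by apply/funext => w; have := congr1 (@^~ y) pq.
have e1 : h = fun=> y by apply: hu; split; first exact: sc.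
have e2 : h = fun=> z.
  by apply: hu; split; [exact: sc|apply/funext|apply/funext].
by have := congr1 (@^~ (0 : 'rV[R]_0)) e1; rewrite e2.
Qed.

Lemma etale_morita_injective_anchor G H : etale H -> morita_equivalent G H ->
  injective_anchor G.
Proof.
move=> eH [K [phi [psi [[[P [p1 [p2 [[_ _ pE _] surj _]]]] pbG] [_ pbH]]]]].
apply/injective_anchorP => x; apply: contrapT.
move=> /isotropy_curve[X [gam [x0 [sg ig sx tx]]]]; apply.
have [z _ zx] := surj x I.
set y := p1 z; set h := p2 z in zx.
have hy : tgt h = hom0 phi y by have := congr1 (@^~ z) pE => /= ->.
(* The object [x] may lie outside the image of [hom0 phi]; conjugation by [h] moves the family to
   the isotropy at [hom0 phi y], where it lifts to [K]. *)
pose gam1 w := comp (comp h (gam w)) (inv_arr h).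
have e1 w : src h = tgt (gam w) by rewrite tx.
have e2 w : src (comp h (gam w)) = tgt (inv_arr h) by rewrite src_comp // sx tgt_inv.
have sg1 : smooth gam1.
  apply/smoothP; apply: comp_smooth_at => //; last by move=> w; exact: smooth_at_cst.
  by apply: comp_smooth_at => // w; exact: smooth_at_cst.
have sg1x w : src_tgt (gam1 w) = (hom0 phi y, hom0 phi y).
  by rewrite /src_tgt /gam1 src_comp // tgt_comp // src_inv tgt_comp // hy.
case: (pbG) => _ _ _ univ.
have [|||gam' [[/smoothP sg' g1 g2] _]] := univ X gam1 (fun=> (y, y)).
- exact: sg1.
- by apply/smoothP => w; exact: smooth_at_cst.
- by apply/funext => w; exact: sg1x.
have e3 w : hom1 phi (gam' w) = gam1 w by have := congr1 (@^~ w) g1.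
have e4 w : src_tgt (gam' w) = (y, y) by have := congr1 (@^~ w) g2.
pose del w := hom1 psi (gam' w).
have sdel w : smooth_at del w.
  apply: (smooth_at_comp (sg' w)).
  by move/smoothP: (hom1_smooth psi); exact.
have [U [s' [[oU Ux0] _ Uinj _ _]]] := eH (del x0).
have near_del : \forall w \near x0, U (del w).
  by case: (sdel x0) => cd _; apply: cd; exact: open_nbhs_nbhs.
have /near_openP[V [oV Vx0 VU]] := near_del.
rewrite (_ : [set x0] = V) //; apply/seteqP; split=> [_ -> //|w Vw].
(* All the arrows [del w] have the same source, and the source map of [H] is injective near
   [del x0]. *)
have dw : del w = del x0.
  rewrite -[LHS](Uinj (del w)) ?inE; last exact: VU.
  rewrite -[RHS](Uinj (del x0)) ?inE //; congr s'.
  rewrite /del !hom_src.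
  by case: (e4 w) => -> _; case: (e4 x0) => -> _.
(* Both lifts lie over [(y, y)] and have the same image in [H], so the pullback square of [psi]
   identifies them. *)
have gw : gam' w = gam' x0 by apply: (pullback_inj pbH) => //; rewrite !e4.
apply: ig; have := e3 w; rewrite gw e3 /gam1 => e.
have := congr1 (fun g => comp g (inv_arr (inv_arr h))) e.
rewrite !comp_cancelr // => e'.
by rewrite -(comp_cancell (e1 w)) -e' comp_cancell.
Qed.

End Isotropy.

Lemma smooth_at_ext (R : realType) (M N : manifold R) (f g : M -> N) p :
  (forall q, f q = g q) -> smooth_at f p -> smooth_at g p.
Proof. by move=> /funext ->. Qed.

(** * Restriction to a complete transversal *)

Section Identity.
Variables (R : realType) (H : smooth_groupoid R).

Definition id_hom : homomorphism H H :=
  @Homomorphism R H H id id ((smoothP _).2 (@smooth_at_id R _))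
    ((smoothP _).2 (@smooth_at_id R _)) (fun=> erefl) (fun=> erefl) (fun=> erefl)
    (fun _ _ _ => erefl).

Lemma src_tgt_smooth (g : arr H) : smooth_at (@src_tgt R H) g.
Proof.
by apply: smooth_at_pair; [exact: src_smooth_at|exact: tgt_smooth_at].
Qed.

(** Supplies the second leg of a Morita equivalence when an essential equivalence [H -> G] is
    known. *)
Lemma id_essential : essential_equivalence id_hom.
Proof.
split.
  exists (arr H), (@tgt R H), id; split.
  - split; [exact: tgt_smooth|exact/smoothP/smooth_at_id|by []|].
    move=> X a b sa sb ab; exists b; split; last by move=> h [_ _ <-].
    by split=> //; rewrite -ab.
  - by move=> x _; exists (unit_arr x) => //=; exact: src_unit.
  - exact: src_submersion.
split; [exact/smoothP/smooth_at_id|exact/smoothP/src_tgt_smooth| |].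
  by apply/funext.
move=> X a b sa sb ab; exists a; split; last by move=> h [_ <- _].
split=> //; rewrite ab; apply/funext => x.
by rewrite /= /hom00 /= -surjective_pairing.
Qed.

Lemma essential_morita G (phi : homomorphism H G) :
  essential_equivalence phi -> morita_equivalent G H.
Proof. by move=> e; exists H, phi, id_hom; split => //; exact: id_essential. Qed.

End Identity.

Section Restriction.
Variables (R : realType) (G : smooth_groupoid R) (T : manifold R) (tau : T -> obj G).
Hypothesis hT : hausdorff_space T.
Hypothesis stau : forall t, smooth_at tau t.
Hypothesis rank0 : forall g : arr G, isotropy_rank g = 0%N.
(** With [rank0] and [dimT] this says that the tangent space of $G_0$ is the direct sum of the image
    of the differential of [tau] and the tangent space of the orbit. *)
Hypothesis transverse : forall t (a : 'rV[R]_(dim T)),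
  (a *m dM tau t <= orbit_tangent (unit_arr (tau t)))%MS -> a = 0.
Hypothesis dimT : (dim T + (dim (arr G) - dim (obj G)) = dim (obj G))%N.
Hypothesis saturated : forall x : obj G, exists t (g : arr G),
  src g = x /\ tgt g = tau t.
Local Notation src := (@src R G).
Local Notation tgt := (@tgt R G).

(* An element of [P] is an arrow whose target lies on the transversal; [sat]  *)
(* is its source.                                                             *)
Let P : manifold R := fibre_product stau (@tgt_smooth_at R G) (@tgt_full R G).
Let P1 : P -> T := @fp1 _ _ _ _ _ _ stau (@tgt_smooth_at R G) (@tgt_full R G).
Let P2 : P -> arr G := @fp2 _ _ _ _ _ _ stau (@tgt_smooth_at R G) (@tgt_full R G).
Let sat : P -> obj G := src \o P2.

Lemma sat_smooth y : smooth_at sat y.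
Proof. exact: (smooth_at_comp (fp2_smooth y) (src_smooth_at _)). Qed.

(** The arrow component of a kernel vector lies in $\ker ds$, so its image under $dt$ is tangent to
    both the orbit and the transversal. Transversality kills the [T]-component, and $\kappa = 0$
    then kills the arrow component. *)
Lemma sat_free y : row_free (dM sat y).
Proof.
apply/row_free_ker0 => v v0.
have t0 : tau (P1 y) = tgt (P2 y) by exact: fp_eq.
have ws : v *m dM P2 y *m dM src (P2 y) = 0.
  by rewrite -mulmxA -(dM_comp (fp2_smooth y) (src_smooth_at _)).
have wt : v *m dM P2 y *m dM tgt (P2 y) = v *m dM P1 y *m dM tau (P1 y).
  rewrite -!mulmxA -(dM_comp (fp2_smooth y) (tgt_smooth_at _)).
  rewrite -(dM_comp (fp1_smooth y) (stau _)); congr (_ *m dM _ y).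
  by apply/funext => z; symmetry; exact: fp_eq.
have a0 : v *m dM P1 y = 0.
  apply: (@transverse (P1 y)); rewrite t0 -(orbit_tangent_unit (P2 y)) -wt.
  by apply: submxMr; apply/sub_kermxP.
have w0 : v *m dM P2 y = 0.
  apply: ((isotropy_rank_eq0 (P2 y)).1 (rank0 _)) => //.
  by rewrite wt a0 mul0mx.
exact: fp_tangent a0 w0.
Qed.

Lemma row_free_full m n (A : 'M[R]_(m, n)) : m = n -> row_free A -> row_full A.
Proof. by move=> mn; rewrite /row_free /row_full => /eqP ->; exact/eqP. Qed.

Lemma sat_full y : row_full (dM sat y).
Proof. by apply: row_free_full (sat_free y); exact: dimT. Qed.

(** The iterated fibre product $T\times_{G_0}(T\times_{G_0}G_1)$ is used because each stage is along
    a submersion, [tgt] and then [sat], while [(src, tgt)] need not be one. *)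
Let rarr : manifold R := fibre_product stau sat_smooth sat_full.
Let rsrc : rarr -> T := @fp1 _ _ _ _ _ _ stau sat_smooth sat_full.
Let rcover : rarr -> P := @fp2 _ _ _ _ _ _ stau sat_smooth sat_full.
Let rtgt : rarr -> T := P1 \o rcover.
Let rarrow : rarr -> arr G := P2 \o rcover.

Lemma rsrc_src x : tau (rsrc x) = src (rarrow x).
Proof. exact: fp_eq. Qed.

Lemma rtgt_tgt x : tau (rtgt x) = tgt (rarrow x).
Proof. exact: fp_eq. Qed.

Lemma rsrc_smooth x : smooth_at rsrc x.
Proof. exact: fp1_smooth. Qed.

Lemma rtgt_smooth x : smooth_at rtgt x.
Proof. exact: (smooth_at_comp (fp2_smooth x) (fp1_smooth _)). Qed.

Lemma rarrow_smooth x : smooth_at rarrow x.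
Proof. exact: (smooth_at_comp (fp2_smooth x) (fp2_smooth _)). Qed.

Definition res_mk v u g (e1 : tau v = src g) (e2 : tau u = tgt g) : rarr :=
  fp_mk stau sat_smooth sat_full (a := v)
    (b := fp_mk stau (@tgt_smooth_at R G) (@tgt_full R G) e2) e1.

Lemma res_ext x y : rsrc x = rsrc y -> rtgt x = rtgt y -> rarrow x = rarrow y -> x = y.
Proof. by move=> e1 e2 e3; apply: fp_ext => //; apply: fp_ext. Qed.

Lemma smooth_at_res (X : manifold R) (k : X -> rarr) x : smooth_at (rsrc \o k) x ->
  smooth_at (rtgt \o k) x -> smooth_at (rarrow \o k) x -> smooth_at k x.
Proof. by move=> s1 s2 s3; apply: smooth_at_fp s1 _; exact: smooth_at_fp s2 s3. Qed.

(** [rsrc] is the base change of [sat] along [tau] and inherits the injectivity of its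
    differential. *)
Lemma rsrc_free x : row_free (dM rsrc x).
Proof.
apply/row_free_ker0 => v v0; apply: (fp_tangent v0).
apply: ((row_free_ker0 _).1 (sat_free (rcover x))).
rewrite -mulmxA -(dM_comp (fp2_smooth x) (sat_smooth _)).
have -> : sat \o rcover = tau \o rsrc by apply/funext => z; symmetry; exact: fp_eq.
by rewrite (dM_comp (rsrc_smooth x) (stau _)) mulmxA v0 mul0mx.
Qed.

Lemma dim_rarr : dim rarr = dim T.
Proof.
change (dim T + ((dim T + (dim (arr G) - dim (obj G))) - dim (obj G)) = dim T)%N.
by rewrite dimT subnn addn0.
Qed.

Lemma rsrc_full x : row_full (dM rsrc x).
Proof. by apply: row_free_full (rsrc_free x); exact: dim_rarr. Qed.

Lemma res_unit_eq t : tau t = src (unit_arr (tau t)) /\ tau t = tgt (unit_arr (tau t)).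
Proof. by rewrite src_unit tgt_unit. Qed.

Definition res_unit t : rarr := res_mk (res_unit_eq t).1 (res_unit_eq t).2.

Lemma res_inv_eq x : tau (rtgt x) = src (inv_arr (rarrow x)) /\
  tau (rsrc x) = tgt (inv_arr (rarrow x)).
Proof. by rewrite src_inv tgt_inv rsrc_src rtgt_tgt. Qed.

Definition res_inv x : rarr := res_mk (res_inv_eq x).1 (res_inv_eq x).2.

Lemma res_comp_eq x y : rsrc x = rtgt y -> [/\ src (rarrow x) = tgt (rarrow y),
  tau (rsrc y) = src (comp (rarrow x) (rarrow y)) &
  tau (rtgt x) = tgt (comp (rarrow x) (rarrow y))].
Proof.
move=> e; have e' : src (rarrow x) = tgt (rarrow y) by rewrite -rsrc_src e rtgt_tgt.
by rewrite src_comp // tgt_comp // rsrc_src rtgt_tgt.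
Qed.

(* Junk value [x] on non-composable pairs.                                    *)
Definition res_comp x y : rarr :=
  match pselect (rsrc x = rtgt y) with
  | left e => let: And3 _ e1 e2 := res_comp_eq e in res_mk e1 e2
  | right _ => x
  end.

Lemma res_compE x y : rsrc x = rtgt y ->
  [/\ rsrc (res_comp x y) = rsrc y, rtgt (res_comp x y) = rtgt x &
      rarrow (res_comp x y) = comp (rarrow x) (rarrow y)].
Proof. by move=> e; rewrite /res_comp; case: pselect => // e'; case: res_comp_eq. Qed.

Lemma res_inv_smooth x : smooth_at res_inv x.
Proof.
apply: smooth_at_res; [exact: rtgt_smooth|exact: rsrc_smooth|].
exact: (smooth_at_comp (rarrow_smooth x) (inv_smooth_at _)).
Qed.

Lemma res_invK x : res_inv (res_inv x) = x.
Proof. by apply: res_ext => //; exact: inv_arrK. Qed.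

Lemma rtgt_full x : row_full (dM rtgt x).
Proof.
have -> : rtgt = rsrc \o res_inv by [].
rewrite (dM_comp (res_inv_smooth x) (rsrc_smooth _)).
have /row_fullP[B BA] := rsrc_full (res_inv x).
apply/row_fullP; exists (B *m dM res_inv (res_inv x)); rewrite mulmxA -(mulmxA B).
have := dM_comp (res_inv_smooth (res_inv x)) (res_inv_smooth (res_inv (res_inv x))).
rewrite res_invK => <-; rewrite (_ : res_inv \o res_inv = id).
  by rewrite dM_id mulmx1.
by apply/funext => z; exact: res_invK.
Qed.

Lemma res_comp_smooth : exists (G2 : manifold R) (p q : G2 -> rarr),
  is_pullback p q rsrc rtgt /\ smooth (fun z => res_comp (p z) (q z)).
Proof.
pose G2 := fibre_product rsrc_smooth rtgt_smooth rtgt_full.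
pose p : G2 -> rarr := @fp1 _ _ _ _ _ _ rsrc_smooth rtgt_smooth rtgt_full.
pose q : G2 -> rarr := @fp2 _ _ _ _ _ _ rsrc_smooth rtgt_smooth rtgt_full.
exists G2, p, q; split; first exact: fp_pullback.
have e z : rsrc (p z) = rtgt (q z) by exact: fp_eq.
apply/smoothP => z; have sp y : smooth_at p y by exact: fp1_smooth.
have sq y : smooth_at q y by exact: fp2_smooth.
apply: smooth_at_res.
- apply: smooth_at_ext (smooth_at_comp (sq z) (rsrc_smooth _)) => y.
  by case: (res_compE (e y)).
- apply: smooth_at_ext (smooth_at_comp (sp z) (rtgt_smooth _)) => y.
  by case: (res_compE (e y)).
- have : smooth_at (fun y => comp (rarrow (p y)) (rarrow (q y))) z.
    apply: comp_smooth_at => y.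
    + exact: (smooth_at_comp (sp y) (rarrow_smooth _)).
    + exact: (smooth_at_comp (sq y) (rarrow_smooth _)).
    + by case: (res_comp_eq (e y)).
  by apply: smooth_at_ext => y; case: (res_compE (e y)).
Qed.

Lemma res_unit_smooth t : smooth_at res_unit t.
Proof.
apply: smooth_at_res; [exact: smooth_at_id|exact: smooth_at_id|].
exact: (smooth_at_comp (stau t) (unit_smooth_at _)).
Qed.

Lemma res_comp_assoc x y z : rsrc x = rtgt y -> rsrc y = rtgt z ->
  res_comp x (res_comp y z) = res_comp (res_comp x y) z.
Proof.
move=> e1 e2; have [s1 t1 a1] := res_compE e1; have [s2 t2 a2] := res_compE e2.
have [|s3 t3 a3] := @res_compE x (res_comp y z); first by rewrite t2.
have [|s4 t4 a4] := @res_compE (res_comp x y) z; first by rewrite s1.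
have [c1 _ _] := res_comp_eq e1; have [c2 _ _] := res_comp_eq e2.
apply: res_ext; [by rewrite s3 s4|by rewrite t3 t4|].
by rewrite a3 a4 a1 a2 compA.
Qed.

Lemma res_comp_unitl x : res_comp (res_unit (rtgt x)) x = x.
Proof.
have [|s1 t1 a1] := @res_compE (res_unit (rtgt x)) x; first by [].
apply: res_ext => //; rewrite a1 -[rarrow (res_unit _)]/(unit_arr (tau (rtgt x))).
by rewrite rtgt_tgt comp_unitl.
Qed.

Lemma res_comp_unitr x : res_comp x (res_unit (rsrc x)) = x.
Proof.
have [|s1 t1 a1] := @res_compE x (res_unit (rsrc x)); first by [].
apply: res_ext => //; rewrite a1 -[rarrow (res_unit _)]/(unit_arr (tau (rsrc x))).
by rewrite rsrc_src comp_unitr.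
Qed.

Lemma res_comp_invl x : res_comp (res_inv x) x = res_unit (rsrc x).
Proof.
have [|s1 t1 a1] := @res_compE (res_inv x) x; first by [].
apply: res_ext => //; rewrite a1 -[rarrow (res_inv x)]/(inv_arr (rarrow x)) comp_invl.
by rewrite -rsrc_src.
Qed.

Lemma res_comp_invr x : res_comp x (res_inv x) = res_unit (rtgt x).
Proof.
have [|s1 t1 a1] := @res_compE x (res_inv x); first by [].
apply: res_ext => //; rewrite a1 -[rarrow (res_inv x)]/(inv_arr (rarrow x)) comp_invr.
by rewrite -rtgt_tgt.
Qed.

Definition restriction : smooth_groupoid R :=
  @SmoothGroupoid R T rarr rsrc rtgt res_unit res_inv res_comp
    (fun=> erefl) (fun=> erefl) (fun=> erefl) (fun=> erefl)
    (fun x y e => let: And3 e1 _ _ := res_compE e in e1)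
    (fun x y e => let: And3 _ e2 _ := res_compE e in e2)
    res_comp_assoc res_comp_unitl res_comp_unitr res_comp_invl res_comp_invr hT
    ((smoothP _).2 rsrc_smooth) ((smoothP _).2 rtgt_smooth)
    ((smoothP _).2 res_unit_smooth) ((smoothP _).2 res_inv_smooth)
    ((submersionP ((smoothP _).2 rsrc_smooth)).2 rsrc_full)
    ((submersionP ((smoothP _).2 rtgt_smooth)).2 rtgt_full) res_comp_smooth.

Lemma restriction_etale : etale restriction.
Proof.
move=> x.
have [U [h [[oU Ux oeU] [hU hV]]]] :=
  manifold_inverse dim_rarr (rsrc_smooth x) (rsrc_free x).
exists U, h; split=> //; first by move=> y; rewrite inE => /hU[].
  by apply/smooth_onP => // y /hU[].
by apply/smooth_onP.
Qed.

Definition restriction_hom : homomorphism restriction G :=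
  @Homomorphism R restriction G tau rarrow ((smoothP _).2 stau) ((smoothP _).2 rarrow_smooth)
    (fun x => esym (rsrc_src x)) (fun x => esym (rtgt_tgt x)) (fun=> erefl)
    (fun x y e => let: And3 _ _ e3 := res_compE e in e3).

(** The submersion in question is [sat], surjective by [saturated]. The square is a pullback because
    an arrow of the restriction is just an arrow of [G] with lifts of its endpoints to [T]. *)
Lemma restriction_essential : essential_equivalence restriction_hom.
Proof.
split.
  exists P, P1, P2; split.
  - exact: fp_pullback.
  - move=> x _; have [t [g [gx gt]]] := saturated x.
    by exists (fp_mk stau (@tgt_smooth_at R G) (@tgt_full R G) (esym gt)).
  - apply/(submersionP ((smoothP _).2 sat_smooth)); exact: sat_full.
split; [exact/smoothP/rarrow_smooth|exact/smoothP/src_tgt_smooth| |].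
  by apply/funext => x; rewrite /= /src_tgt /hom00 /= rsrc_src rtgt_tgt.
move=> X a b /smoothP sa /smoothP sb ab.
have e x : tau (b x).1 = src (a x) /\ tau (b x).2 = tgt (a x).
  by have := congr1 (@^~ x) ab; rewrite /src_tgt /hom00 /= => -[-> ->].
exists (fun x => res_mk (e x).1 (e x).2); split.
  split.
  - apply/smoothP => x; apply: smooth_at_res.
    + exact: (smooth_at_comp (sb x) (smooth_at_fst _)).
    + exact: (smooth_at_comp (sb x) (smooth_at_snd _)).
    + exact: sa.
  - by [].
  - by apply/funext => x; rewrite /= /src_tgt /= -surjective_pairing.
move=> h [_ h1 h2]; apply/funext => x.
have e1 : rarrow (h x) = a x by have := congr1 (@^~ x) h1.
have e2 : (rsrc (h x), rtgt (h x)) = b x by have := congr1 (@^~ x) h2.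
by apply: res_ext; [rewrite -[RHS]/(rsrc (h x), rtgt (h x)).1 e2|
  rewrite -[RHS]/(rsrc (h x), rtgt (h x)).2 e2|rewrite e1].
Qed.

End Restriction.

(** * Existence of complete transversals *)

Section DifferentialExtras.
Variable R : realType.
Implicit Types M N X : manifold R.
Local Hint Resolve chart_at_atlas chart_at_dom : core.

Lemma dM_row_mx X n m (f : X -> 'rV[R]_n) (g : X -> 'rV[R]_m) x :
  @smooth_at R X (euclid R n) f x -> @smooth_at R X (euclid R m) g x ->
  @dM R X (euclid R (n + m)) (fun y => row_mx (f y) (g y)) x =
  row_mx (@dM R X (euclid R n) f x) (@dM R X (euclid R m) g x).
Proof.
move=> sf sg; have s := smooth_at_row_mx sf sg.
set D := @dM R X (euclid R (n + m)) _ x.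
have sl w : @smooth_at R (euclid R (n + m)) (euclid R n) lsubmx w.
  by apply/smooth_at_euclid; exact: germ_lsubmx.
have sr w : @smooth_at R (euclid R (n + m)) (euclid R m) rsubmx w.
  by apply/smooth_at_euclid; exact: germ_rsubmx.
apply: mulmx_ext => v; rewrite mul_mx_row -[LHS]hsubmxK; congr row_mx.
  have -> : f = lsubmx \o (fun y => row_mx (f y) (g y)).
    by apply/funext => y /=; rewrite row_mxKl.
  by rewrite (dM_comp s (sl _)) dM_euclid jac_lin mulmxA mul_rV_lin1.
have -> : g = rsubmx \o (fun y => row_mx (f y) (g y)).
  by apply/funext => y /=; rewrite row_mxKr.
by rewrite (dM_comp s (sr _)) dM_euclid jac_lin mulmxA mul_rV_lin1.
Qed.

(** The two components are realized along the slices [i1] and [i2] through [z] and then added. *)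
Lemma prod_tangent_ex M N (z : prod_manifold M N) (a : 'rV[R]_(dim M))
    (b : 'rV[R]_(dim N)) : exists v : 'rV[R]_(dim M + dim N),
  v *m @dM R (prod_manifold M N) M fst z = a /\
  v *m @dM R (prod_manifold M N) N snd z = b.
Proof.
pose MN := prod_manifold M N.
pose i1 (x : M) : MN := (x, z.2); pose i2 (y : N) : MN := (z.1, y).
have s1 : @smooth_at R M MN i1 z.1.
  by apply: smooth_at_pair; [exact: smooth_at_id|exact: smooth_at_cst].
have s2 : @smooth_at R N MN i2 z.2.
  by apply: smooth_at_pair; [exact: smooth_at_cst|exact: smooth_at_id].
have z1 : i1 z.1 = z by rewrite /i1 -surjective_pairing.
have z2 : i2 z.2 = z by rewrite /i2 -surjective_pairing.
have e (Q : manifold R) (i : Q -> MN) q : smooth_at i q -> i q = z ->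
    dM i q *m @dM R MN M fst z = dM (fst \o i : Q -> M) q /\
    dM i q *m @dM R MN N snd z = dM (snd \o i : Q -> N) q.
  move=> si <-; split.
    by rewrite -(dM_comp (P := M) si (smooth_at_fst _)).
  by rewrite -(dM_comp (P := N) si (smooth_at_snd _)).
have [e11 e12] := e _ _ _ s1 z1; have [e21 e22] := e _ _ _ s2 z2.
exists (a *m dM i1 z.1 + b *m dM i2 z.2).
rewrite !mulmxDl -!mulmxA e11 e12 e21 e22.
rewrite -[dM (fst \o i1) _]/(dM (@id M) _) -[dM (snd \o i2) _]/(dM (@id N) _).
rewrite -[dM (fst \o i2) _]/(dM (fun=> z.1) _) -[dM (snd \o i1) _]/(dM (fun=> z.2) _).
by rewrite !dM_id !dM_cst !mulmx1 !mulmx0 addr0 add0r.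
Qed.

Lemma germ_affine n m (a : 'rV[R]_m) (B : 'M[R]_(n, m)) w :
  germ_smooth (fun u : 'rV[R]_n => a + u *m B) w.
Proof.
have -> : (fun u : 'rV[R]_n => a + u *m B) = (fun=> a) \+ (fun u => u *m B) by [].
by apply: germ_add; [exact: germ_cst|exact: germ_mulmx].
Qed.

Lemma jac_affine n m (a : 'rV[R]_m) (B : 'M[R]_(n, m)) w :
  jac (fun u : 'rV[R]_n => a + u *m B) w = B.
Proof.
apply: mulmx_ext => v; rewrite (jacE v (germ_affine a B w)).
have gB := germ_mulmx B w.
have -> : (fun u : 'rV[R]_n => a + u *m B) = cst a + (fun u => u *m B) by [].
rewrite deriveD.
- by rewrite derive_cst add0r -(jacE v gB) jac_mulmx.
- exact: derivable_cst.
- by apply: diff_derivable; exact: germ_differentiable.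
Qed.

End DifferentialExtras.

(** * Discs transverse to the orbits *)

Section LocalTransversal.
Variables (R : realType) (G : smooth_groupoid R) (q : nat).
Local Notation src := (@src R G).
Local Notation tgt := (@tgt R G).

Definition transversal_at (T : manifold R) (tau : T -> obj G) (t : T) : Prop :=
  smooth_at tau t /\ forall a : 'rV[R]_(dim T),
    (a *m dM tau t <= orbit_tangent (unit_arr (tau t)))%MS -> a = 0.

Lemma complement_rows m n (A : 'M[R]_(m, n)) : (\rank A + q)%N = n ->
  exists B : 'M[R]_(q, n), forall a : 'rV[R]_q, (a *m B <= A)%MS -> a = 0.
Proof.
move=> e; have kE : \rank (A^C)%MS = q.
  by rewrite mxrank_compl -[X in (X - _)%N]e addKn.
case: q / kE {e}; exists (row_base (A^C)%MS) => a aA.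
apply: (row_free_inj (row_base_free (A^C)%MS)); rewrite mul0mx; apply/eqP.
rewrite -submx0 -(capmx_compl A) sub_capmx aA /=.
by rewrite -(eq_row_base (A^C)%MS) submxMl.
Qed.

Hypothesis rank0 : forall g : arr G, isotropy_rank g = 0%N.
Hypothesis dimq : (q + (dim (arr G) - dim (obj G)))%N = dim (obj G).

(* In a chart [c] at [x] the transversal is the affine map [aff] through      *)
(* [cmap c x] along a complement of the orbit. The map [th] sending (u, g) to *)
(* (src g, cmap c (tgt g) - u *m B) is a local diffeomorphism at (0, 1_x):    *)
(* injectivity of its differential at (u, 1_(tau u)) is transversality at u,  *)
(* and the solutions of [th (u, g) = (z, cmap c x)] are the arrows from z to  *)
(* [tau u].                                                                   *)
Lemma local_transversal (x : obj G) :
  exists (tau : euclid R q -> obj G) (U : set 'rV[R]_q) (N : set (obj G)),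
    [/\ open U, forall u, U u -> transversal_at tau u, open N, N x &
      forall z, N z -> exists u (g : arr G), [/\ U u, src g = z & tgt g = tau u]].
Proof.
have dimq' := dimq; set n := dim (obj G) in dimq' *; set m := dim (arr G) in dimq' *.
have nm : (n <= m)%N.
  by rewrite /n /m -(eqP (src_full (unit_arr x))) rank_leq_row.
have dE : (q + m = n + n)%N by rewrite -{2}dimq' -addnCA subnKC // addnC.
pose g0 := unit_arr x; pose c := chart_at x.
have ac : atlas c by exact: chart_at_atlas.
have cx : dom c x by exact: chart_at_dom.
have rO : (\rank (orbit_tangent g0) + q)%N = n.
  by rewrite -[X in _ = X]dimq' -(rank_orbit_tangent g0) rank0 addn0 addnC.
have [B BP] := complement_rows rO.
pose aff (u : 'rV[R]_q) : 'rV[R]_n := cmap c x + u *m B.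
pose tau (u : euclid R q) : obj G := cinv c (aff u).
have saff u : @smooth_at R (euclid R q) (euclid R n) aff u.
  by apply/smooth_at_euclid; exact: germ_affine.
have daff u : @dM R (euclid R q) (euclid R n) aff u = B.
  by rewrite dM_euclid jac_affine.
have aff0 : aff 0 = cmap c x by rewrite /aff mul0mx addr0.
have stau u : (cmap c @` dom c) (aff u) -> smooth_at tau u.
  move=> [y cy yE]; apply: (smooth_at_comp (saff u)).
  by rewrite -yE; exact: smooth_at_cinv.
pose EA : manifold R := prod_manifold (euclid R q) (arr G).
pose OE : manifold R := prod_manifold (obj G) (euclid R n).
pose C : 'M[R]_(n + q, n) := col_mx 1%:M (- B).
pose th1 (z : EA) : obj G := src z.2.
pose rr (z : EA) : 'rV[R]_(n + q) := row_mx (cmap c (tgt z.2)) z.1.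
pose th2 (z : EA) : 'rV[R]_n := rr z *m C.
pose th (z : EA) : OE := (th1 z, th2 z).
have th2E z : th2 z = cmap c (tgt z.2) - z.1 *m B.
  by rewrite /th2 /rr /C mul_row_col mulmx1 mulmxN.
have s1 z : smooth_at th1 z.
  exact: (smooth_at_comp (smooth_at_snd z) (src_smooth_at _)).
have sct z : dom c (tgt z.2) ->
    @smooth_at R EA (euclid R n) (fun z : EA => cmap c (tgt z.2)) z.
  move=> cz; apply: (smooth_at_comp (smooth_at_comp (smooth_at_snd z) (tgt_smooth_at _))).
  exact: smooth_at_cmap.
have sC w : @smooth_at R (euclid R (n + q)) (euclid R n) (mulmx^~ C) w.
  by apply/smooth_at_euclid; exact: germ_mulmx.
have s2 z : dom c (tgt z.2) -> @smooth_at R EA (euclid R n) th2 z.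
  move=> cz; have sr := smooth_at_row_mx (sct z cz) (smooth_at_fst z).
  exact: (smooth_at_comp sr (sC _)).
have sth z : dom c (tgt z.2) -> @smooth_at R EA OE th z.
  by move=> cz; apply: smooth_at_pair; [exact: s1|exact: s2].
have d1 z (v : 'rV[R]_(q + m)) : v *m dM th1 z =
    v *m @dM R EA (arr G) snd z *m dM src z.2.
  by rewrite -mulmxA -(dM_comp (smooth_at_snd z) (src_smooth_at _)).
have d2 z (v : 'rV[R]_(q + m)) : dom c (tgt z.2) ->
    v *m @dM R EA (euclid R n) th2 z =
    v *m @dM R EA (arr G) snd z *m dM tgt z.2 *m
      @dM R (obj G) (euclid R n) (cmap c) (tgt z.2)
    - v *m @dM R EA (euclid R q) fst z *m B.
  move=> cz; have sr := smooth_at_row_mx (sct z cz) (smooth_at_fst z).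
  have st := smooth_at_comp (smooth_at_snd z) (tgt_smooth_at z.2).
  have sc := smooth_at_cmap ac cz.
  rewrite (dM_comp sr (sC _)) dM_euclid jac_mulmx (dM_row_mx (sct z cz) (smooth_at_fst z)).
  rewrite /C mul_row_col mulmx1 mulmxN mulmxBr (mulmxA v _ B).
  congr (_ - _); rewrite -!mulmxA; congr (_ *m _).
  by rewrite (dM_comp st sc) (dM_comp (smooth_at_snd z) (tgt_smooth_at z.2)) mulmxA.
have dth z (v : 'rV[R]_(q + m)) : dom c (tgt z.2) -> v *m @dM R EA OE th z = 0 <->
    v *m dM th1 z = 0 /\ v *m @dM R EA (euclid R n) th2 z = 0.
  move=> cz.
  have e1 : v *m dM th1 z = v *m @dM R EA OE th z *m @dM R OE (obj G) fst (th z).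
    by rewrite -mulmxA -(dM_comp (P := obj G) (sth z cz) (smooth_at_fst _)).
  have e2 : v *m @dM R EA (euclid R n) th2 z =
      v *m @dM R EA OE th z *m @dM R OE (euclid R n) snd (th z).
    by rewrite -mulmxA -(dM_comp (P := euclid R n) (sth z cz) (smooth_at_snd _)).
  split=> [v0|[v1 v2]]; first by rewrite e1 e2 v0 !mul0mx.
  by apply: (@prod_dM_inj R (obj G) (euclid R n) (th z)); rewrite -?e1 -?e2.
pose z0 : EA := (0, g0).
have cz0 : dom c (tgt z0.2) by rewrite /= tgt_unit.
(* A kernel vector has its arrow component in $\ker ds$, with $dt$ of it equal to [a *m B]. This
   vector is tangent to the orbit, so [BP] gives [a = 0] and then [rank0] applies. *)
have fth : row_free (@dM R EA OE th z0).
  apply/row_free_ker0 => v /(dth _ _ cz0)[]; rewrite d1 d2 // => v1 v2.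
  have dc1 : @dM R (obj G) (euclid R n) (cmap c) (tgt z0.2) = 1%:M.
    by rewrite /= tgt_unit dM_cmap.
  move/eqP: v2; rewrite dc1 mulmx1 subr_eq0 => /eqP v2.
  have a0 : v *m @dM R EA (euclid R q) fst z0 = 0.
    by apply: BP; rewrite -v2; apply: submxMr; apply/sub_kermxP.
  apply: (@prod_dM_inj R (euclid R q) (arr G) z0) => //.
  apply: ((isotropy_rank_eq0 g0).1 (rank0 _)) => //.
  by rewrite v2 a0 mul0mx.
have [U' [h [[oU' U'z0 oV] [hU hV]]]] :=
  manifold_inverse (M := EA) (N := OE) dE (sth z0 cz0) fth.
have tau0 : tau 0 = x by rewrite /tau aff0 chart_cmapK.
pose k (u : euclid R q) : EA := (u, unit_arr (tau u)).
have sk u : (cmap c @` dom c) (aff u) -> smooth_at k u.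
  move=> iu; apply: smooth_at_pair; first exact: smooth_at_id.
  exact: (smooth_at_comp (stau u iu) (unit_smooth_at _)).
have k0 : k 0 = z0 by rewrite /k tau0.
have i0 : (cmap c @` dom c) (aff 0) by rewrite aff0; exists x.
have near0 : \forall u \near (0 : 'rV[R]_q), (cmap c @` dom c) (aff u) /\ U' (k u).
  have h1 : \forall u \near (0 : 'rV[R]_q), (cmap c @` dom c) (aff u).
    case: (saff 0) => ca _; apply: ca; rewrite aff0; exact: chart_near_img.
  have h2 : \forall u \near (0 : 'rV[R]_q), U' (k u).
    case: (sk 0 i0) => ck _; apply: ck; rewrite k0.
    by apply: open_nbhs_nbhs.
  by near=> u; split; near: u.
have /near_openP[U [oU U0 UP]] := near0.
have trU u : U u -> transversal_at tau u.
  move=> Uu; have [iu U'k] := UP u Uu; have sti := stau u iu.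
  have [ctu tuE] : dom c (tau u) /\ cmap c (tau u) = aff u by exact: (chart_cinvK iu).
  split=> // a /submxP[D aD].
  (* A lift to $\ker ds$ of the orbit vector [a *m dM tau u]: the pair [(a, w)] lies in the kernel
     of the differential of [th] at [k u], which is zero. *)
  pose w := D *m kermx (dM src (unit_arr (tau u))).
  have [v [va vw]] := @prod_tangent_ex R (euclid R q) (arr G) (k u) a w.
  have cku : dom c (tgt (k u).2) by rewrite /= tgt_unit.
  have skh : smooth_at h (th (k u)) by apply: hV; exists (k u).
  have fku := local_inverse_free oU' U'k (fun z Uz => (hU z Uz).1) (sth _ cku) skh.
  have cE : @dM R (euclid R q) (obj G) tau u *m
      @dM R (obj G) (euclid R n) (cmap c) (tau u) = B.
    have sc := smooth_at_cmap ac ctu.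
    rewrite -(dM_comp sti sc) -(daff u); symmetry.
    apply: (@dM_eq R (euclid R q) (euclid R n) aff (cmap c \o tau) u _ (saff u)).
    have : \forall u' \near u, U u' by exact: near_open.
    apply: filterS => u' /UP[iu' _]; symmetry.
    by have [_] := chart_cinvK iu'.
  have v0 : v = 0.
    apply: ((row_free_ker0 _).1 fku); apply/(dth _ _ cku); split.
      rewrite d1 vw; rewrite /w -mulmxA; have -> : (k u).2 = unit_arr (tau u) by [].
      by rewrite mulmx_ker mulmx0.
    rewrite d2 // va vw; have -> : (k u).2 = unit_arr (tau u) by [].
    rewrite tgt_unit /w -(mulmxA D) -/(orbit_tangent _) -aD -(mulmxA a) cE.
    by rewrite subrr.
  by rewrite -va v0 mul0mx.
have y0E : th z0 = (x, cmap c x).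
  by rewrite /th th2E /th1 /= src_unit tgt_unit mul0mx subr0.
(* The solution of [th (u, g) = (z, cmap c x)] given by [h] depends continuously on [z], so near [x]
   its components stay in [U] and in the chart. *)
have nearN : \forall z \near x, (th @` U') (z, cmap c x) /\
    (U (h (z, cmap c x)).1 /\ dom c (tgt (h (z, cmap c x)).2)).
  pose j (z : obj G) : OE := (z, cmap c x).
  have sj : smooth_at j x.
    by apply: smooth_at_pair; [exact: smooth_at_id|exact: smooth_at_cst].
  have thz0 : (th @` U') (j x) by exists z0.
  have h1 : \forall z \near x, (th @` U') (j z).
    by case: sj => cj _; apply: cj; apply: open_nbhs_nbhs.
  have hj : h (j x) = z0 by rewrite /j -y0E; have [] := hU _ U'z0.
  have shj := smooth_at_comp sj (hV _ thz0).
  have h2 : \forall z \near x, U (h (j z)).1.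
    have := smooth_at_comp shj (smooth_at_fst _).
    by case=> cf _; apply: cf; rewrite /= hj; exact: near_open.
  have h3 : \forall z \near x, dom c (tgt (h (j z)).2).
    have := smooth_at_comp (smooth_at_comp shj (smooth_at_snd _)) (tgt_smooth_at _).
    by case=> cf _; apply: cf; rewrite /= hj tgt_unit; exact: chart_near_dom.
  by near=> z; split; [near: z|split; near: z].
have /near_openP[N [oN Nx NP]] := nearN.
exists tau, U, N; split=> // z /NP[[[u g] U'z thE] [Uz cz]].
have [hz _] := hU _ U'z; rewrite thE in hz; rewrite hz /= in Uz cz.
exists u, g; case: thE => e1 e2; split=> //.
rewrite -[LHS](chart_cmapK cz) /tau /aff; congr (cinv c _).
by rewrite -e2 th2E subrK.
Unshelve. all: by end_near. Qed.

End LocalTransversal.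

(** * The discrete manifold of indices *)

Section NatManifold.
Variable R : realType.
Local Open Scope nat_scope.

Lemma nat_open (A : set nat) : open A.
Proof. exact: discrete_open. Qed.

Section NatChart.
Variable i : nat.
Let cm (_ : nat) : 'rV[R]_0 := 0%R.
Let ci (_ : 'rV[R]_0) : nat := i.
Let D : set nat := [set i].

Lemma nat_img_open : open (cm @` D).
Proof.
rewrite (_ : cm @` D = setT); first exact: openT.
by apply/seteqP; split=> // w _; exists i => //; rewrite [RHS]thinmx0.
Qed.

Lemma nat_cmapK : {in D, cancel cm ci}.
Proof. by move=> j; rewrite inE => ->. Qed.

Lemma nat_cmap_continuous : {in D, continuous cm}.
Proof. by move=> j _; exact: cst_continuous. Qed.

Lemma nat_cinv_continuous : {in cm @` D, continuous ci}.
Proof. by move=> j _; exact: cst_continuous. Qed.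

Definition nat_chart : chart R nat 0 :=
  Chart (@nat_open D) nat_img_open nat_cmapK nat_cmap_continuous nat_cinv_continuous.

End NatChart.

Lemma nat_cover (i : nat) : exists c, range nat_chart c /\ dom c i.
Proof. by exists (nat_chart i); split => //; exists i. Qed.

Lemma nat_compat c d : range nat_chart c -> range nat_chart d ->
  Cinfty (cmap c @` (dom c `&` dom d)) (cmap d \o cinv c).
Proof.
move=> [i _ <-] [j _ <-].
have oI : open (cmap (nat_chart i) @` (dom (nat_chart i) `&` dom (nat_chart j))).
  by apply: open_cmap_img; [exact: open_domI|exact: subIsetl].
apply/(Cinfty_germ _ oI) => w _; exact: germ_cst.
Qed.

Lemma nat_second_countable : @second_countable nat.
Proof.
exists (range (fun i : nat => [set i])).
  exact: (sub_countable (card_image_le _ _) (countableP _)).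
split=> [A _|i A Ai]; first exact: nat_open.
exists [set i]; first by split => //; exists i.
by move=> _ ->; exact: nbhs_singleton.
Qed.

Definition nat_manifold : manifold R := Manifold nat_cover nat_compat nat_second_countable.

End NatManifold.

(** * Countably many discs meeting all the orbits *)

Section Transversal.
Variables (R : realType) (G : smooth_groupoid R) (q : nat).
Hypothesis rank0 : forall g : arr G, isotropy_rank g = 0%N.
Hypothesis dimq : (q + (dim (arr G) - dim (obj G)))%N = dim (obj G).

(* [F i] is a transversal disc whose saturation contains the basic open set   *)
(* of index [i], if there is one, and is empty otherwise.                     *)
Lemma complete_transversal (x0 : obj G) :
  exists (T : manifold R) (tau : T -> obj G), [/\ hausdorff_space T, dim T = q,
    forall t, transversal_at tau t &
    forall x, exists t (g : arr G), src g = x /\ tgt g = tau t].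
Proof.
have [B cB [oB bB]] := manifold_second_countable (obj G).
have /countable_injP[f finj] := cB.
pose slicing := ((euclid R q -> obj G) * set 'rV[R]_q)%type.
pose good (s : slicing) := open s.2 /\ forall u, s.2 u -> transversal_at s.1 u.
pose covers (s : slicing) (N : set (obj G)) := forall z, N z ->
  exists u (g : arr G), [/\ s.2 u, src g = z & tgt g = s.1 u].
have Fex (i : nat) : exists s, good s /\ forall b,
    B b -> f b = i -> (exists s, good s /\ covers s b) -> covers s b.
  have [[b [Bb bi [s [gs cs]]]]|nb] := pselect (exists b, [/\ B b, f b = i &
      exists s, good s /\ covers s b]).
    exists s; split=> // b' Bb' b'i _.
    by rewrite (finj b' b) ?inE // b'i bi.
  exists (fun=> x0, set0); split.
    by split; [exact: open0|].
  by move=> b Bb bi sb; exfalso; apply: nb; exists b.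
have [F FP] := choice Fex.
pose NE : manifold R := prod_manifold (nat_manifold R) (euclid R q).
pose S : set NE := [set z | (F z.1).2 z.2].
(* The disjoint union of the discs is realized as an open subset of the product of the index
   manifold with $\mathbb{R}^q$. *)
have oS : open S.
  rewrite openE => -[i u] /= Su; have [[oU _] _] := FP i.
  exists ([set i], (F i).2) => /=; last by move=> [_ v] [/= -> ].
  by split; [exact: discrete_set1|exact: near_open].
pose T : manifold R := open_submanifold oS.
pose tau (t : T) : obj G := (F (incl t).1).1 (incl t).2.
pose p1 (t : T) : nat_manifold R := (incl t).1.
pose p2 (t : T) : euclid R q := (incl t).2.
have sp2 t : smooth_at p2 t.
  exact: (smooth_at_comp (incl_smooth t) (smooth_at_snd _)).
have trF i u : (F i).2 u -> transversal_at (F i).1 u.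
  by move=> Fu; have [[_ tr] _] := FP i; exact: tr.
(* The index is locally constant, so near [t] the map [tau] is that of a single disc. *)
have tauE (t : T) : \forall t' \near t, ((F (p1 t)).1 \o p2) t' = tau t'.
  have : \forall t' \near t, p1 t' = p1 t.
    have [c1 _] : smooth_at p1 t.
      exact: (smooth_at_comp (incl_smooth t) (smooth_at_fst _)).
    exact: (c1 _ (discrete_set1 (p1 t))).
  by apply: filterS => t' e; rewrite /tau -/(p1 t') e.
have sF (t : T) : smooth_at (F (p1 t)).1 (p2 t).
  by have [] := trF _ _ (inclP t).
have sc t := smooth_at_comp (sp2 t) (sF t).
exists T, tau; split=> //.
- have c_incl : continuous (fun t : T => incl t : NE).
    by move=> t; case: (incl_smooth t).
  apply: (injective_hausdorff (f := fun t : T => incl t : NE) _ c_incl).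
    exact: incl_inj.
  by apply: prod_hausdorff; [exact: discrete_hausdorff|exact: norm_hausdorff].
- move=> t; split; first exact: smooth_at_eq (tauE t) (sc t).
  move=> a; rewrite -(dM_eq (tauE t) (sc t)) (dM_comp (sp2 t) (sF t)) mulmxA => a1.
  have [_ tr] := trF _ _ (inclP t).
  have a0 : a *m dM p2 t = 0 by apply: tr.
  apply: ((row_free_ker0 _).1 (incl_free t)).
  apply: (@prod_dM_inj R (nat_manifold R) (euclid R q) (incl t)).
    exact: thinmx0.
  by rewrite -mulmxA -(dM_comp (incl_smooth t) (smooth_at_snd _)).
move=> x; have [tau' [U [N [oU tU oN Nx cN]]]] := local_transversal rank0 dimq x.
have [b [Bb bx] bN] := bB x N (open_nbhs_nbhs (conj oN Nx)).
have [_ /(_ b Bb erefl) cF] := FP (f b).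
have [|u [g [Fu gx gt]]] := cF _ x bx.
  exists (tau', U); split; first by split.
  by move=> z /bN; exact: cN.
by exists (to_sub (open_sliced oS) (q := (f b, u)) Fu), g.
Qed.

End Transversal.

Theorem theorem1 (R : realType) (G : smooth_groupoid R) :
  ((exists H : smooth_groupoid R, etale H /\ morita_equivalent G H) <->
     injective_anchor G) /\
  (injective_anchor G <-> discrete_isotropy G).
Proof.
split; last by split; [exact: injective_anchor_discrete|exact: discrete_injective_anchor].
split=> [[H [eH GH]]|/injective_anchorP aG].
  exact: etale_morita_injective_anchor eH GH.
have rank0 (g : arr G) : isotropy_rank g = 0%N by rewrite isotropy_rank_src.
(* The dimension count below needs a unit at which to compute ranks; a groupoid without objects is
   vacuously étale. *)
have [[x0 _]|nG] := pselect (exists x0 : obj G, True); last first.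
  exists G; split; last exact: essential_morita (id_essential G).
  by move=> g; exfalso; apply: nG; exists (src g).
pose q := (dim (obj G) - (dim (arr G) - dim (obj G)))%N.
(* The subtraction is exact: when $\kappa = 0$ the orbit tangent space has dimension
   [dim (arr G) - dim (obj G)], at most [dim (obj G)]. *)
have dimq : (q + (dim (arr G) - dim (obj G)))%N = dim (obj G).
  rewrite subnK // -(rank_orbit_tangent (unit_arr x0)) rank0 addn0.
  exact: rank_leq_col.
have [T [tau [hT dT trT sat]]] := complete_transversal rank0 dimq x0.
have stau t : smooth_at tau t by have [] := trT t.
have tra t (a : 'rV[R]_(dim T)) :
    (a *m dM tau t <= orbit_tangent (unit_arr (tau t)))%MS -> a = 0 by have [_] := trT t; exact.
have dimT : (dim T + (dim (arr G) - dim (obj G)))%N = dim (obj G) by rewrite dT.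
exists (restriction hT stau rank0 tra dimT); split.
  exact: restriction_etale.
exact: (essential_morita (restriction_essential hT stau rank0 tra dimT sat)).
Qed.
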